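(* Suppose that $K\in\mathbb{L}_1(\mathbb{R})$, that there are constants $\beta>0$, $\overline{\kappa}>0$ with $|\widehat K(\omega)|\le\overline\kappa(1+|\omega|^2)^{-\beta/2}$ for all $\omega\in\mathbb{R}$, and that $|\widehat K(\omega)|\ne0$ for all $\omega$. Let $a,L>0$ and $m\ge1$ be fixed, and let $\mathcal{F}_m=\mathcal{F}_m(a,L)$. Then, for sufficiently small $\varepsilon$, the minimax risk over the class $\mathcal{F}_m$ is bounded from below as follows: 1. (Regular case.) If $\beta>1/2$, then $$R^*_\varepsilon[\mathcal{F}_m]\ge c_1^*\,a^{-1}L^{(2\beta-1)/(2\beta+2m+1)}\,\varepsilon^{(2m+2)/(2m+2\beta+1)},$$ where $c_1^*>0$ does not depend on $a,L$. 2. (Singular case.) If $0<\beta\le1/2$, then $$R^*_\varepsilon[\mathcal{F}_m]\ge\begin{cases}c_2^*\,\varepsilon\left(\ln\frac1\varepsilon\right)^{-1/2},&\text{if }\beta=1/2,\\ c_3^*\,\varepsilon^{2/(2\beta+1)},&\text{if }0<\beta<1/2,\end{cases}$$ where $c_2^*,c_3^*>0$ are constants.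
   Context: Fourier transform: $\widehat g(\omega)=\int_{-\infty}^\infty g(x)e^{2\pi i\omega x}\,dx$ for $g\in\mathbb{L}_1(\mathbb{R})\cap\mathbb{L}_2(\mathbb{R})$, extended to $\mathbb{L}_2(\mathbb{R})$ as usual (and given by the same integral on $\mathbb{L}_1(\mathbb{R})$). Functions $f$, $K$ are real-valued. Model: for unknown $f\in\mathbb{L}_2(\mathbb{R})$ one observes $dY(x)=(\mathsf{K}f)(x)\,dx+\varepsilon\,dW(x)$, $x\in\mathbb{R}$, where $W$ is a standard two-sided Wiener process on $\mathbb{R}$, $0<\varepsilon<1$, and $(\mathsf{K}f)(x)=\int_{-\infty}^\infty K(x-y)f(y)\,dy$ with known $K\in\mathbb{L}_1(\mathbb{R})$. $\mathbb{E}_f$ is expectation with respect to the law $\mathbb{P}_f$ of the observations for given $f$. Change-point: $f(x\pm)=\lim_{t\to x\pm}f(t)$, $[f](x)=f(x+)-f(x-)$; $\theta$ is a change-point of $f$ if $[f](\theta)\ne0$ and $f(\theta+),f(\theta-)$ are finite. Classes: $\mathcal{F}_1(a,L)$ is the set of $f\in\mathbb{L}_2(\mathbb{R})$ having a single change-point $\theta\in[0,1]$ such that $|[f](\theta)|\ge a$ and $|f(x)-f(x')|\le L|x-x'|$ for all $x\le x'$ with $\theta\notin[x,x']$. For $m>1$, $\mathcal{F}_m(a,L)$ is the set of $f\in\mathbb{L}_2(\mathbb{R})$ having a single change-point $\theta\in[0,1]$ such that: (i) $|[f](\theta)|\ge a$; (ii) $f'(x)$ exists for all $x\ne\theta$ and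 $[f'](\theta)=0$, so that the function $g_f$ defined by $g_f(x)=f'(x)$ for $x\neq\theta$, $g_f(\theta)=f'(\theta\pm)$ is continuous; (iii) $g_f\in\mathbb{L}_2(\mathbb{R})$ and $\int_{-\infty}^\infty|\widehat g_f(\omega)||\omega|^{m-1}\,d\omega\le L$. Risk: for an estimator $\hat\theta$ based on $Y$ and a class $\mathcal{G}$ of functions $f$ with a single change-point $\theta=\theta(f)\in[0,1]$, $R_\varepsilon[\hat\theta;\mathcal{G}]=\sup_{f\in\mathcal{G}}\{\mathbb{E}_f|\hat\theta-\theta|^2\}^{1/2}$. The minimax risk is $R^*_\varepsilon[\mathcal{G}]=\inf_{\hat\theta}R_\varepsilon[\hat\theta;\mathcal{G}]$, the infimum being over all estimators (measurable functions of the observations). *)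

(* Defs.v *)
From HB Require Import structures.
From mathcomp Require Import all_boot all_order all_algebra.
From mathcomp Require Import all_classical all_reals all_analysis.
From mathcomp Require Import complex.

Set Implicit Arguments.
Unset Strict Implicit.
Unset Printing Implicit Defensive.
Import Order.TTheory GRing.Theory Num.Theory.
Import numFieldNormedType.Exports.
Local Open Scope classical_set_scope.
Local Open Scope ring_scope.

Notation lebR R := (@lebesgue_measure R).

(* The integral of g(x) e^(2 pi i omega x), for real-valued g in L_1. *)
Definition fourier (R : realType) (g : R -> R) (omega : R) : R[i] :=
  Complex (\int[lebR R]_x (g x * cos (2 * pi * omega * x)))
          (\int[lebR R]_x (g x * sin (2 * pi * omega * x))).

(* G is (a version of) the Fourier transform of g in L_2, by continuous
   extension from L_1 `&` L_2.  By Plancherel's theorem G is unique up to a null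
   set and does not depend on the approximating sequence. *)
Definition is_fourier_L2 (R : realType) (g : R -> R) (G : R -> R[i]) : Prop :=
  [/\ measurable_fun setT (fun omega => complex.Re (G omega)),
      measurable_fun setT (fun omega => complex.Im (G omega)) &
      exists u : nat -> R -> R,
        [/\ forall n, u n \in Lfun (lebR R) 1%E /\ u n \in Lfun (lebR R) 2%:E,
            (\int[lebR R]_x ((u n x - g x) ^+ 2)%:E)%E @[n --> \oo] --> 0%E &
            (\int[lebR R]_omega
               ((Normc.normc (fourier (u n) omega - G omega)) ^+ 2)%:E)%E
              @[n --> \oo] --> 0%E]].

Definition jump (R : realType) (f : R -> R) (x : R) : R :=
  lim (f t @[t --> x^'+]) - lim (f t @[t --> x^'-]).

Definition change_point (R : realType) (f : R -> R) (theta : R) : Prop :=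
  [/\ cvg (f t @[t --> theta^'+]), cvg (f t @[t --> theta^'-])
    & jump f theta != 0].

Definition single_change_point (R : realType) (f : R -> R) (theta : R) : Prop :=
  [/\ 0 <= theta <= 1, change_point f theta &
      forall theta', change_point f theta' -> theta' = theta].

Definition class_F1 (R : realType) (a L : R) : set (R -> R) :=
  [set f | f \in Lfun (lebR R) 2%:E /\
    exists theta, [/\ single_change_point f theta, a <= `|jump f theta| &
      forall x x', x <= x' -> ~ (x <= theta <= x') ->
        `|f x - f x'| <= L * `|x - x'|]].

(* The function g_f; the value at theta is f'(theta+), which class_Fgt1 requires to
   coincide with f'(theta-). *)
Definition deriv_ext (R : realType) (f : R -> R) (theta : R) (x : R) : R :=
  if x == theta then lim (derive1 f t @[t --> theta^'+]) else derive1 f x.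

Definition class_Fgt1 (R : realType) (m a L : R) : set (R -> R) :=
  [set f | f \in Lfun (lebR R) 2%:E /\
    exists theta,
      [/\ single_change_point f theta, a <= `|jump f theta|,
          [/\ forall x, x != theta -> derivable f x 1,
              cvg (derive1 f t @[t --> theta^'+]),
              cvg (derive1 f t @[t --> theta^'-]),
              jump (derive1 f) theta = 0 &
              continuous (deriv_ext f theta)] &
          deriv_ext f theta \in Lfun (lebR R) 2%:E /\
          exists2 G : R -> R[i], is_fourier_L2 (deriv_ext f theta) G &
            (\int[lebR R]_omega (Normc.normc (G omega) * `|omega| `^ (m - 1))%:E
               <= L%:E)%E]].

(* Meant for real m >= 1. *)
Definition class_F (R : realType) (m a L : R) : set (R -> R) :=
  if m == 1 then class_F1 a L else class_Fgt1 m a L.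

(* The second parameter of normal_prob is the standard deviation.  Increments are
   independent over consecutive intervals anywhere in R, including to the left of
   0; together with W 0 = 0 this makes (W t)_{t >= 0} and (W (- t))_{t >= 0}
   independent one-sided Wiener processes. *)
Definition two_sided_wiener (R : realType) (d : measure_display)
    (T : measurableType d) (P : probability T R) (W : R -> T -> R) : Prop :=
  [/\ forall t, measurable_fun setT (W t),
      {ae P, forall w, W 0 w = 0},
      {ae P, forall w, continuous (W^~ w)},
      (forall s t, s < t -> forall A : set R, measurable A ->
         P [set w | A (W t w - W s w)] =
         normal_prob 0 (Num.sqrt (t - s)) A) &
      (forall (n : nat) (t : nat -> R) (A : nat -> set R),
         (forall i, (i < n)%N -> t i <= t i.+1) ->
         (forall i, measurable (A i)) ->
         P (\bigcap_(i < n) [set w | A i (W (t i.+1) w - W (t i) w)]) =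
         (\prod_(i < n) P [set w | A i (W (t i.+1) w - W (t i) w)%R])%E)].

(* For K in L_1 and f in L_2 the integrand is integrable for almost every x only;
   the null set of other x does not affect the observations. *)
Definition convolution (R : realType) (K f : R -> R) (x : R) : R :=
  \int[lebR R]_y (K (x - y) * f y).

Definition primitive0 (R : realType) (g : R -> R) (x : R) : R :=
  if 0 <= x then \int[lebR R]_(u in `[0, x]) g u
  else - \int[lebR R]_(u in `[x, 0]) g u.

(* dY = (K f) dx + eps dW, in integrated form, normalized by Y(0) = eps W(0). *)
Definition observation (R : realType) (T : Type) (K : R -> R) (eps : R)
    (W : R -> T -> R) (f : R -> R) (w : T) : R -> R :=
  fun x => primitive0 (convolution K f) x + eps * W x w.

(* The sigma-algebra on paths is generated by the coordinate maps. *)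
Definition coordinate_sets (R : realType) : set (set (R -> R)) :=
  [set C | exists x : R, exists2 A : set R, measurable A &
     C = [set y : R -> R | A (y x)]].

Notation path_space R := (g_sigma_algebraType (@coordinate_sets R)).

Notation estimator R := {mfun path_space R >-> R}.

(* For f with a single change-point the value theta below is that point. *)
Definition risk (R : realType) (d : measure_display) (T : measurableType d)
    (P : probability T R) (W : R -> T -> R) (K : R -> R) (eps : R)
    (thetahat : estimator R) (G : set (R -> R)) : \bar R :=
  ereal_sup [set r | exists f theta, [/\ G f, change_point f theta &
    r = poweR ('E_P[fun w =>
          (`|thetahat (observation K eps W f w) - theta| ^+ 2)%R])%E 2^-1]].

Definition minimax_risk (R : realType) (d : measure_display)
    (T : measurableType d) (P : probability T R) (W : R -> T -> R)
    (K : R -> R) (eps : R) (G : set (R -> R)) : \bar R :=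
  ereal_inf [set risk P W K eps thetahat G | thetahat in [set: estimator R]].

(* b <= R^*_eps[G] in the model with noise level eps.  The laws P_f are those of
   the observation built on any probability space carrying a two-sided Wiener
   process; the bound is required on each of them, which keeps the constants in
   b independent of the choice of that space. *)
Definition minimax_risk_ge (R : realType) (K : R -> R) (eps : R)
    (G : set (R -> R)) (b : R) : Prop :=
  forall (d : measure_display) (T : measurableType d) (P : probability T R)
    (W : R -> T -> R), two_sided_wiener P W ->
  (b%:E <= minimax_risk P W K eps G)%E.

(* Main.v *)
Require Import Defs.
From HB Require Import structures.
From mathcomp Require Import all_boot all_order all_algebra.
From mathcomp Require Import all_classical all_reals all_analysis.
From mathcomp Require Import measurable_realfun complex.
From mathcomp Require Import ring lra.
Import Order.TTheory GRing.Theory Num.Theory.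
Import numFieldNormedType.Exports.
Local Open Scope classical_set_scope.
Local Open Scope ring_scope.
Set Implicit Arguments.
Unset Strict Implicit.
Unset Printing Implicit Defensive.

(** An estimator cannot tell two functions apart when their images under the convolution with K
  are at L_2 distance at most eps. So if the class contains two such functions with change-points
  0 and d, the minimax risk is at least d / 8; each rate is the order of the d for which such a
  pair is constructed.

  Statistics. The two observations are eps W plus a drift. Girsanov's formula is avoided by
  considering the three laws P_0, P_1, P_2 whose drifts are in arithmetic progression.
  For one Gaussian increment, Cauchy-Schwarz gives P_1(A)^2 <= exp(tau^2) P_0(A) P_2(A), where
  tau is the normalized shift ([normal_prob_sqr_le]). Increments are independent, so this
  multiplies to P_1^2 <= exp(sum of the tau^2) P_0 P_2 on rectangles, where the sum is bounded by
  the energy of the drift difference over eps^2, hence by 1. The linear consequence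
  P_1 <= 4 P_0 + P_2 / 4 is stable under disjoint unions and monotone limits, so that it holds for
  all measurable sets of paths ([drift_law_le]); applied to the set where the estimate is closer
  to d than to 0, it gives [two_point_minimax_risk].

  Hypotheses. With p_s the centred Gaussian density of scale s and Phi_s its distribution
  function, the functions are
    f_d = a (1_(x > 0) - Phi_s + G * box - box),
  where box is the indicator of the interval ]0, d] and G is a linear combination of Gaussian
  densities. Subtracting box moves the jump of size a from 0 to d, and G * box is a smooth
  compensation with nearly the same low frequencies. Outside of the jump f_d is a combination of
  Gaussian distribution functions, so the requirements of the class are bounds on Gaussian moments
  ([class_F_hypothesis_fun]): if G has scale t, they read
    a s^-m + a d t^-(m+1) <= L up to constants.
  The difference f_d - f_0 = a (G * box - box) has the transform a (Ghat - 1) boxhat, and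
  Plancherel's inequality ([convolution_L2_le]) bounds the energy of the drift difference by the
  integral of |Khat|^2 a^2 (1 - Ghat)^2 |boxhat|^2 ([two_hypotheses_minimax]).

  Rates. If beta > 1/2, choose G with 1 - Ghat(w) = (1 - exp(-2 pi^2 t^2 w^2))^k, which is of order
  (t w)^(2k) at frequencies below 1 / t ([binomial_mixture_hat]); since |boxhat| <= d and |Khat|^2
  decays at least like w^(-2 beta), the energy is at most of order (a d)^2 t^(2 beta - 1) ([regular_energy_le]).
  Equating it to eps^2 and a d t^-(m+1) to L determines t and d. If beta <= 1/2, take G = 0: the
  energy, of order a^2 times the integral of (1 + w^2)^-beta min(d^2, w^-2), is
  at most of order d^(2 beta + 1) if beta < 1/2 and d^2 ln(1/d) if beta = 1/2 ([singular_energy_le]). *)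

(** * Integrable functions on the line *)

Notation L1 f := ((@lebesgue_measure _).-integrable setT (EFin \o f)).

Lemma L1_measurable (R : realType) (f : R -> R) :
  L1 f -> measurable_fun setT f.
Proof. by move=> /measurable_int/measurable_EFinP. Qed.

Lemma L1_le (R : realType) (f g : R -> R) :
  measurable_fun setT f -> L1 g -> (forall x, `|f x| <= g x) -> L1 f.
Proof.
move=> mf ig fg; apply: le_integrable ig => //; first exact/measurable_EFinP.
by move=> x _ /=; rewrite lee_fin (le_trans (fg x))// ler_norm.
Qed.

Lemma L1Z (R : realType) (c : R) (f : R -> R) : L1 f -> L1 (fun x => c * f x).
Proof.
move=> f1; have := integrableZl measurableT c f1.
by apply: eq_integrable => // x _ /=; rewrite EFinM.
Qed.

Lemma L1D (R : realType) (f g : R -> R) :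
  L1 f -> L1 g -> L1 (fun x => f x + g x).
Proof.
move=> f1 g1; have := integrableD measurableT f1 g1.
by apply: eq_integrable => // x _ /=; rewrite EFinD.
Qed.

Lemma L1B (R : realType) (f g : R -> R) :
  L1 f -> L1 g -> L1 (fun x => f x - g x).
Proof.
move=> f1 g1; have := integrableB measurableT f1 g1.
by apply: eq_integrable => // x _ /=; rewrite EFinB.
Qed.

Lemma L1_sum (R : realType) (I : Type) (s : seq I) (f : I -> R -> R) :
  (forall i, L1 (f i)) -> L1 (fun x => \sum_(i <- s) f i x).
Proof.
move=> f1; elim: s => [|i s IH].
  have := @integrable0 _ _ R (@lebesgue_measure R) setT.
  by apply: eq_integrable => // x _ /=; rewrite big_nil.
have := L1D (f1 i) IH.
by apply: eq_integrable => // x _ /=; rewrite big_cons.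
Qed.

Lemma L1_norm (R : realType) (f : R -> R) : L1 f -> L1 (fun x => `|f x|).
Proof. exact: integrable_norm. Qed.

Lemma L1M_bounded (R : realType) (f b : R -> R) (C : R) :
  L1 f -> measurable_fun setT b -> (forall x, `|b x| <= C) ->
  L1 (fun x => f x * b x).
Proof.
move=> f1 mb bC; apply: (@L1_le _ _ (fun x => C * `|f x|)).
- by apply: measurable_funM => //; exact: L1_measurable.
- exact/L1Z/L1_norm.
- by move=> x; rewrite normrM mulrC ler_wpM2r.
Qed.

Lemma eRintegral (R : realType) (f : R -> R) : L1 f ->
  (\int[@lebesgue_measure R]_x (f x)%:E)%E = (\int[@lebesgue_measure R]_x f x)%:E.
Proof. by move=> f1; rewrite /Rintegral fineK//; exact: integrable_fin_num. Qed.

Lemma Rintegral_sum (R : realType) (I : Type) (s : seq I) (f : I -> R -> R) :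
  (forall i, L1 (f i)) ->
  \int[@lebesgue_measure R]_x (\sum_(i <- s) f i x) =
  \sum_(i <- s) \int[@lebesgue_measure R]_x f i x.
Proof.
move=> f1; elim: s => [|i s IH].
  rewrite big_nil /Rintegral -[RHS]/(fine 0%E) -(integral0 (@lebesgue_measure R) setT).
  by congr fine; apply: eq_integral => x _; rewrite big_nil.
rewrite big_cons -IH -RintegralD//; last exact: L1_sum.
by apply: eq_Rintegral => x _; rewrite big_cons.
Qed.

Section affine.
Variables (R : realType) (c d : R).
Hypothesis c0 : 0 < c.
Let phi : measurableTypeR R -> measurableTypeR R := fun x => c * x + d.

Let mphi : measurable_fun setT phi.
Proof. by apply: measurable_funD => //; apply: measurable_funM. Qed.

Lemma affine_measurable (f : R -> R) : measurable_fun setT f ->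
  measurable_fun setT (fun x => f (c * x + d)).
Proof. by move=> mf; exact: (measurableT_comp mf mphi). Qed.

Lemma lebesgue_measure_affine (A : set R) : measurable A ->
  (@lebesgue_measure R) A =
  pushforward (mscale (NngNum (ltW c0)) (@lebesgue_measure R)) phi A.
Proof.
move=> mA.
pose nu : {measure set (measurableTypeR R) -> \bar R} :=
  measure_function_pushforward__canonical__measure_function_Measure
    (mscale (NngNum (ltW c0)) (@lebesgue_measure R)) mphi.
rewrite -[RHS]/(nu A); apply: lebesgue_measure_unique => //.
move=> _ [[a b]] _ <-.
rewrite /nu /= /pushforward /mscale.
have -> : phi @^-1` [set` `]a, b]] = [set` `](a - d) / c, (b - d) / c]].
  apply/seteqP; split => x; rewrite /= /phi !in_itv/= ltr_pdivrMr// ler_pdivlMr//;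
  by rewrite ltrBlDr lerBrDr mulrC.
rewrite lebesgue_measure_itv/= [X in _ = (_ * X)%E]lebesgue_measure_itv/= !lte_fin ltr_pM2r ?invr_gt0// ltrD2r.
case: ifPn => ab; last by rewrite mule0.
rewrite -!EFinB -EFinM; congr EFin.
by field; exact: lt0r_neq0.
Qed.

Lemma ge0_integral_affine (f : R -> \bar R) : measurable_fun setT f ->
  (forall x, 0 <= f x)%E ->
  (\int[@lebesgue_measure R]_x f x =
   c%:E * \int[@lebesgue_measure R]_x f (c * x + d)%R)%E.
Proof.
move=> mf f0.
have mfp : measurable_fun setT (f \o phi) by exact: (measurableT_comp mf mphi).
have := @ge0_integral_pushforward _ _ _ _ R phi mphi
  (mscale (NngNum (ltW c0)) (@lebesgue_measure R)) setT f
  measurableT mf (fun x _ => f0 x).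
rewrite preimage_setT ge0_integral_mscale//; last by move=> x _; exact: f0.
move=> <-; apply: eq_measure_integral => A mA _.
exact: lebesgue_measure_affine.
Qed.

Lemma L1_affine (f : R -> R) : L1 f -> L1 (fun x => f (c * x + d)).
Proof.
move=> f1; have mf := L1_measurable f1; apply/integrableP; split.
  by apply/measurable_EFinP; exact: affine_measurable.
have /integrableP[_] := f1.
rewrite (@ge0_integral_affine (fun x => `|(f x)%:E|)%E)//; last first.
  exact/measurable_EFinP/measurableT_comp.
move=> h; rewrite ltey; apply/eqP => hy; move: h; rewrite hy.
by rewrite gt0_muley// ltxx.
Qed.

Lemma Rintegral_affine (f : R -> R) : L1 f ->
  \int[@lebesgue_measure R]_x f x = c * \int[@lebesgue_measure R]_x f (c * x + d).
Proof.
move=> f1; have fa := L1_affine f1.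
apply/EFin_inj; rewrite EFinM -!eRintegral//.
have mEf : measurable_fun setT (EFin \o f) by exact: measurable_int f1.
have p := ge0_integral_affine (measurable_funepos mEf) (funepos_ge0 _).
have n := ge0_integral_affine (measurable_funeneg mEf) (funeneg_ge0 _).
have pE : (fun x => (f (c * x + d))%:E)^\+%E =
    (fun x => (EFin \o f)^\+%E (c * x + d)).
  by apply/funext => x; rewrite !funeposE.
have nE : (fun x => (f (c * x + d))%:E)^\-%E =
    (fun x => (EFin \o f)^\-%E (c * x + d)).
  by apply/funext => x; rewrite !funenegE.
rewrite integralE p n [in RHS]integralE pE nE [in RHS]muleBr//.
by rewrite -nE; apply: fin_num_adde_defl; rewrite fin_numN; exact: integrable_neg_fin_num fa.
Qed.
End affine.

Lemma ge0_integral_opp (R : realType) (f : R -> \bar R) : measurable_fun setT f ->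
  (forall x, 0 <= f x)%E ->
  (\int[@lebesgue_measure R]_x f x = \int[@lebesgue_measure R]_x f (- x)%R)%E.
Proof.
move=> mf f0.
pose phi : measurableTypeR R -> measurableTypeR R := fun x => - x.
have mphi : measurable_fun setT phi by exact: measurableT_comp.
have := @ge0_integral_pushforward _ _ _ _ R phi mphi (@lebesgue_measure R) setT f
  measurableT mf (fun x _ => f0 x).
rewrite preimage_setT /comp /phi => <-.
apply: eq_measure_integral => A mA _.
exact/esym/lebesgue_measureN.
Qed.

Lemma L1_opp (R : realType) (f : R -> R) : L1 f -> L1 (fun x => f (- x)).
Proof.
move=> f1; have mf := L1_measurable f1; apply/integrableP; split.
  by apply/measurable_EFinP; apply: (measurableT_comp mf).
have /integrableP[_] := f1.
rewrite (@ge0_integral_opp _ (fun x => `|(f x)%:E|)%E)//.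
exact/measurable_EFinP/measurableT_comp.
Qed.

Lemma Rintegral_opp (R : realType) (f : R -> R) : L1 f ->
  \int[@lebesgue_measure R]_x f x = \int[@lebesgue_measure R]_x f (- x).
Proof.
move=> f1; congr fine.
have mEf : measurable_fun setT (EFin \o f) by exact: measurable_int f1.
have p := ge0_integral_opp (measurable_funepos mEf) (funepos_ge0 _).
have n := ge0_integral_opp (measurable_funeneg mEf) (funeneg_ge0 _).
have pE : (fun x => (f (- x))%:E)^\+%E = (fun x => (EFin \o f)^\+%E (- x)).
  by apply/funext => x; rewrite !funeposE.
have nE : (fun x => (f (- x))%:E)^\-%E = (fun x => (EFin \o f)^\-%E (- x)).
  by apply/funext => x; rewrite !funenegE.
by rewrite integralE p n [in RHS]integralE pE nE.
Qed.

Lemma L1_shift (R : realType) (f : R -> R) (d : R) : L1 f -> L1 (fun x => f (x - d)).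
Proof.
move=> f1; have := L1_affine (- d) (@ltr01 R) f1.
by apply: eq_integrable => // x _ /=; rewrite mul1r.
Qed.

Lemma Rintegral_shift (R : realType) (f : R -> R) (d : R) : L1 f ->
  \int[@lebesgue_measure R]_x f (x - d) = \int[@lebesgue_measure R]_x f x.
Proof.
move=> f1; rewrite [RHS](Rintegral_affine (- d) (@ltr01 R) f1) mul1r.
by apply: eq_Rintegral => x _; rewrite mul1r.
Qed.

Lemma L1_reflect (R : realType) (f : R -> R) (d : R) : L1 f -> L1 (fun x => f (d - x)).
Proof.
move=> /L1_opp/(L1_shift d).
by apply: eq_integrable => // x _ /=; rewrite opprB.
Qed.

Lemma Rintegral_reflect (R : realType) (f : R -> R) (d : R) : L1 f ->
  \int[@lebesgue_measure R]_x f (d - x) = \int[@lebesgue_measure R]_x f x.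
Proof.
move=> f1; rewrite [RHS]Rintegral_opp// -(Rintegral_shift d (L1_opp f1)).
by apply: eq_Rintegral => x _; rewrite opprB.
Qed.

Lemma Rdominated_cvg (R : realType) (f_ : nat -> R -> R) (f g : R -> R) :
  (forall n, measurable_fun setT (f_ n)) -> measurable_fun setT f -> L1 g ->
  {ae (@lebesgue_measure R), forall x, f_ n x @[n --> \oo] --> f x} ->
  (forall n x, `|f_ n x| <= g x) ->
  \int[@lebesgue_measure R]_x f_ n x @[n --> \oo] --> \int[@lebesgue_measure R]_x f x.
Proof.
move=> mf_ mf g1 cv dom.
have h1 : {ae (@lebesgue_measure R), forall x, setT x ->
    (fun n => (f_ n x)%:E) @ \oo --> (f x)%:E}.
  apply: filterS cv; first exact: (ae_filter_ringOfSetsType (@lebesgue_measure R)).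
  move=> x cvx _; apply: cvg_EFin => //; exact: nearW.
have h2 : {ae (@lebesgue_measure R), forall x n, setT x ->
    (`|(f_ n x)%:E| <= (EFin \o g) x)%E}.
  by apply: aeW => x n _ /=; rewrite lee_fin.
have [f1 _ cvI] := @dominated_convergence _ _ R (@lebesgue_measure R) setT measurableT
  (fun n x => (f_ n x)%:E) (EFin \o f) (EFin \o g)
  (fun n => (measurable_EFinP _ _).2 (mf_ n)) ((measurable_EFinP _ _).2 mf) h1 g1 h2.
move: cvI; rewrite /= eRintegral//.
have -> : (fun n => \int[@lebesgue_measure R]_x (f_ n x)%:E)%E =
   (fun n => (\int[@lebesgue_measure R]_x f_ n x)%:E).
  by apply/funext => n; rewrite eRintegral//; apply: L1_le g1 _.
by move=> /fine_cvg.
Qed.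

Section Fubini.
Variable R : realType.
Notation mu := (@lebesgue_measure R).

Lemma prodM_integrable (F : R * R -> R) (b : R * R -> R) (C : R) :
  (mu \x mu)%E.-integrable setT (EFin \o F) ->
  measurable_fun setT b -> (forall z, `|b z| <= C) ->
  (mu \x mu)%E.-integrable setT (EFin \o (fun z => F z * b z)).
Proof.
move=> iF mb bC; have mF : measurable_fun setT F.
  by apply/measurable_EFinP; exact: measurable_int iF.
have iC := integrableZl measurableT C (integrable_norm iF).
apply: le_integrable iC => //.
  exact/measurable_EFinP/measurable_funM.
move=> z _ /=; rewrite lee_fin normrM.
have C0 : 0 <= C by exact: le_trans (bC (0, 0)).
by rewrite normrM (ger0_norm C0) normr_id mulrC ler_wpM2r.
Qed.

Lemma prod_L1 (u w : R -> R) : L1 u -> L1 w ->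
  (mu \x mu)%E.-integrable setT (EFin \o (fun z : R * R => u z.1 * w z.2)).
Proof.
move=> u1 w1; have mu1 := L1_measurable u1; have mw1 := L1_measurable w1.
apply/integrable12ltyP.
  apply/measurable_EFinP; apply: measurable_funM.
    exact: (measurableT_comp mu1).
  exact: (measurableT_comp mw1).
have -> : (fun x => \int[mu]_y `|(EFin \o (fun z : R * R => (u z.1 * w z.2)%R)) (x, y)|)%E
  = (fun x => `|u x|%:E * (\int[mu]_y `|w y|)%:E)%E.
  apply/funext => x; rewrite -eRintegral; last exact: L1_norm.
  rewrite -ge0_integralZl//.
  - by apply: eq_integral => y _ /=; rewrite normrM EFinM.
  - by apply/measurable_EFinP; exact: measurableT_comp.
rewrite ge0_integralZr//; last 2 first.
- by apply/measurable_EFinP; exact: measurableT_comp.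
- by rewrite lee_fin Rintegral_ge0.
rewrite eRintegral; last exact: L1_norm.
by rewrite -EFinM ltry.
Qed.

Lemma conv_L1 (K h : R -> R) : L1 K -> L1 h ->
  (mu \x mu)%E.-integrable setT (EFin \o (fun z : R * R => K (z.1 - z.2) * h z.2)).
Proof.
move=> K1 h1; have mK := L1_measurable K1; have mh := L1_measurable h1.
apply/integrable21ltyP.
  apply/measurable_EFinP; apply: measurable_funM.
    by apply: (measurableT_comp mK); exact: measurable_funB.
  exact: (measurableT_comp mh).
have -> : (fun y => \int[mu]_x `|(EFin \o (fun z : R * R => (K (z.1 - z.2) * h z.2)%R)) (x, y)|)%E
  = (fun y => `|h y|%:E * (\int[mu]_x `|K x|)%:E)%E.
  apply/funext => y.
  rewrite -(Rintegral_shift y (L1_norm K1)) -eRintegral; last first.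
    exact: (L1_shift y (L1_norm K1)).
  rewrite -ge0_integralZl//.
  - by apply: eq_integral => x _ /=; rewrite normrM mulrC EFinM.
  - by apply/measurable_EFinP; apply/measurableT_comp => //; apply/(measurableT_comp mK)/measurable_funB.
rewrite ge0_integralZr//; last 2 first.
- by apply/measurable_EFinP; exact: measurableT_comp.
- by rewrite lee_fin Rintegral_ge0.
rewrite eRintegral; last exact: L1_norm.
by rewrite -EFinM ltry.
Qed.

Lemma L1_Fubini (F : R -> R -> R) :
  (mu \x mu)%E.-integrable setT (EFin \o (fun z : R * R => F z.1 z.2)) ->
  (forall x, L1 (F x)) -> L1 (fun x => \int[mu]_y F x y).
Proof.
move=> iF F1.
have := @integrable_fubini_F _ _ _ _ R mu mu _ iF.
apply: eq_integrable => // x _.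
by rewrite /fubini_F /= -eRintegral.
Qed.

Lemma RFubini (F : R -> R -> R) :
  (mu \x mu)%E.-integrable setT (EFin \o (fun z : R * R => F z.1 z.2)) ->
  (forall x, L1 (F x)) -> (forall y, L1 (F^~ y)) ->
  \int[mu]_x (\int[mu]_y F x y) = \int[mu]_y (\int[mu]_x F x y).
Proof.
move=> iF F1 F2.
have := @Fubini _ _ _ _ R mu mu _ iF => /= h; congr fine.
transitivity (\int[mu]_x \int[mu]_y (F x y)%:E)%E.
  by apply: eq_integral => x _; rewrite -eRintegral.
by rewrite h; apply: eq_integral => y _; rewrite -eRintegral//; exact: F2.
Qed.
End Fubini.

(** * Set inequalities between measures *)

(** Finite disjoint unions of members of [Q], presented as the preimages under
  maps to a finite type whose fibres are in [Q]: in this form complements and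
  intersections need no rewriting of unions. *)
Definition finite_partition_sets (T : Type) (Q : set (set T)) : set (set T) :=
  [set C | exists (J : finType) (Z : T -> J) (S : {set J}),
     C = Z @^-1` [set j | j \in S] /\ forall j, Q (Z @^-1` [set j])].

Lemma finite_partition_setC (T : Type) (Q : set (set T)) C :
  finite_partition_sets Q C -> finite_partition_sets Q (~` C).
Proof.
move=> [J [Z [S [-> QZ]]]]; exists J, Z, (finset.setC S); split => //.
by apply/seteqP; split => x /=; rewrite finset.in_setC => /negP.
Qed.

Lemma finite_partition_setU (T : Type) (Q : set (set T)) : setI_closed Q ->
  setU_closed (finite_partition_sets Q).
Proof.
move=> QI _ _ [J [Z [S [-> QZ]]]] [J' [Z' [S' [-> QZ']]]].
exists (J * J')%type, (fun x => (Z x, Z' x)),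
  [set j : J * J' | (j.1 \in S) || (j.2 \in S')]%SET; split.
  apply/seteqP; split => x /=; rewrite inE /=.
    by move=> [->|->] //; rewrite orbT.
  by move=> /orP[->|->]; [left|right].
move=> [j j']; have := QI _ _ (QZ j) (QZ' j').
congr Q; apply/seteqP; split => x /=; first by move=> [-> ->].
by move=> [-> ->].
Qed.

Section set_inequality.
Context d (T : measurableType d) (R : realType).
Variables (P0 P1 P2 : {measure set T -> \bar R}) (b c : R).
Hypotheses (b0 : 0 <= b) (c0 : 0 <= c).
Hypotheses (P0T : (P0 setT < +oo)%E) (P1T : (P1 setT < +oo)%E)
  (P2T : (P2 setT < +oo)%E).

Definition dominated_set (E : set T) :=
  measurable E /\ (P1 E <= b%:E * P0 E + c%:E * P2 E)%E.

Let fin (P : {measure set T -> \bar R}) E : (P setT < +oo)%E -> measurable E ->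
  (P E < +oo)%E.
Proof. by move=> PT mE; apply: le_lt_trans PT; apply: le_measure; rewrite ?inE. Qed.

Let cvg_dominated (F : (set T)^nat) (E : set T) :
  (forall i, dominated_set (F i)) -> measurable E ->
  (forall P : {measure set T -> \bar R}, (P setT < +oo)%E ->
     P (F n) @[n --> \oo] --> P E) ->
  dominated_set E.
Proof.
move=> FD mE cv; split => //.
have fE (P : {measure set T -> \bar R}) : (P setT < +oo)%E -> P E \is a fin_num.
  by move=> PT; rewrite ge0_fin_numE//; exact: fin.
have cvR : (b%:E * P0 (F n) + c%:E * P2 (F n))%E @[n --> \oo] -->
    (b%:E * P0 E + c%:E * P2 E)%E.
  apply: cvgeD; first by apply: fin_num_adde_defl; rewrite fin_numM// fE.
    by apply: cvgeZl => //; exact: cv.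
  by apply: cvgeZl => //; exact: cv.
by apply: (lee_cvg_to (cv _ P1T) cvR); apply: nearW => n; case: (FD n).
Qed.

(** Continuity of finite measures makes the inequality survive monotone limits,
  so that it passes from an algebra to the sigma-algebra. *)
Lemma dominated_sigma_algebra (A : set (set T)) :
  A setT -> (forall C, A C -> A (~` C)) -> setU_closed A ->
  A `<=` dominated_set -> <<s A >> `<=` dominated_set.
Proof.
move=> AT hC AU Adom.
have AI X Y : A X -> A Y -> A (X `&` Y).
  by move=> AX AY; rewrite -[_ `&` _]setCK setCI; apply: (hC); apply: AU; exact: (hC).
have ringA : setring A.
  split => //; first by rewrite -setCT; exact: (hC).
  by move=> X Y AX AY; rewrite setDE; apply: AI => //; exact: (hC).
have sub : <<s A >> `<=` <<sr A >>.
  apply: smallest_sub; last by move=> X AX; apply: sub_gen_smallest.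
  have [h0 hD hU] := @smallest_sigma_ring T A.
  split => // X sX; apply: hD => //; exact: sub_gen_smallest.
apply: (subset_trans sub); apply: monotone_setring_sub_g_sigma_ring => //.
split => F mono FD.
  have mU : measurable (\bigcup_i F i) by apply: bigcupT_measurable => i; case: (FD i).
  apply: (cvg_dominated FD) => // P PT; apply: nondecreasing_cvg_mu => // i.
  by case: (FD i).
have mU : measurable (\bigcap_i F i) by apply: bigcapT_measurable => i; case: (FD i).
apply: (cvg_dominated FD) => // P PT; apply: nonincreasing_cvg_mu => //.
  by apply: fin => //; case: (FD 0%N).
by move=> i; case: (FD i).
Qed.

Lemma finite_partition_dominated Q : Q `<=` dominated_set ->
  finite_partition_sets Q `<=` dominated_set.
Proof.
move=> Qd _ [J [Z [S [-> QZ]]]].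
have -> : [set j | j \in S] = [set j | j \in enum S].
  by apply/seteqP; split => j /=; rewrite mem_enum.
elim: (enum S) => [|a s IH].
  have -> : Z @^-1` [set j | j \in [::]] = set0 by apply/seteqP; split.
  by split => //; rewrite !measure0 !mule0 add0e.
have [mIH leIH] := IH; have [ma lea] := Qd _ (QZ a).
have -> : Z @^-1` [set j | j \in a :: s] =
    Z @^-1` [set a] `|` Z @^-1` [set j | j \in s].
  apply/seteqP; split => x /=; rewrite inE.
    by move=> /orP[/eqP|]; [left|right].
  by move=> [->|->]; rewrite ?eqxx ?orbT.
have [as_|nas] := boolP (a \in s).
  suff -> : Z @^-1` [set a] `|` Z @^-1` [set j | j \in s] =
      Z @^-1` [set j | j \in s] by [].
  apply/seteqP; split => x /=; first by move=> [->|].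
  by move=> ?; right.
split; first exact: measurableU.
have dj : Z @^-1` [set a] `&` Z @^-1` [set j | j \in s] = set0.
  by apply/seteqP; split => x //= [->]; rewrite (negbTE nas).
rewrite !measureU// (le_trans (leeD lea leIH))// !ge0_muleDr//.
by rewrite addeACA.
Qed.

End set_inequality.

(** A product bound can be checked on linear combinations, which are stable under addition of
  measures: the square is recovered by optimizing over [mu]. *)
Lemma lincomb_sqr_le (R : realType) (a b c d : R) :
  0 <= a -> 0 <= b -> 0 <= c -> 0 <= d ->
  (forall mu : R, 0 < mu -> 2 * a <= c * (mu * b + d / mu)) ->
  a ^+ 2 <= c ^+ 2 * b * d.
Proof.
move=> a0 b0 c0 d0 h.
have small (x y : R) : 0 <= x -> 0 <= y ->
    (forall mu : R, 0 < mu -> x <= y * mu) -> x = 0.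
  move=> x0 y0 hxy; apply/eqP; rewrite eq_le x0 andbT.
  have [y1|yn0] := eqVneq y 0; first by rewrite (le_trans (hxy 1 ltr01))// y1 mul0r.
  rewrite leNgt; apply/negP => x1.
  have yp : 0 < y by rewrite lt0r yn0.
  have := hxy (x / (2 * y)) _; rewrite divr_gt0 ?mulr_gt0// => /(_ isT).
  have -> : y * (x / (2 * y)) = x / 2 by field.
  lra.
have [b1|bn0] := eqVneq b 0.
  have -> : a = 0.
    apply: (@small _ (c * d / 2)) => //; first by rewrite divr_ge0 ?mulr_ge0.
    move=> mu mu0; have := h mu^-1; rewrite invr_gt0 mu0 => /(_ isT).
    rewrite b1 mulr0 add0r invrK; lra.
  by rewrite expr0n /= mulr_ge0 ?mulr_ge0 ?exprn_ge0.
have [d1|dn0] := eqVneq d 0.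
  have -> : a = 0.
    apply: (@small _ (c * b / 2)) => //; first by rewrite divr_ge0 ?mulr_ge0.
    move=> mu mu0; have := h mu mu0.
    rewrite d1 mul0r addr0; lra.
  by rewrite expr0n /= mulr_ge0 ?mulr_ge0 ?exprn_ge0.
have bp : 0 < b by rewrite lt0r bn0.
have dp : 0 < d by rewrite lt0r dn0.
pose s := Num.sqrt b; pose t := Num.sqrt d.
have sp : 0 < s by rewrite sqrtr_gt0.
have tp : 0 < t by rewrite sqrtr_gt0.
have bs : b = s ^+ 2 by rewrite sqr_sqrtr.
have dt : d = t ^+ 2 by rewrite sqr_sqrtr.
have := h (t / s); rewrite divr_gt0// => /(_ isT).
have -> : t / s * b + d / (t / s) = 2 * (s * t).
  by rewrite bs dt; field; rewrite !lt0r_neq0.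
move=> h2; have h3 : a <= c * (s * t) by lra.
rewrite bs dt -mulrA -exprMn -exprMn ler_sqr// nnegrE//.
by rewrite mulr_ge0// mulr_ge0// ltW.
Qed.

Section normal_shift.
Variable R : realType.
Notation mu := (@lebesgue_measure R).

Lemma normal_prob_shift (s c : R) (B : set R) : measurable B ->
  normal_prob 0 s [set x | B (x + c)] = (\int[mu]_(x in B) (normal_pdf 0 s (x - c))%:E)%E.
Proof.
move=> mB; rewrite /normal_prob.
rewrite integral_mkcond [RHS]integral_mkcond.
pose f x := if x \in B then (normal_pdf 0 s (x - c))%:E else 0%E.
have mf : measurable_fun setT (((fun x => (normal_pdf 0 s (x - c))%:E) \_ B) : R -> \bar R).
  apply/(measurable_restrict _ mB measurableT) => //; rewrite setTI.
  apply/measurable_EFinP; apply: measurable_funTS.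
  apply: (measurableT_comp (measurable_normal_pdf 0 s)).
  exact: measurable_funB.
rewrite (ge0_integral_affine c (@ltr01 R) mf); last first.
  by move=> x; apply: erestrict_ge0 => y _; rewrite lee_fin normal_pdf_ge0.
rewrite mul1e; apply: eq_integral => x _.
rewrite !patchE mul1r addrK.
by congr (if _ then _ else _); apply/idP/idP; rewrite !inE.
Qed.

(** Cauchy-Schwarz, since the density of N(t, s^2) is exp(t^2 / (2 s^2)) times the
  geometric mean of those of N(0, s^2) and N(2 t, s^2). *)
Lemma normal_prob_sqr_le (s t : R) (B : set R) : 0 < s -> measurable B ->
  fine (normal_prob 0 s [set x | B (x + t)]) ^+ 2 <=
  expR (t ^+ 2 / s ^+ 2) * fine (normal_prob 0 s B) *
    fine (normal_prob 0 s [set x | B (x + 2 * t)]).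
Proof.
move=> s0 mB0; have mB : @measurable _ (measurableTypeR R) B := mB0.
have mBc c : measurable [set x | B (x + c)].
  rewrite -[X in measurable X]setTI.
  by apply: (measurable_funD (@measurable_id _ _ setT) (@measurable_cst _ _ _ _ setT c)).
have i c : mu.-integrable B (EFin \o (fun x => normal_pdf 0 s (x - c))).
  apply: (@integrableS _ _ _ _ setT) => //.
  by apply: L1_shift; exact: integrable_normal_pdf.
have pE c : normal_prob 0 s [set x | B (x + c)] =
   (\int[mu]_(x in B) (normal_pdf 0 s (x - c)))%:E.
  rewrite normal_prob_shift// /Rintegral fineK//.
  exact: (@integrable_fin_num _ (measurableTypeR R) _ mu B mB _ (i c)).
have p0E : normal_prob 0 s B = (\int[mu]_(x in B) (normal_pdf 0 s (x - 0)))%:E.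
  by rewrite -pE; congr normal_prob; apply/seteqP; split => x /=; rewrite addr0.
rewrite p0E !pE /=.
have -> : expR (t ^+ 2 / s ^+ 2) = expR (t ^+ 2 / (2 * s ^+ 2)) ^+ 2.
  rewrite -expRM_natl; congr expR; field; exact: lt0r_neq0.
apply: lincomb_sqr_le; rewrite ?expR_ge0//; try by
  apply: Rintegral_ge0 => x _; exact: normal_pdf_ge0.
move=> l l0.
have iZ (r c : R) : mu.-integrable B (EFin \o (fun x => r * normal_pdf 0 s (x - c))).
  have := integrableZl mB r (i c).
  by apply: eq_integrable => // x _ /=; rewrite EFinM.
have iD : mu.-integrable B (EFin \o (fun x => l * normal_pdf 0 s (x - 0) +
    l^-1 * normal_pdf 0 s (x - 2 * t))).
  have := integrableD mB (integrableZl mB l (i 0)) (integrableZl mB l^-1 (i (2 * t))).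
  by apply: eq_integrable => // x _ /=; rewrite EFinD !EFinM.
rewrite (mulrC _ l^-1) -!RintegralZl// -RintegralD//.
rewrite -RintegralZl//; apply: le_Rintegral => //.
  have := integrableZl mB (expR (t ^+ 2 / (2 * s ^+ 2))) iD.
  by apply: eq_integrable => // x _ /=; rewrite EFinM.
move=> x _.
have sn0 : s != 0 by exact: lt0r_neq0.
rewrite !normal_pdfE// /normal_fun !subr0.
set k := normal_peak s; have k0 : 0 <= k by exact: normal_peak_ge0.
pose u := expR (- x ^+ 2 / (4 * s ^+ 2)).
pose v := expR (- (x - 2 * t) ^+ 2 / (4 * s ^+ 2)).
have -> : expR (- x ^+ 2 / (s ^+ 2 *+ 2)) = u ^+ 2.
  by rewrite -expRM_natl; congr expR; field.
have -> : expR (- (x - 2 * t) ^+ 2 / (s ^+ 2 *+ 2)) = v ^+ 2.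
  by rewrite -expRM_natl; congr expR; field.
have -> : expR (- (x - t) ^+ 2 / (s ^+ 2 *+ 2)) = expR (t ^+ 2 / (2 * s ^+ 2)) * (u * v).
  by rewrite -!expRD; congr expR; field.
rewrite [leLHS](_ : _ = expR (t ^+ 2 / (2 * s ^+ 2)) * (k * (2 * (u * v)))); last by ring.
apply: ler_wpM2l; first exact: expR_ge0.
rewrite [leRHS](_ : _ = k * (l * u ^+ 2 + l^-1 * v ^+ 2)); last by ring.
apply: ler_wpM2l => //.
have -> : l * u ^+ 2 + l^-1 * v ^+ 2 = 2 * (u * v) + l^-1 * (l * u - v) ^+ 2.
  by field; exact: lt0r_neq0.
by rewrite lerDl mulr_ge0 ?sqr_ge0// invr_ge0 ltW.
Qed.
End normal_shift.

(** * Cylinder sets of the path space *)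

(** A rectangle constrains the increments along a finite grid [t] and the value at time 0. The
  law of such a set factorizes, while the coordinates at finitely many times are functions of
  these increments and of that value. *)
Section cylinders.
Variable R : realType.
Implicit Types (t : nat -> R) (n : nat).

Definition increment_rect n t : set (set (R -> R)) :=
  [set E | exists A0 (A : nat -> set R), [/\ measurable A0,
     forall i, measurable (A i) &
     E = [set y : R -> R | A0 (y 0) /\ forall i, (i < n)%N -> A i (y (t i.+1) - y (t i))]]].

Lemma increment_rect_setI n t : setI_closed (increment_rect n t).
Proof.
move=> _ _ [A0 [A [mA0 mA ->]]] [B0 [B [mB0 mB ->]]].
exists (A0 `&` B0), (fun i => A i `&` B i); split.
- exact: measurableI.
- by move=> i; exact: measurableI.
apply/seteqP; split => y /=.
  by move=> [[? hA] [? hB]]; split => // i ni; split; [exact: hA|exact: hB].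
by move=> [[? ?] h]; split; split => // i /h[].
Qed.

Lemma coordinate_measurable (x : R) :
  measurable_fun setT (fun y : path_space R => y x).
Proof.
move=> _ A mA; rewrite setTI; apply: sub_sigma_algebra.
by exists x, A.
Qed.

Lemma increment_rect_measurable n t (E : set (path_space R)) :
  increment_rect n t E -> measurable E.
Proof.
move=> [A0 [A [mA0 mA ->]]].
have -> : [set y : R -> R | A0 (y 0) /\
      (forall i, (i < n)%N -> A i (y (t i.+1) - y (t i)))] =
   [set y : path_space R | A0 ((y : R -> R) 0)] `&` \bigcap_i
     [set y : path_space R | (i < n)%N -> A i ((y : R -> R) (t i.+1) - (y : R -> R) (t i))].
  by apply/seteqP; split => y /= [h1 h2]; split => // i; [move=> _; exact: h2|exact: h2].
apply: measurableI.
  by have := @coordinate_measurable 0 measurableT A0 mA0; rewrite setTI.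
apply: bigcapT_measurable => i; have [ni|ni] := boolP (i < n)%N; last first.
  rewrite (_ : [set _ | _] = setT); last by apply/seteqP; split.
  exact: measurableT.
rewrite (_ : [set _ | _] =
    [set y : path_space R | A i ((y : R -> R) (t i.+1) - (y : R -> R) (t i))]); last first.
  by apply/seteqP; split => y /= h //; exact: h.
have mD : measurable_fun setT
    (fun y : path_space R => (y : R -> R) (t i.+1) - (y : R -> R) (t i)).
  by apply: measurable_funB; exact: coordinate_measurable.
by have := mD measurableT (A i) (mA i); rewrite setTI.
Qed.

Definition sigma_rect n t := <<s finite_partition_sets (increment_rect n t) >>.

(** The events depending on the coordinates in [s]; all events depending on finitely many
  coordinates form an algebra that generates the sigma-algebra of the path space. *)
Definition sigma_coord (s : seq R) : set (set (R -> R)) :=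
  <<s [set C | exists x, x \in s /\
        exists2 A : set R, measurable A & C = [set y : R -> R | A (y x)]] >>.

Lemma sigma_coord_sub (s s' : seq R) : {subset s <= s'} ->
  sigma_coord s `<=` sigma_coord s'.
Proof.
move=> ss'; apply: sub_smallest2r => // _ [x [xs [A mA ->]]].
by exists x; split; [exact: ss'|exists A].
Qed.

Lemma increment_in_sigma_rect n t i (A : set R) : (i < n)%N -> measurable A ->
  sigma_rect n t [set y : R -> R | A (y (t i.+1) - y (t i))].
Proof.
move=> ni mA; apply: sub_gen_smallest.
exists bool, (fun y : R -> R => `[< A (y (t i.+1) - y (t i)) >]), [set true]%SET; split.
  by apply/seteqP; split => y /=; rewrite finset.in_set1 eqb_id; [move/asboolP|move/asboolP].
move=> b; exists setT, (fun j => if j == i then (if b then A else ~` A) else setT); split => //.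
  by move=> j; case: ifP => // _; case: b => //; exact: measurableC.
apply/seteqP; split => y /=.
  move=> <-; split => // j nj; case: eqP => // ->.
  by case: asboolP.
move=> [_ /(_ i ni)]; rewrite eqxx; case: b => h; apply/asboolP => //.
Qed.

Lemma start_in_sigma_rect n t (A : set R) : measurable A ->
  sigma_rect n t [set y : R -> R | A (y 0)].
Proof.
move=> mA; apply: sub_gen_smallest.
exists bool, (fun y : R -> R => `[< A (y 0) >]), [set true]%SET; split.
  by apply/seteqP; split => y /=; rewrite finset.in_set1 eqb_id; [move/asboolP|move/asboolP].
move=> b; exists (if b then A else ~` A), (fun j => setT); split => //.
  by case: b => //; exact: measurableC.
apply/seteqP; split => y /=.
  by move=> <-; split => //; case: asboolP.
by move=> [h _]; case: b h => h; apply/asboolP.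
Qed.

(** Coordinates are sums of increments, anchored at the time 0 which is
  among the [t k]. *)
Lemma sigma_coord_sub_rect n t (s : seq R) :
  (exists2 k, (k <= n)%N & t k = 0) ->
  (forall x, x \in s -> exists2 k, (k <= n)%N & t k = x) ->
  sigma_coord s `<=` sigma_rect n t.
Proof.
move=> [k0 k0n tk0] hs.
pose M := g_sigma_algebraType (finite_partition_sets (increment_rect n t)).
have m0 : measurable_fun setT (fun y : M => (y : R -> R) 0).
  by move=> _ A mA; rewrite setTI; exact: start_in_sigma_rect.
have mI i : (i < n)%N ->
    measurable_fun setT (fun y : M => (y : R -> R) (t i.+1) - (y : R -> R) (t i)).
  by move=> ni _ A mA; rewrite setTI; exact: increment_in_sigma_rect.
have mD i : (i <= n)%N ->
    measurable_fun setT (fun y : M => (y : R -> R) (t i) - (y : R -> R) (t 0%N)).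
  elim: i => [_|i IH ni].
    rewrite (_ : (fun _ => _) = cst 0); first exact: measurable_cst.
    by apply/funext => y; rewrite subrr.
  rewrite (_ : (fun _ => _) = (fun y : M => ((y : R -> R) (t i.+1) - (y : R -> R) (t i)) +
     ((y : R -> R) (t i) - (y : R -> R) (t 0%N)))); last first.
    by apply/funext => y; rewrite addrA subrK.
  by apply: measurable_funD; [exact: mI|exact: IH (ltnW ni)].
have mC i : (i <= n)%N -> measurable_fun setT (fun y : M => (y : R -> R) (t i)).
  move=> ni.
  rewrite (_ : (fun _ => _) = (fun y : M => ((y : R -> R) (t i) - (y : R -> R) (t 0%N)) -
     ((y : R -> R) (t k0) - (y : R -> R) (t 0%N)) + (y : R -> R) 0)); last first.
    by apply/funext => y; rewrite tk0; ring.
  by apply: measurable_funD => //; apply: measurable_funB; exact: mD.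
apply: smallest_sub; first exact: smallest_sigma_algebra.
move=> _ [x [/hs[k kn <-] [A mA ->]]].
by have := mC k kn measurableT A mA; rewrite setTI.
Qed.

Lemma coordinate_sets_sub :
  <<s @coordinate_sets R >> `<=` <<s \bigcup_s sigma_coord s >>.
Proof.
apply: smallest_sub; first exact: smallest_sigma_algebra.
move=> _ [x [A mA ->]]; apply: sub_gen_smallest.
exists [:: x] => //; apply: sub_gen_smallest.
by exists x; rewrite inE eqxx; split => //; exists A.
Qed.

Lemma sigma_coord_setT s : sigma_coord s setT.
Proof.
have [h0 hC _] := @smallest_sigma_algebra _ setT [set C | exists x, x \in s /\
        exists2 A : set R, measurable A & C = [set y : R -> R | A (y x)]].
by have := hC _ h0; rewrite setD0.
Qed.

Lemma sigma_coord_setC s C : sigma_coord s C -> sigma_coord s (~` C).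
Proof.
have [h0 hC _] := @smallest_sigma_algebra _ setT [set C | exists x, x \in s /\
        exists2 A : set R, measurable A & C = [set y : R -> R | A (y x)]].
by move=> /hC; rewrite setTD.
Qed.

Lemma bigcup_sigma_coord_setU : setU_closed (\bigcup_s sigma_coord s).
Proof.
move=> C D [s _ sC] [s' _ sD]; exists (s ++ s') => //.
have {}sC : sigma_coord (s ++ s') C.
  by apply: sigma_coord_sub sC => x xs; rewrite mem_cat xs.
have {}sD : sigma_coord (s ++ s') D.
  by apply: sigma_coord_sub sD => x xs; rewrite mem_cat xs orbT.
have [h0 hC hU] := @smallest_sigma_algebra _ setT [set C | exists x, x \in (s ++ s') /\
        exists2 A : set R, measurable A & C = [set y : R -> R | A (y x)]].
rewrite -bigcup2E; apply: hU => -[|[|i]] //=.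
Qed.

Lemma sorted_grid (s : seq R) : exists n t,
  [/\ forall i, (i < n)%N -> t i <= t i.+1,
      (exists2 k, (k <= n)%N & t k = 0) &
      forall x, x \in s -> exists2 k, (k <= n)%N & t k = x].
Proof.
pose s' := sort <=%R (0 :: s).
have sz : size s' = (size s).+1 by rewrite size_sort.
have mem x : x \in 0 :: s -> exists2 k, (k <= size s)%N & nth 0 s' k = x.
  move=> xs; have xs' : x \in s' by rewrite mem_sort.
  exists (index x s'); last exact: nth_index.
  by rewrite -ltnS -sz index_mem.
exists (size s), (nth 0 s'); split.
- move=> i ni; apply: (sorted_leq_nth le_trans le_refl) => //.
  + by apply: sort_sorted; exact: le_total.
  + by rewrite inE sz ltnS ltnW.
  + by rewrite inE sz ltnS.
- by apply: mem; rewrite inE eqxx.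
- by move=> x xs; apply: mem; rewrite inE xs orbT.
Qed.

End cylinders.

(** * Change of drift in the white noise model *)

Section drift.
Variables (R : realType) (d : measure_display) (T : measurableType d)
  (P : probability T R) (W : R -> T -> R).
Hypothesis hW : two_sided_wiener P W.
Variables (eps : R) (U H : R -> R).
Hypotheses (eps0 : 0 < eps) (U00 : U 0 = 0) (H00 : H 0 = 0).
Hypothesis energy : forall n (t : nat -> R), (forall i, (i < n)%N -> t i <= t i.+1) ->
  \sum_(i < n) (H (t i.+1) - H (t i)) ^+ 2 / (t i.+1 - t i) <= eps ^+ 2.

(** For j = 0 and j = 1 these are the observations under the two hypotheses; j = 2 extrapolates. *)
Definition drift_path (j : R) (w : T) : path_space R :=
  fun x => U x + j * H x + eps * W x w.

Let mW x : measurable_fun setT (W x).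
Proof. by have [+ _ _ _ _] := hW; exact. Qed.

Lemma measurable_drift_path j : measurable_fun setT (drift_path j).
Proof.
apply: (@measurability _ _ T (path_space R) setT (drift_path j) (@coordinate_sets R)) => //.
move=> _ [_ [x [A mA ->]] <-].
have mx : measurable_fun setT (fun w => U x + j * H x + eps * W x w).
  by apply: measurable_funD => //; apply: measurable_funM.
exact: mx.
Qed.

(** Paths start at 0 almost surely only, so that a constraint on the initial value
  amounts to a constant factor 0 or 1. *)
Let start_as (X : set T) (A0 : set R) : measurable X -> measurable A0 ->
  P (X `&` [set w | A0 (eps * W 0 w)]) = if `[< A0 0 >] then P X else 0%E.
Proof.
move=> mX mA0; have [_ [N [mN N0 sN]] _ _ _] := hW.
have mZ : measurable [set w | A0 (eps * W 0 w)].
  have m0 : measurable_fun setT (fun w => eps * W 0 w) by apply: measurable_funM.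
  by have := m0 measurableT A0 mA0; rewrite setTI.
have le0 (Y : set T) : measurable Y -> Y `<=` N -> P Y = 0%E.
  move=> mY YN; apply/eqP; rewrite eq_le measure_ge0 andbT -N0.
  by apply: le_measure; rewrite ?inE.
case: asboolP => A00.
  rewrite [RHS](measureDI P mX mZ) [X in (X + _)%E]le0 ?add0e//.
    exact: measurableD.
  move=> w [_ /= nA]; apply: sN => /= w0; apply: nA.
  by rewrite w0 mulr0.
apply: le0; first exact: measurableI.
move=> w [_ /= hA]; apply: sN => /= w0; apply: A00.
by rewrite w0 mulr0 in hA.
Qed.

(** The increment is Gaussian with a mean that is affine in j. *)
Lemma increment_sqr_le (s t : R) (A : set R) (q : R -> R) :
  s <= t -> measurable A ->
  q = (fun j => fine (P [set w | A (drift_path j w t - drift_path j w s)])) ->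
  q 1 ^+ 2 <= expR ((H t - H s) ^+ 2 / (t - s) / eps ^+ 2) * (q 0 * q 2).
Proof.
move=> st mA ->{q}; have [_ _ _ hN _] := hW.
set q := fun j => fine (P [set w | A (drift_path j w t - drift_path j w s)]).
rewrite -/(q 0) -/(q 1) -/(q 2).
have en0 : eps != 0 by exact: lt0r_neq0.
have [ts|tns] := eqVneq s t.
  have qE j : q j = q 0.
    rewrite /q; congr (fine (P _)); apply/seteqP; split => w /=;
    by rewrite /drift_path ts !subrr.
  by rewrite !qE ts !subrr invr0 mulr0 mul0r expR0 mul1r expr2.
have slt : s < t by rewrite lt_neqAle tns.
pose B := [set x | A (U t - U s + eps * x)].
have mB : measurable B.
  have mf : measurable_fun setT (fun x : R => U t - U s + eps * x).
    by apply: measurable_funD => //; apply: measurable_funM.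
  by have := mf measurableT A mA; rewrite setTI.
pose tau := (H t - H s) / eps.
pose sg := Num.sqrt (t - s).
have sg0 : 0 < sg by rewrite sqrtr_gt0 subr_gt0.
have mBc c : measurable [set x | B (x + c)].
  have mf : measurable_fun setT (fun x : R => x + c) by apply: measurable_funD.
  by have := mf measurableT B mB; rewrite setTI.
have qE j : q j = fine (normal_prob 0 sg [set x | B (x + j * tau)]).
  rewrite /q -(hN s t slt _ (mBc _)); congr (fine (P _)).
  apply/seteqP; split => w /=; rewrite /drift_path /B /=;
  by congr A; rewrite /tau; field.
have -> : (H t - H s) ^+ 2 / (t - s) / eps ^+ 2 = tau ^+ 2 / sg ^+ 2.
  rewrite /sg sqr_sqrtr; last by rewrite subr_ge0.
  have tsn : t - s != 0 by rewrite subr_eq0 eq_sym.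
  by rewrite /tau; field; rewrite ?tsn ?en0.
have := normal_prob_sqr_le tau sg0 mB.
rewrite !qE mul1r mulrA.
have -> : [set x | B (x + 0 * tau)] = B.
  by apply/seteqP; split => x /=; rewrite mul0r addr0.
by [].
Qed.

Lemma rect_probability n (t : nat -> R) (j : R) (A0 : set R) (A : nat -> set R) :
  (forall i, (i < n)%N -> t i <= t i.+1) -> measurable A0 ->
  (forall i, measurable (A i)) ->
  P (drift_path j @^-1` [set y | A0 (y 0) /\
        forall i, (i < n)%N -> A i (y (t i.+1) - y (t i))]) =
  (if `[< A0 0 >] then
    \prod_(i < n) fine (P [set w | A i (drift_path j w (t i.+1) - drift_path j w (t i))])
   else 0)%:E.
Proof.
move=> tS mA0 mA; have [_ _ _ _ hI] := hW.
pose A' i := [set x | A i (U (t i.+1) - U (t i) + j * (H (t i.+1) - H (t i)) + eps * x)].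
have mA' i : measurable (A' i).
  have mf : measurable_fun setT (fun x : R =>
      U (t i.+1) - U (t i) + j * (H (t i.+1) - H (t i)) + eps * x).
    by apply: measurable_funD => //; apply: measurable_funM.
  by have := mf measurableT (A i) (mA i); rewrite setTI.
have A'E i : [set w | A i (drift_path j w (t i.+1) - drift_path j w (t i))] =
    [set w | A' i (W (t i.+1) w - W (t i) w)].
  by apply/seteqP; split => w /=; rewrite /A' /drift_path /=; congr (A i _); ring.
pose X := \bigcap_(i < n) [set w | A' i (W (t i.+1) w - W (t i) w)].
have mi i : measurable [set w | A' i (W (t i.+1) w - W (t i) w)].
  have mf : measurable_fun setT (fun w => W (t i.+1) w - W (t i) w).
    exact: measurable_funB.
  by have := mf measurableT _ (mA' i); rewrite setTI.
have mX : measurable X by rewrite /X; apply: bigcap_measurableType.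
have -> : drift_path j @^-1` [set y | A0 (y 0) /\
    forall i, (i < n)%N -> A i (y (t i.+1) - y (t i))] =
    X `&` [set w | A0 (eps * W 0 w)].
  apply/seteqP; split => w /=.
    rewrite {1}/drift_path U00 H00 mulr0 !add0r => -[hA0 hA]; split => // i /= ni.
    by rewrite -[A' i _]/([set w | A' i (W (t i.+1) w - W (t i) w)] w) -A'E; exact: hA.
  rewrite {1}/drift_path U00 H00 mulr0 !add0r => -[hX hA0]; split => // i ni.
  have := hX i ni; rewrite -A'E; exact.
rewrite start_as//; case: asboolP => // _.
rewrite /X (hI n t A' tS mA') -prodEFin; apply: eq_bigr => i _.
by rewrite A'E fineK//; exact: fin_num_measure.
Qed.

Definition drift_law (j : R) : {measure set (path_space R) -> \bar R} :=
  measure_function_pushforward__canonical__measure_function_Measure P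
    (measurable_drift_path j).

Lemma drift_lawT j : (drift_law j setT < +oo)%E.
Proof.
rewrite /drift_law /= /pushforward preimage_setT probability_setT.
exact: ltry.
Qed.

(** Since e <= 4, the squares satisfy P_1^2 <= 4 P_0 P_2, and the arithmetic-geometric mean
  inequality makes this bound linear. *)
Lemma rect_dominated n (t : nat -> R) :
  (forall i, (i < n)%N -> t i <= t i.+1) ->
  increment_rect n t `<=` dominated_set (drift_law 0) (drift_law 1) (drift_law 2) 4 4^-1.
Proof.
move=> tS E ER; split; first exact: increment_rect_measurable ER.
have [A0 [A [mA0 mA ->]]] := ER.
rewrite /= /pushforward !rect_probability//.
case: asboolP => _; last by rewrite !mule0 add0e.
rewrite -!EFinM -EFinD lee_fin.
set q := fun j (i : nat) => fine (P [set w | A i (drift_path j w (t i.+1) - drift_path j w (t i))]).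
rewrite -/(q 0) -/(q 1) -/(q 2).
have q0 j i : 0 <= q j i by exact: fine_ge0.
have Q0 j : 0 <= \prod_(i < n) q j i by apply: prodr_ge0.
set a := \prod_(i < n) q 1 i; set b := \prod_(i < n) q 0 i; set c := \prod_(i < n) q 2 i.
suff h : a ^+ 2 <= 4 * (b * c).
  rewrite -ler_sqr ?nnegrE ?addr_ge0 ?mulr_ge0// ?Q0//.
  apply: le_trans h _; have := sqr_ge0 (4 * b - 4^-1 * c); lra.
apply: (@le_trans _ _ (\prod_(i < n) (expR ((H (t i.+1) - H (t i)) ^+ 2 / (t i.+1 - t i) / eps ^+ 2)
   * (q 0 i * q 2 i)))).
  rewrite /a -prodrXl; apply: ler_prod => i _; rewrite exprn_ge0//=.
  by apply: (@increment_sqr_le _ _ (A i) (fun j => q j i)) => //; exact: tS.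
rewrite big_split /= big_split /= -/b -/c ler_wpM2r ?mulr_ge0 ?Q0//.
rewrite -expR_sum -mulr_suml.
apply: (@le_trans _ _ (expR 1)).
  rewrite ler_expR ler_pdivrMr ?exprn_gt0// mul1r; exact: energy.
have e2 : expR (2^-1) <= 2 :> R.
  have := @expR_ge1Dx R (- 2^-1).
  rewrite expRN (_ : 1 + - 2^-1 = 2^-1); last by field.
  by rewrite lef_pV2 ?posrE ?expR_gt0.
rewrite (_ : 1 = 2^-1 + 2^-1) ?expRD; last by field.
have := expR_ge0 (2^-1 : R).
nra.
Qed.

(** Writing P_j for the law of the observation with drift U + j H: the
  three laws satisfy P_1(E)^2 <= e P_0(E) P_2(E) on rectangles, hence
  P_1 <= 4 P_0 + P_2 / 4 there, and the latter is stable under finite disjoint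
  unions and monotone limits. *)
Lemma drift_law_le (E : set (path_space R)) : measurable E ->
  (drift_law 1 E <= 4%:E * drift_law 0 E + 4^-1%:E)%E.
Proof.
move=> mE.
suff [_ h] : dominated_set (drift_law 0) (drift_law 1) (drift_law 2) 4 4^-1 E.
  apply: (le_trans h); rewrite leeD2l// -[leRHS]mule1 lee_wpmul2l ?lee_fin//.
  rewrite -(@probability_setT _ _ _ P) -(preimage_setT (drift_path 2)).
  by apply: (@le_measure _ _ _ (drift_law 2)); rewrite ?inE.
move: E mE; apply: (@subset_trans _ _ _ _ (@coordinate_sets_sub R)).
apply: (@dominated_sigma_algebra _ (path_space R)); rewrite ?drift_lawT//.
- by exists [::] => //; exact: sigma_coord_setT.
- by move=> C [s _ sC]; exists s => //; exact: sigma_coord_setC.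
- exact: bigcup_sigma_coord_setU.
move=> C [s _ sC].
have [n [t [tS t0 ts]]] := sorted_grid s.
move: C sC; apply: (subset_trans (sigma_coord_sub_rect t0 ts)).
apply: (@dominated_sigma_algebra _ (path_space R)); rewrite ?drift_lawT//.
- exists unit, (fun=> tt), [set u : unit | true]%SET; split.
    by apply/seteqP; split => y //= _; rewrite inE.
  move=> []; exists setT, (fun=> setT); split => //.
  by apply/seteqP; split.
- by move=> C; exact: finite_partition_setC.
- by apply: finite_partition_setU; exact: increment_rect_setI.
by apply: (@finite_partition_dominated _ (path_space R)); exact: rect_dominated.
Qed.

End drift.

(** * Two-point lower bound *)

Section two_points.
Variable R : realType.

Lemma primitive00 (g : R -> R) : primitive0 g 0 = 0.
Proof.
rewrite /primitive0 lexx set_itv1.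
exact: Rintegral_set1.
Qed.

(** Chebyshev's inequality around an arbitrary centre. *)
Lemma mean_square_ge (d : measure_display) (T : measurableType d) (P : probability T R)
    (X : T -> R) (th r : R) (A : set T) :
  measurable_fun setT X -> measurable A -> 0 <= r ->
  (forall w, A w -> r <= `|X w - th|) ->
  ((r ^+ 2)%:E * P A <= 'E_P[fun w => (`|X w - th| ^+ 2)%R])%E.
Proof.
move=> mX mA r0 hA; rewrite unlock.
rewrite -[X in (_ * P X)%E]setIT -integral_indic// -ge0_integralZl//; last 2 first.
- by apply/measurable_EFinP; exact: measurable_indic.
- by rewrite lee_fin sqr_ge0.
apply: ge0_le_integral => //.
- by move=> w _; rewrite -EFinM lee_fin mulr_ge0// sqr_ge0.
- apply/measurable_EFinP; apply: measurable_funM => //; exact: measurable_indic.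
- apply/measurable_EFinP; apply: measurable_funX; apply: measurableT_comp => //.
  exact: measurable_funB.
move=> w _; rewrite -EFinM lee_fin indicE.
have [wA|wA] := boolP (w \in A); last by rewrite mulr0 sqr_ge0.
by rewrite mulr1 ler_sqr ?nnegrE//; apply: hA; rewrite inE in wA.
Qed.

(** On the event that the estimate exceeds the midpoint, its distance to [th0] is at least r;
  on the complement, its distance to [th1] is. If the event has probability less than 1/16 under the first
  law, it has probability at most 1/2 under the second one. *)
Lemma two_point_minimax_risk (K : R -> R) (eps : R) (G : set (R -> R))
    (f0 f1 : R -> R) (th0 th1 : R) :
  0 < eps -> G f0 -> G f1 -> change_point f0 th0 -> change_point f1 th1 ->
  th0 <= th1 ->
  (let H x := primitive0 (convolution K f1) x - primitive0 (convolution K f0) x in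
   forall n (t : nat -> R), (forall i, (i < n)%N -> t i <= t i.+1) ->
     \sum_(i < n) (H (t i.+1) - H (t i)) ^+ 2 / (t i.+1 - t i) <= eps ^+ 2) ->
  minimax_risk_ge K eps G ((th1 - th0) / 8).
Proof.
move=> eps0 Gf0 Gf1 c0 c1 th01 energy d T P W hW.
apply: le_ereal_inf_tmp => _ [thetahat _ <-].
set U := primitive0 (convolution K f0).
pose H x := primitive0 (convolution K f1) x - U x.
have U00 : U 0 = 0 by exact: primitive00.
have H00 : H 0 = 0 by rewrite /H U00 primitive00 subrr.
have o0 w : observation K eps W f0 w = drift_path W eps U H 0 w.
  by apply/funext => x; rewrite /observation /drift_path mul0r addr0.
have o1 w : observation K eps W f1 w = drift_path W eps U H 1 w.
  by apply/funext => x; rewrite /observation /drift_path mul1r /H; congr (_ + _); ring.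
(* r^2 / 16 is the square of (th1 - th0) / 8. *)
pose r := (th1 - th0) / 2.
have r0 : 0 <= r by rewrite /r; lra.
have mp j := measurable_drift_path hW eps U H j.
have mth : measurable_fun setT (thetahat : path_space R -> R) by exact: measurable_funP.
pose E := [set y : path_space R | (th0 + th1) / 2 <= thetahat y].
have mE : measurable E.
  have := mth measurableT `[(th0 + th1) / 2, +oo[%classic (measurable_itv _).
  rewrite setTI; congr measurable; apply/seteqP; split => y /=;
  by rewrite in_itv/= andbT.
have mEj j : measurable (drift_path W eps U H j @^-1` E).
  by have := mp j measurableT E mE; rewrite setTI.
have key := drift_law_le hW eps0 U00 H00 energy mE.
rewrite /= /pushforward in key.
have risk_ge j f th (B : set T) : G f -> change_point f th ->
    (forall w, observation K eps W f w = drift_path W eps U H j w) ->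
    measurable B -> (forall w, B w -> r <= `|thetahat (drift_path W eps U H j w) - th|) ->
    (16^-1%:E <= P B)%E ->
    (((th1 - th0) / 8)%:E <= risk P W K eps thetahat G)%E.
  move=> Gf cf of_ mB hB PB.
  apply: (@le_trans _ _ (poweR ('E_P[fun w =>
      (`|thetahat (observation K eps W f w) - th| ^+ 2)%R])%E 2^-1)); last first.
    by apply: ereal_sup_ubound; exists f, th.
  have h := @mean_square_ge _ _ P _ th r B (measurableT_comp mth (mp j)) mB r0 hB.
  apply: (@le_trans _ _ (poweR ((r ^+ 2)%:E * P B) 2^-1)); last first.
    apply: gt0_ler_poweR => //.
    - by rewrite in_itv /= leey andbT mule_ge0 ?lee_fin ?sqr_ge0.
    - rewrite in_itv /= leey andbT unlock; apply: integral_ge0 => w _.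
      by rewrite lee_fin sqr_ge0.
    - apply: (le_trans h); rewrite le_eqVlt; apply/orP; left; apply/eqP.
      by congr expectation; apply/funext => w; rewrite of_.
  apply: (@le_trans _ _ (poweR (((th1 - th0) / 8) ^+ 2)%:E 2^-1)).
    rewrite poweR_EFin powR12_sqrt ?sqr_ge0// sqrtr_sqr lee_fin ler_norm//.
  apply: gt0_ler_poweR => //.
  - by rewrite in_itv /= lee_fin sqr_ge0/= leey.
  - by rewrite in_itv /= leey andbT mule_ge0 ?lee_fin ?sqr_ge0.
  apply: (@le_trans _ _ ((r ^+ 2)%:E * 16^-1%:E)%E); last first.
    by rewrite lee_wpmul2l// lee_fin sqr_ge0.
  by rewrite -EFinM lee_fin /r le_eqVlt; apply/orP; left; apply/eqP; field.
have [PE|PE] := leP (16^-1%:E) (P (drift_path W eps U H 0 @^-1` E)).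
  apply: (risk_ge 0 f0 th0 _ Gf0 c0 o0 _ _ PE) => // w /= wE.
  rewrite (le_trans _ (ler_norm _))// /r; move: wE; rewrite /E /=; lra.
apply: (risk_ge 1 f1 th1 (~` (drift_path W eps U H 1 @^-1` E)) Gf1 c1 o1).
- exact: measurableC.
- move=> w /= /negP; rewrite -ltNge => wE.
  rewrite distrC (le_trans _ (ler_norm _))// /r; move: wE; lra.
rewrite probability_setC//.
have f0E : P (drift_path W eps U H 0 @^-1` E) \is a fin_num by exact: fin_num_measure.
have f1E : P (drift_path W eps U H 1 @^-1` E) \is a fin_num by exact: fin_num_measure.
move: key PE; rewrite -(fineK f0E) -(fineK f1E) -EFinM -EFinD -EFinB !lee_fin lte_fin.
lra.
Qed.
End two_points.

(** * The Fourier transform of a Gaussian density *)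

Section calculus.
Variable R : realType.
Implicit Types (x c : R).

Lemma is_derive_mull (c x : R) : is_derive x 1 (fun y => c * y) c.
Proof.
rewrite (_ : (fun y => c * y) = c \*: (id : R -> R))//.
by apply: is_derive_eq; rewrite /GRing.scale /= mulr1.
Qed.

Lemma is_derive_cosM (c x : R) : is_derive x 1 (fun y => cos (c * y)) (- c * sin (c * x)).
Proof.
have h : is_derive x 1 (cos \o (fun y => c * y)) (- sin (c * x) * c).
  by apply: is_derive1_comp; exact: is_derive_mull.
by apply: (is_derive_eq h); rewrite mulrC mulrN mulNr.
Qed.

Lemma is_derive_sinM (c x : R) : is_derive x 1 (fun y => sin (c * y)) (c * cos (c * x)).
Proof.
have h : is_derive x 1 (sin \o (fun y => c * y)) (cos (c * x) * c).
  by apply: is_derive1_comp; exact: is_derive_mull.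
by apply: (is_derive_eq h); rewrite mulrC.
Qed.

Lemma is_derive_expRsqr (c x : R) :
  is_derive x 1 (fun y => expR (c * y ^+ 2)) (2 * c * x * expR (c * x ^+ 2)).
Proof.
have h2 : is_derive x 1 (fun y : R => c * y ^+ 2) (2 * c * x).
  rewrite (_ : (fun y : R => c * y ^+ 2) = c \*: ((id : R -> R) ^+ 2)); last first.
    by apply/funext => y.
  by apply: is_derive_eq; rewrite /GRing.scale /= expr1 mulr1; ring.
have h : is_derive x 1 (expR \o (fun y => c * y ^+ 2)) (expR (c * x ^+ 2) * (2 * c * x)).
  exact: is_derive1_comp.
by apply: (is_derive_eq h); rewrite mulrC.
Qed.

Lemma is_derive_mul (f g : R -> R) x (a b : R) :
  is_derive x 1 f a -> is_derive x 1 g b ->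
  is_derive x 1 (fun y => f y * g y) (a * g x + f x * b).
Proof.
move=> hf hg; have h := is_deriveM hf hg.
by apply: (is_derive_eq h); rewrite /GRing.scale /= addrC mulrC.
Qed.

Lemma is_derive_continuous (f : R -> R) x (a : R) : is_derive x 1 f a -> {for x, continuous f}.
Proof. by move=> [df _]; exact/differentiable_continuous/derivable1_diffP. Qed.

Lemma continuous_cosM (c : R) : continuous (fun x : R => cos (c * x)).
Proof. by move=> x; exact: (is_derive_continuous (is_derive_cosM c x)). Qed.

Lemma continuous_sinM (c : R) : continuous (fun x : R => sin (c * x)).
Proof. by move=> x; exact: (is_derive_continuous (is_derive_sinM c x)). Qed.

Lemma measurable_cosM (c : R) : measurable_fun setT (fun x : R => cos (c * x)).
Proof. by apply: continuous_measurable_fun; exact: continuous_cosM. Qed.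

Lemma measurable_sinM (c : R) : measurable_fun setT (fun x : R => sin (c * x)).
Proof. by apply: continuous_measurable_fun; exact: continuous_sinM. Qed.

Lemma L1_cos (f : R -> R) (c : R) : L1 f -> L1 (fun x => f x * cos (c * x)).
Proof.
move=> f1; apply: (@L1M_bounded _ _ _ 1) => //; first exact: measurable_cosM.
by move=> x; exact: cos_max.
Qed.

Lemma L1_sin (f : R -> R) (c : R) : L1 f -> L1 (fun x => f x * sin (c * x)).
Proof.
move=> f1; apply: (@L1M_bounded _ _ _ 1) => //; first exact: measurable_sinM.
by move=> x; exact: sin_max.
Qed.

(** The fundamental theorem on growing intervals and dominated convergence; the boundary terms
  need only be controlled along the integers. *)
Lemma integral_derive_eq0 (F f : R -> R) : (forall x, is_derive x 1 F (f x)) ->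
  continuous f -> L1 f ->
  (fun n : nat => F n.+1%:R - F (- n.+1%:R)) @ \oo --> (0 : R) ->
  \int[@lebesgue_measure R]_x f x = 0.
Proof.
move=> dF cf f1 F0.
pose I n := `[- n.+1%:R, n.+1%:R]%classic : set R.
have mI n : measurable (I n) by exact: measurable_itv.
have mf := L1_measurable f1.
have cvgI : \int[@lebesgue_measure R]_x (f \_ (I n)) x @[n --> \oo] -->
    \int[@lebesgue_measure R]_x f x.
  apply: (@Rdominated_cvg _ _ _ (fun x => `|f x|)) => //.
  - move=> n; apply/(measurable_restrict _ (mI n) measurableT).
    by rewrite setTI; exact: measurable_funTS.
  - exact: L1_norm.
  - apply: aeW => x; apply: cvg_near_cst.
    have [N _ hN] : \forall n \near \oo, `|x| <= n%:R by apply: nbhs_infty_ger.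
    exists N => // n /= Nn; rewrite patchE mem_set// /I /= in_itv /= -ler_norml.
    by rewrite (le_trans (hN _ (leqnn _)))// ler_nat (leq_trans Nn).
  - move=> n x; rewrite patchE; case: ifP => // _.
    by rewrite normr0.
apply: (cvg_unique (@Rhausdorff R) cvgI).
apply: cvg_trans F0; apply: near_eq_cvg; apply: nearW => n /=.
rewrite -Rintegral_mkcond /Rintegral (@continuous_FTC2 _ f F)//.
- by rewrite (lt_trans (y := 0)) ?ltr0Sn// oppr_lt0 ltr0Sn.
- by apply: continuous_subspaceT.
- split.
  + by move=> x _; case: (dF x).
  + apply: cvg_at_right_filter; exact: (is_derive_continuous (dF _)).
  + apply: cvg_at_left_filter; exact: (is_derive_continuous (dF _)).
- by move=> x _; rewrite derive1E; exact: derive_val.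
Qed.

End calculus.

Section gaussian.
Variables (R : realType) (s : R).
Hypothesis s0 : 0 < s.
Notation mu := (@lebesgue_measure R).
Notation p := (normal_pdf 0 s).

Let sn0 : s != 0. Proof. exact: lt0r_neq0. Qed.

Lemma normal_pdf0E x : p x = normal_peak s * expR (- (2 * s ^+ 2)^-1 * x ^+ 2).
Proof.
rewrite normal_pdfE// /normal_fun subr0; congr (_ * expR _).
by rewrite -mulr_natl; field.
Qed.

Lemma normal_pdf_even x : p (- x) = p x.
Proof. by rewrite !normal_pdf0E sqrrN. Qed.

Lemma is_derive_normal_pdf (x : R) : is_derive x 1 p (- (x / s ^+ 2) * p x).
Proof.
have h := is_derive_mul (is_derive_cst (normal_peak s) x 1)
  (is_derive_expRsqr (- (2 * s ^+ 2)^-1) x).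
have -> : p = (fun y => cst (normal_peak s) y * expR (- (2 * s ^+ 2)^-1 * y ^+ 2)).
  by apply/funext => y; rewrite normal_pdf0E.
by apply: (is_derive_eq h) => /=; field.
Qed.

Lemma L1_normal_pdf : L1 p.
Proof. exact: integrable_normal_pdf. Qed.

(** A first moment is paid for by a wider Gaussian. *)
Lemma abs_normal_pdf_le : exists2 C : R, 0 <= C &
  forall x, `|x| * p x <= C * normal_pdf 0 (2 * s) x.
Proof.
have s20 : 2 * s != 0 by rewrite mulf_neq0.
exists (2 * s * normal_peak s / normal_peak (2 * s)).
  by rewrite divr_ge0 ?normal_peak_ge0// mulr_ge0 ?normal_peak_ge0// mulr_ge0// ltW.
move=> x; rewrite normal_pdf0E normal_pdfE// /normal_fun subr0.
have pn0 : normal_peak (2 * s) != 0 by rewrite gt_eqF// normal_peak_gt0.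
rewrite [leRHS](_ : _ = normal_peak s * (2 * s * expR (- x ^+ 2 / ((2 * s) ^+ 2 *+ 2)))); last by field.
rewrite mulrCA ler_wpM2l ?normal_peak_ge0//.
pose y := `|x| / (2 * s).
have y0 : 0 <= y by rewrite divr_ge0// mulr_ge0// ltW.
have xy : `|x| = 2 * s * y by rewrite /y; field.
have x2 : x ^+ 2 = (2 * s * y) ^+ 2 by rewrite -xy real_normK// num_real.
rewrite x2 xy -[leLHS]mulrA; apply: ler_wpM2l; first by rewrite mulr_ge0// ltW.
have -> : - (2 * s ^+ 2)^-1 * (2 * s * y) ^+ 2 = - (3 / 2) * y ^+ 2 + - (2 * s * y) ^+ 2 / ((2 * s) ^+ 2 *+ 2).
  by rewrite -mulr_natl; field.
rewrite expRD mulrA ler_piMl ?expR_ge0//.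
rewrite mulNr expRN ler_pdivrMr ?expR_gt0// mul1r.
apply: le_trans (expR_ge1Dx _); nra.
Qed.

Lemma L1_abs_normal_pdf : L1 (fun x => `|x| * p x).
Proof.
have [C C0 hC] := abs_normal_pdf_le.
apply: (@L1_le _ _ (fun x => C * normal_pdf 0 (2 * s) x)).
- by apply: measurable_funM; [exact: (measurableT_comp (@normr_measurable _ _))|exact: measurable_normal_pdf].
- by apply: L1Z; exact: integrable_normal_pdf.
by move=> x; rewrite normrM normr_id (ger0_norm (normal_pdf_ge0 _ _ _)).
Qed.

Lemma normal_pdf_cvg0 : (fun n : nat => p n.+1%:R) @ \oo --> (0 : R).
Proof.
have [C C0 hC] := abs_normal_pdf_le.
have s20 : 2 * s != 0 by rewrite mulf_neq0.
apply: (@squeeze_cvgr _ _ _ _ (cst 0) (fun n => C * normal_peak (2 * s) * n.+1%:R^-1)).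
- apply: nearW => n; rewrite normal_pdf_ge0/= ler_pdivlMr ?ltr0Sn// mulrC.
  have := hC n.+1%:R; rewrite ger0_norm ?ler0n// => /le_trans; apply.
  by rewrite ler_wpM2l// normal_pdf_ub.
- exact: cvg_cst.
rewrite -[X in _ --> X](mulr0 (C * normal_peak (2 * s))).
by apply: cvgM; [exact: cvg_cst|exact: cvg_harmonic].
Qed.

Let C t := \int[mu]_x (p x * cos (t * x)).

(** Differentiation under the integral and an integration by parts lead to the equation
  C' = - s^2 t C of the Gaussian transform. *)
Let is_derive_C (t : R) : is_derive t 1 C (- s ^+ 2 * t * C t).
Proof.
have pd t0 x : partial1of2 (fun t x => p x * cos (t * x)) t0 x = - (p x * x * sin (t0 * x)).
  rewrite /partial1of2 derive1E.
  have h := is_derive_cosM x t0.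
  have h2 : is_derive t0 1 (fun t : R => p x * cos (t * x)) (p x * (- x * sin (x * t0))).
    have -> : (fun t : R => p x * cos (t * x)) = p x \*: (fun t : R => cos (x * t)).
      by apply/funext => y; rewrite (mulrC y).
    exact: is_deriveZ.
  rewrite (@derive_val _ _ _ _ _ _ _ h2) (mulrC t0); ring.
have Lc t0 : L1 (fun x => p x * cos (t0 * x)) by apply: L1_cos; exact: L1_normal_pdf.
have Gub x y : `]t - 1, t + 1[%classic x -> setT y ->
    `|partial1of2 (fun t x => p x * cos (t * x)) x y| <= `|y| * p y.
  move=> _ _; rewrite pd normrN !normrM (ger0_norm (normal_pdf_ge0 _ _ _)).
  by rewrite mulrC (mulrC (p y)) ler_piMl// ?sin_max// mulr_ge0// normal_pdf_ge0.
have It : `]t - 1, t + 1[%classic t by rewrite /= in_itv /= ltrBlDr ltrDl ltr01.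
have dd x y : `]t - 1, t + 1[%classic x -> setT y ->
    derivable ((fun t x => p x * cos (t * x)) ^~ y) x 1.
  move=> _ _.
  have -> : (fun t : R => p y * cos (t * y)) = p y \*: (fun t : R => cos (y * t)).
    by apply/funext => z; rewrite (mulrC z).
  by apply: derivableZ; case: (is_derive_cosM y x).
have G0 y : 0 <= `|y| * p y by rewrite mulr_ge0// normal_pdf_ge0.
have h1 := @derivable_under_integral R _ _ mu (fun t x => p x * cos (t * x)) setT measurableT
  t (t - 1) (t + 1) It (fun x _ => Lc x) dd _ G0 L1_abs_normal_pdf Gub.
have h2 := @differentiation_under_integral R _ _ mu (fun t x => p x * cos (t * x)) setT measurableT
  t (t - 1) (t + 1) It (fun x _ => Lc x) dd _ G0 L1_abs_normal_pdf Gub.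
apply: DeriveDef => //; rewrite -derive1E h2.
have L1xs : L1 (fun x => p x * x * sin (t * x)).
  apply: L1_sin; apply: L1_le L1_abs_normal_pdf _.
    by apply: measurable_funM => //; exact: measurable_normal_pdf.
  by move=> x; rewrite normrM (ger0_norm (normal_pdf_ge0 _ _ _)) mulrC.
have F0 : \int[mu]_x (s ^+ 2 * t * (p x * cos (t * x)) - p x * x * sin (t * x)) = 0.
  apply: (@integral_derive_eq0 _ (fun x => s ^+ 2 * (p x * sin (t * x)))).
  - move=> x; have h := is_derive_mul (is_derive_normal_pdf x) (is_derive_sinM t x).
    have h3 := is_deriveZ (s ^+ 2) h.
    by apply: (is_derive_eq h3); rewrite /GRing.scale /=; field.
  - move=> x; apply: cvgB.
      by apply: cvgM; [exact: cvg_cst|apply: cvgM; [exact: continuous_normal_pdf|exact: continuous_cosM]].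
    apply: cvgM; last exact: continuous_sinM.
    by apply: cvgM; [exact: continuous_normal_pdf|exact: cvg_id].
  - by apply: L1B => //; exact: L1Z.
  have b n : `|s ^+ 2 * (p n.+1%:R * sin (t * n.+1%:R)) -
      s ^+ 2 * (p (- n.+1%:R) * sin (t * - n.+1%:R))| <= 2 * s ^+ 2 * p n.+1%:R.
    rewrite normal_pdf_even mulrN sinN.
    rewrite (_ : _ - _ = 2 * s ^+ 2 * p n.+1%:R * sin (t * n.+1%:R)); last by ring.
    have h0 : 0 <= 2 * s ^+ 2 * p n.+1%:R.
      by rewrite mulr_ge0 ?normal_pdf_ge0// mulr_ge0// sqr_ge0.
    by rewrite normrM (ger0_norm h0) ler_piMr// sin_max.
  apply: norm_cvg0.
  apply: (@squeeze_cvgr _ _ _ _ (cst 0) (fun n => 2 * s ^+ 2 * p n.+1%:R)).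
  - by apply: nearW => n; rewrite normr_ge0 b.
  - exact: cvg_cst.
  rewrite -[X in _ --> X](mulr0 (2 * s ^+ 2)).
  by apply: cvgM; [exact: cvg_cst|exact: normal_pdf_cvg0].
have e : \int[mu]_x (p x * x * sin (t * x)) = s ^+ 2 * t * C t.
  move: F0; rewrite RintegralB//; last exact: L1Z.
  by rewrite RintegralZl// => /eqP; rewrite subr_eq0 => /eqP.
rewrite (_ : \int[mu]_x _ = \int[mu]_x ((-1) * (p x * x * sin (t * x)))); last first.
  by apply: eq_Rintegral => x _; rewrite pd mulN1r.
by rewrite RintegralZl// e; ring.
Qed.

Lemma normal_pdf_cos t :
  \int[mu]_x (p x * cos (t * x)) = expR (- (s ^+ 2 / 2) * t ^+ 2).
Proof.
have d0 (x : R) : is_derive x 1 (fun t => C t * expR (s ^+ 2 / 2 * t ^+ 2)) 0.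
  have h := is_derive_mul (is_derive_C x) (is_derive_expRsqr (s ^+ 2 / 2) x).
  by apply: (is_derive_eq h); field.
have e := is_derive_0_is_cst t 0 d0.
have C0 : C 0 = 1.
  rewrite /C (_ : \int[mu]_x _ = \int[mu]_x p x); last first.
    by apply: eq_Rintegral => x _; rewrite mul0r cos0 mulr1.
  by rewrite /Rintegral integral_normal_pdf.
move: e; rewrite C0 expr0n /= mulr0 expR0 mulr1 => e.
rewrite -[LHS]/(C t) mulNr expRN.
by rewrite -[LHS](mulfK (x := expR (s ^+ 2 / 2 * t ^+ 2))) ?e ?mul1r// gt_eqF// expR_gt0.
Qed.

Lemma normal_pdf_sin t : \int[mu]_x (p x * sin (t * x)) = 0.
Proof.
have L : L1 (fun x => p x * sin (t * x)) by apply: L1_sin; exact: L1_normal_pdf.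
have := Rintegral_opp L.
rewrite [RHS](_ : _ = \int[mu]_x ((-1) * (p x * sin (t * x)))); last first.
  by apply: eq_Rintegral => x _; rewrite normal_pdf_even mulrN sinN mulN1r mulrN.
by rewrite RintegralZl//; lra.
Qed.

End gaussian.

(** * Plancherel inequality and convolutions *)

Section fourier_L1.
Variable R : realType.
Notation mu := (@lebesgue_measure R).
Implicit Types (g u K h : R -> R).

Lemma L1_Fubini_snd (F : R -> R -> R) :
  (mu \x mu)%E.-integrable setT (EFin \o (fun z : R * R => F z.1 z.2)) ->
  (forall y, L1 (F^~ y)) -> L1 (fun y => \int[mu]_x F x y).
Proof.
move=> iF F1.
have mF : measurable_fun setT (fun z : R * R => F z.1 z.2).
  by apply/measurable_EFinP; exact: measurable_int iF.
apply: (@L1_Fubini R (fun y x => F x y)) => //; apply/integrable12ltyP.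
  by apply/measurable_EFinP; exact: (measurableT_comp mF (@measurable_swap _ _ _ _)).
have mEF : measurable_fun setT (EFin \o (fun z : R * R => F z.1 z.2)).
  exact/measurable_EFinP.
have [h _] := @integrable21ltyP _ _ _ _ R mu mu _ mEF.
exact: h iF.
Qed.

(** The real and imaginary parts of the transform, in the angular frequency [c]: most identities
  below are addition formulas for cosine and sine, free of complex numbers. *)
Definition fcos g (c : R) := \int[mu]_x (g x * cos (c * x)).
Definition fsin g (c : R) := \int[mu]_x (g x * sin (c * x)).

Lemma normc_fourier_sqr g w :
  Normc.normc (fourier g w) ^+ 2 = fcos g (2 * pi * w) ^+ 2 + fsin g (2 * pi * w) ^+ 2.
Proof. by rewrite /= sqr_sqrtr// addr_ge0// sqr_ge0. Qed.

Lemma normr_Rintegral_le g (C : R) : L1 g -> \int[mu]_x `|g x| <= C ->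
  `|\int[mu]_x g x| <= C.
Proof. by move=> g1; apply: le_trans; exact: le_normr_Rintegral. Qed.

Section weighted_plancherel.
Variables (u E : R -> R).
Hypotheses (u1 : L1 u) (E1 : L1 E).

Let C w := fcos u (2 * pi * w).
Let S w := fsin u (2 * pi * w).
Let k z := \int[mu]_w (E w * cos (2 * pi * w * z)).

Let cs_meas : measurable_fun setT (fun z : R * R => cos (2 * pi * z.1 * z.2)).
Proof.
apply: (@measurableT_comp _ _ _ _ _ _ cos).
  by apply: continuous_measurable_fun; exact: continuous_cos.
by apply: measurable_funM => //; apply: measurable_funM.
Qed.

Let sn_meas : measurable_fun setT (fun z : R * R => sin (2 * pi * z.1 * z.2)).
Proof.
apply: (@measurableT_comp _ _ _ _ _ _ sin).
  by apply: continuous_measurable_fun; exact: continuous_sin.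
by apply: measurable_funM => //; apply: measurable_funM.
Qed.

Lemma L1_weight_fcos : L1 (fun w => E w * C w).
Proof.
have L w : L1 (fun x => E w * u x * cos (2 * pi * w * x)).
  by apply: (@L1_cos _ (fun x => E w * u x)); exact: L1Z.
have iF := prodM_integrable (prod_L1 E1 u1) cs_meas (fun z => cos_max _).
have := L1_Fubini iF L; apply: eq_integrable => // w _ /=; congr EFin.
rewrite -RintegralZl//; last exact: L1_cos.
by apply: eq_Rintegral => x _; rewrite mulrA.
Qed.

Lemma L1_weight_fsin : L1 (fun w => E w * S w).
Proof.
have L w : L1 (fun x => E w * u x * sin (2 * pi * w * x)).
  by apply: (@L1_sin _ (fun x => E w * u x)); exact: L1Z.
have iF := prodM_integrable (prod_L1 E1 u1) sn_meas (fun z => sin_max _).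
have := L1_Fubini iF L; apply: eq_integrable => // w _ /=; congr EFin.
rewrite -RintegralZl//; last exact: L1_sin.
by apply: eq_Rintegral => x _; rewrite mulrA.
Qed.

(** The weight E makes the inversion integral absolutely convergent. *)
Lemma weighted_inversion x : \int[mu]_y (u y * k (x - y)) =
  \int[mu]_w (E w * C w * cos (2 * pi * x * w)) + \int[mu]_w (E w * S w * sin (2 * pi * x * w)).
Proof.
have bm : measurable_fun setT (fun z : R * R => cos (2 * pi * z.2 * (x - z.1))).
  apply: (@measurableT_comp _ _ _ _ _ _ cos).
    by apply: continuous_measurable_fun; exact: continuous_cos.
  by apply: measurable_funM; [apply: measurable_funM|apply: measurable_funB].
have iF := prodM_integrable (prod_L1 u1 E1) bm (fun z => cos_max _).
have Ly y : L1 (fun w => u y * E w * cos (2 * pi * w * (x - y))).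
  have := L1_cos (2 * pi * (x - y)) (L1Z (u y) E1).
  by apply: eq_integrable => // w _ /=; congr (_ * cos _)%:E; ring.
have Lw w : L1 (fun y => u y * E w * cos (2 * pi * w * (x - y))).
  apply: (@L1M_bounded _ (fun y => u y * E w) _ 1) => //.
  - have := L1Z (E w) u1; apply: eq_integrable => // y _ /=; by rewrite mulrC.
  - have := measurable_cosM (2 * pi * w) => m.
    by apply: (measurableT_comp m); exact: measurable_funB.
  - by move=> y; exact: cos_max.
have := RFubini iF Ly Lw.
rewrite (_ : \int[mu]_y \int[mu]_w _ = \int[mu]_y (u y * k (x - y))); last first.
  apply: eq_Rintegral => y _; rewrite /k -RintegralZl//.
    by apply: eq_Rintegral => w _; rewrite -mulrA.
  have := L1_cos (2 * pi * (x - y)) E1.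
  by apply: eq_integrable => // w _ /=; congr (_ * cos _)%:E; ring.
move=> ->; rewrite -RintegralD//; last 2 first.
- by apply: L1_cos; exact: L1_weight_fcos.
- by apply: L1_sin; exact: L1_weight_fsin.
apply: eq_Rintegral => w _.
rewrite (_ : \int[mu]_y _ = \int[mu]_y ((E w * cos (2 * pi * w * x)) * (u y * cos (2 * pi * w * y)) +
   (E w * sin (2 * pi * w * x)) * (u y * sin (2 * pi * w * y)))); last first.
  by apply: eq_Rintegral => y _; rewrite mulrBr cosB; ring.
rewrite RintegralD//; try by apply: L1Z; [exact: L1_cos|exact: L1_sin].
- rewrite !RintegralZl//; [|exact: L1_sin|exact: L1_cos].
  by rewrite -/(fcos u _) -/(fsin u _) -/(C w) -/(S w) (mulrAC (2 * pi) w x); ring.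
- by apply: L1Z; exact: L1_cos.
- by apply: L1Z; exact: L1_sin.
Qed.

(** Plancherel's identity with an integrable weight on the transform is Fubini's theorem. *)
Lemma weighted_plancherel : L1 (fun w => E w * (C w ^+ 2 + S w ^+ 2)) /\
  \int[mu]_x (u x * \int[mu]_y (u y * k (x - y))) =
  \int[mu]_w (E w * (C w ^+ 2 + S w ^+ 2)).
Proof.
have iC := prodM_integrable (prod_L1 u1 L1_weight_fcos) cs_meas (fun z => cos_max _).
have iS := prodM_integrable (prod_L1 u1 L1_weight_fsin) sn_meas (fun z => sin_max _).
have LC x : L1 (fun w => u x * (E w * C w) * cos (2 * pi * x * w)).
  by apply: (@L1_cos _ (fun w => u x * (E w * C w))); apply: L1Z; exact: L1_weight_fcos.
have LS x : L1 (fun w => u x * (E w * S w) * sin (2 * pi * x * w)).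
  by apply: (@L1_sin _ (fun w => u x * (E w * S w))); apply: L1Z; exact: L1_weight_fsin.
have LC' w : L1 (fun x => u x * (E w * C w) * cos (2 * pi * x * w)).
  have := L1Z (E w * C w) (L1_cos (2 * pi * w) u1).
  apply: eq_integrable => // x _ /=; congr EFin.
  by rewrite (mulrAC (2 * pi) x w); ring.
have LS' w : L1 (fun x => u x * (E w * S w) * sin (2 * pi * x * w)).
  have := L1Z (E w * S w) (L1_sin (2 * pi * w) u1).
  apply: eq_integrable => // x _ /=; congr EFin.
  by rewrite (mulrAC (2 * pi) x w); ring.
have inv := weighted_inversion.
have WC := L1_weight_fcos; have WS := L1_weight_fsin.
have FC := RFubini iC LC LC'; have FS := RFubini iS LS LS'.
have MC := L1_Fubini iC LC; have MS := L1_Fubini iS LS.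
have KC := L1_Fubini_snd iC LC'; have KS := L1_Fubini_snd iS LS'.
clear iC iS cs_meas sn_meas.
have eC w : \int[mu]_x (u x * (E w * C w) * cos (2 * pi * x * w)) = E w * C w ^+ 2.
  rewrite (_ : \int[mu]_x _ = \int[mu]_x (E w * C w * (u x * cos (2 * pi * w * x)))); last first.
    by apply: eq_Rintegral => x _; rewrite (mulrAC (2 * pi) x w); ring.
  rewrite (RintegralZl (E w * C w) measurableT (L1_cos _ u1)).
  by rewrite expr2 mulrA.
have eS w : \int[mu]_x (u x * (E w * S w) * sin (2 * pi * x * w)) = E w * S w ^+ 2.
  rewrite (_ : \int[mu]_x _ = \int[mu]_x (E w * S w * (u x * sin (2 * pi * w * x)))); last first.
    by apply: eq_Rintegral => x _; rewrite (mulrAC (2 * pi) x w); ring.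
  rewrite (RintegralZl (E w * S w) measurableT (L1_sin _ u1)).
  by rewrite expr2 mulrA.
have {}KC : L1 (fun w => E w * C w ^+ 2).
  by apply: (eq_integrable measurableT) KC => w _ /=; rewrite eC.
have {}KS : L1 (fun w => E w * S w ^+ 2).
  by apply: (eq_integrable measurableT) KS => w _ /=; rewrite eS.
split.
  by apply: (eq_integrable measurableT) (L1D KC KS) => w _ /=; rewrite mulrDr.
rewrite [RHS](_ : _ = \int[mu]_w (E w * C w ^+ 2 + E w * S w ^+ 2)); last first.
  by apply: eq_Rintegral => w _; rewrite mulrDr.
rewrite (RintegralD measurableT KC KS).
rewrite (_ : \int[mu]_w (E w * C w ^+ 2) = \int[mu]_x \int[mu]_w (u x * (E w * C w) * cos (2 * pi * x * w))); last first.
  by rewrite FC; apply: eq_Rintegral => w _; rewrite eC.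
rewrite (_ : \int[mu]_w (E w * S w ^+ 2) = \int[mu]_x \int[mu]_w (u x * (E w * S w) * sin (2 * pi * x * w))); last first.
  by rewrite FS; apply: eq_Rintegral => w _; rewrite eS.
rewrite -(RintegralD measurableT MC MS).
apply: eq_Rintegral => x _.
rewrite inv mulrDr -!(RintegralZl _ measurableT); last 2 first.
- by apply: L1_sin; exact: WS.
- by apply: L1_cos; exact: WC.
by congr (_ + _); apply: eq_Rintegral => w _; rewrite !mulrA.
Qed.

End weighted_plancherel.

Section weight.
Variable s : R.
Hypothesis s0 : 0 < s.

Let s' := (2 * pi * s)^-1.
Let pi0 : 0 < pi :> R. Proof. exact: pi_gt0. Qed.
Let s'0 : 0 < s'. Proof. by rewrite invr_gt0 !mulr_gt0. Qed.

(** The transform exp(- 2 pi^2 s^2 w^2) of the density of scale s, written as a multiple of a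
  Gaussian density, whose integrability and transform are known. *)
Definition gauss_weight (w : R) := normal_peak s * normal_pdf 0 s' w.

Lemma gauss_weight_ge0 w : 0 <= gauss_weight w.
Proof. by rewrite mulr_ge0 ?normal_peak_ge0 ?normal_pdf_ge0. Qed.

Lemma L1_gauss_weight : L1 gauss_weight.
Proof. by apply: L1Z; exact: integrable_normal_pdf. Qed.

Lemma gauss_weightE w : gauss_weight w = expR (- (2 * pi ^+ 2 * s ^+ 2) * w ^+ 2).
Proof.
have sn0 : s != 0 by exact: lt0r_neq0.
have pn0 : pi != 0 :> R by exact: lt0r_neq0.
rewrite /gauss_weight normal_pdf0E// mulrA.
have -> : normal_peak s * normal_peak s' = 1.
  rewrite /normal_peak -invfM -sqrtrM; last by rewrite -mulr_natr !mulr_ge0 ?sqr_ge0// ltW.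
  rewrite (_ : _ * _ = 1) ?sqrtr1 ?invr1//.
  by rewrite /s' !mulr2n; move: (@pi R) pn0 => q q0; field; rewrite q0 sn0.
have -> : - (2 * s' ^+ 2)^-1 = - (2 * pi ^+ 2 * s ^+ 2).
  by rewrite /s'; move: (@pi R) pn0 => q q0; field; rewrite q0 sn0.
by rewrite mul1r.
Qed.

Lemma gauss_weight_le1 w : gauss_weight w <= 1.
Proof.
rewrite gauss_weightE -[leRHS]expR0 ler_expR mulNr oppr_le0.
by rewrite mulr_ge0 ?sqr_ge0// mulr_ge0 ?sqr_ge0// mulr_ge0 ?sqr_ge0.
Qed.

Lemma gauss_weight_cos z : \int[mu]_w (gauss_weight w * cos (2 * pi * w * z)) = normal_pdf 0 s z.
Proof.
have sn0 : s != 0 by exact: lt0r_neq0.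
have pn0 : pi != 0 :> R by exact: lt0r_neq0.
rewrite (_ : \int[mu]_w _ = \int[mu]_w (normal_peak s * (normal_pdf 0 s' w * cos (2 * pi * z * w)))); last first.
  apply: eq_Rintegral => w _; rewrite /gauss_weight -mulrA; congr (_ * (_ * cos _)); ring.
rewrite RintegralZl//; last by apply: L1_cos; exact: integrable_normal_pdf.
rewrite normal_pdf_cos// normal_pdf0E//; congr (_ * expR _).
by rewrite /s'; move: (@pi R) pn0 => q q0; field; rewrite q0 sn0.
Qed.

End weight.

(** Multiplied by a Gaussian weight, the transform is a Fubini integral. *)
Lemma measurable_fcos u : L1 u -> measurable_fun setT (fun w => fcos u (2 * pi * w)).
Proof.
move=> u1; have mE := L1_measurable (L1_weight_fcos u1 (L1_gauss_weight 1)).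
have mW : measurable_fun setT (gauss_weight 1) by exact: L1_measurable (L1_gauss_weight 1).
rewrite (_ : (fun _ => _) = (fun w => gauss_weight 1 w * fcos u (2 * pi * w) *
   expR (2 * pi ^+ 2 * 1 ^+ 2 * w ^+ 2))).
  apply: measurable_funM => //; apply: (measurableT_comp (@measurable_expR R)).
  by apply: measurable_funM => //; exact: measurable_funX.
by apply/funext => w; rewrite [RHS]mulrAC gauss_weightE// -expRD mulNr addNr expR0 mul1r.
Qed.

Lemma measurable_fsin u : L1 u -> measurable_fun setT (fun w => fsin u (2 * pi * w)).
Proof.
move=> u1; have mE := L1_measurable (L1_weight_fsin u1 (L1_gauss_weight 1)).
rewrite (_ : (fun _ => _) = (fun w => gauss_weight 1 w * fsin u (2 * pi * w) *
   expR (2 * pi ^+ 2 * 1 ^+ 2 * w ^+ 2))).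
  apply: measurable_funM => //; apply: (measurableT_comp (@measurable_expR R)).
  by apply: measurable_funM => //; exact: measurable_funX.
by apply/funext => w; rewrite [RHS]mulrAC gauss_weightE// -expRD mulNr addNr expR0 mul1r.
Qed.

Lemma normal_pdf_scale (s z : R) : 0 < s -> s * normal_pdf 0 s (s * z) = normal_pdf 0 1 z.
Proof.
move=> s0; have sn0 : s != 0 by exact: lt0r_neq0.
rewrite !normal_pdf0E// mulrA; congr (_ * expR _); last by field.
rewrite /normal_peak expr1n mul1r -mulrnAr sqrtrM ?sqr_ge0// sqrtr_sqr gtr0_norm// invfM.
by rewrite mulrA divff// mul1r.
Qed.

(** After a change of variables the averages are against one fixed Gaussian density, so that
  dominated convergence applies. *)
Lemma smooth_cvg (u : R -> R) (B : R) (x : R) : L1 u -> (forall y, `|u y| <= B) ->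
  continuous u ->
  (fun n : nat => \int[mu]_y (u y * normal_pdf 0 n.+1%:R^-1 (x - y))) @ \oo --> u x.
Proof.
move=> u1 uB cu; have mu_ := L1_measurable u1.
have B0 : 0 <= B by exact: le_trans (uB 0).
have iu s : L1 (fun y => u y * normal_pdf 0 s (x - y)).
  have := @L1M_bounded _ (fun y => normal_pdf 0 s (x - y)) u B
    (L1_reflect x (integrable_normal_pdf 0 s)) mu_ uB.
  by apply: eq_integrable => // y _ /=; rewrite mulrC.
have e n : \int[mu]_y (u y * normal_pdf 0 n.+1%:R^-1 (x - y)) =
    \int[mu]_z (u (x - n.+1%:R^-1 * z) * normal_pdf 0 1 z).
  set s := n.+1%:R^-1.
  have s0 : 0 < s by rewrite invr_gt0 ltr0Sn.
  rewrite -(Rintegral_reflect x (iu s)) (Rintegral_affine 0 s0 (L1_reflect x (iu s))).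
  rewrite -RintegralZl//; last exact: (L1_affine 0 s0 (L1_reflect x (iu s))).
  apply: eq_Rintegral => z _; rewrite addr0 opprB addrCA subrr addr0.
  by rewrite mulrCA normal_pdf_scale.
under eq_fun do rewrite e.
have -> : u x = \int[mu]_z (u x * normal_pdf 0 1 z).
  rewrite RintegralZl//; last exact: integrable_normal_pdf.
  by rewrite /Rintegral integral_normal_pdf mulr1.
apply: (@Rdominated_cvg _ _ _ (fun z => B * normal_pdf 0 1 z)).
- move=> n; apply: measurable_funM; last exact: measurable_normal_pdf.
  by apply: (measurableT_comp mu_); apply: measurable_funB => //; exact: measurable_funM.
- by apply: measurable_funM => //; exact: measurable_normal_pdf.
- by apply: L1Z; exact: integrable_normal_pdf.
- apply: aeW => z; apply: cvgM; last exact: cvg_cst.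
  have c : (fun n : nat => x - n.+1%:R^-1 * z) @ \oo --> x.
    rewrite -[X in _ --> X](subr0 x); apply: cvgB; first exact: cvg_cst.
    rewrite -[X in _ --> X](mul0r z); apply: cvgM; last exact: cvg_cst.
    exact: cvg_harmonic.
  exact: (cvg_comp _ _ c (cu x)).
- move=> n z; rewrite normrM (ger0_norm (normal_pdf_ge0 _ _ _)).
  by rewrite ler_wpM2r// normal_pdf_ge0.
Qed.

(** With the weight [gauss_weight s] <= 1 in front of the squared modulus of the transform,
  Plancherel's identity is Fubini's theorem; then let s tend to 0. *)
Lemma plancherel_le (u : R -> R) (B : R) : L1 u -> (forall y, `|u y| <= B) ->
  continuous u ->
  (\int[mu]_x (u x ^+ 2)%:E <= \int[mu]_w (Normc.normc (fourier u w) ^+ 2)%:E)%E.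
Proof.
move=> u1 uB cu; have mu_ := L1_measurable u1.
have B0 : 0 <= B by exact: le_trans (uB 0).
pose s (n : nat) : R := n.+1%:R^-1.
have s0 n : 0 < s n by rewrite invr_gt0 ltr0Sn.
pose v n x := \int[mu]_y (u y * normal_pdf 0 (s n) (x - y)).
have iu x n : L1 (fun y => u y * normal_pdf 0 (s n) (x - y)).
  have := @L1M_bounded _ (fun y => normal_pdf 0 (s n) (x - y)) u B
    (L1_reflect x (integrable_normal_pdf 0 (s n))) mu_ uB.
  by apply: eq_integrable => // y _ /=; rewrite mulrC.
have mv n : measurable_fun setT (v n).
  have h := @L1_Fubini R (fun x y => normal_pdf 0 (s n) (x - y) * u y)
    (conv_L1 (integrable_normal_pdf 0 (s n)) u1).
  apply: L1_measurable.
  have : forall x, L1 (fun y => normal_pdf 0 (s n) (x - y) * u y).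
    move=> x; have := iu x n; apply: eq_integrable => // y _ /=; by rewrite mulrC.
  move/h; apply: eq_integrable => // x _ /=; congr EFin.
  by apply: eq_Rintegral => y _; rewrite mulrC.
have vB n x : `|v n x| <= B.
  apply: normr_Rintegral_le => //.
  have -> : B = \int[mu]_y (B * normal_pdf 0 (s n) (x - y)).
    rewrite RintegralZl//; last exact: (L1_reflect x (integrable_normal_pdf 0 (s n))).
    rewrite (Rintegral_reflect x (integrable_normal_pdf 0 (s n))).
    by rewrite /Rintegral integral_normal_pdf mulr1.
  apply: le_Rintegral => //; first exact: (L1_norm (iu x n)).
    by apply: L1Z; exact: (L1_reflect x (integrable_normal_pdf 0 (s n))).
  move=> y _; rewrite normrM (ger0_norm (normal_pdf_ge0 _ _ _)).
  by rewrite ler_wpM2r// normal_pdf_ge0.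
have u2 : L1 (fun x => u x ^+ 2).
  by apply: (@L1M_bounded _ u u B).
have cv : \int[mu]_x (u x * v n x) @[n --> \oo] --> \int[mu]_x (u x ^+ 2).
  apply: (@Rdominated_cvg _ _ _ (fun x => B * `|u x|)).
  - by move=> n; exact: measurable_funM.
  - exact: L1_measurable u2.
  - exact/L1Z/L1_norm.
  - apply: aeW => x; apply: cvgM; first exact: cvg_cst.
    exact: smooth_cvg uB cu.
  - by move=> n x; rewrite normrM mulrC ler_wpM2r.
rewrite eRintegral//.
set D := (\int[mu]_w (Normc.normc (fourier u w) ^+ 2)%:E)%E.
have le n : ((\int[mu]_x (u x * v n x))%:E <= D)%E.
  have [L e] := weighted_plancherel u1 (L1_gauss_weight (s n)).
  rewrite (_ : \int[mu]_x _ = \int[mu]_x (u x * \int[mu]_y (u y *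
      \int[mu]_w (gauss_weight (s n) w * cos (2 * pi * w * (x - y)))))); last first.
    apply: eq_Rintegral => x _; congr (_ * _); apply: eq_Rintegral => y _.
    by rewrite gauss_weight_cos.
  rewrite e.
  rewrite -eRintegral//; apply: ge0_le_integral => //.
  - by move=> w _; rewrite lee_fin mulr_ge0 ?gauss_weight_ge0// addr_ge0// sqr_ge0.
  - exact: measurable_int L.
  - apply/measurable_EFinP; rewrite (_ : (fun _ => _) =
      (fun w => fcos u (2 * pi * w) ^+ 2 + fsin u (2 * pi * w) ^+ 2)); last first.
      by apply/funext => w; rewrite normc_fourier_sqr.
    by apply: measurable_funD; apply: measurable_funX; [exact: measurable_fcos|exact: measurable_fsin].
  - move=> w _; rewrite lee_fin normc_fourier_sqr ler_piMl ?gauss_weight_le1//.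
    by rewrite addr_ge0// sqr_ge0.
have D0 : (0 <= D)%E by apply: integral_ge0 => w _; rewrite lee_fin sqr_ge0.
case: D le D0 => [r| |] le D0; [|by rewrite leey|by []].
rewrite lee_fin; apply: (ler_cvg_to cv (@cvg_cst _ r _ _ _)).
by apply: nearW => n; rewrite -lee_fin; exact: le.
Qed.

End fourier_L1.

Section convolutions.
Variable R : realType.
Notation mu := (@lebesgue_measure R).
Variables (K h : R -> R) (B : R).
Hypotheses (K1 : L1 K) (h1 : L1 h) (hB : forall x, `|h x| <= B).

Let mh : measurable_fun setT h. Proof. exact: L1_measurable. Qed.
Let mK : measurable_fun setT K. Proof. exact: L1_measurable. Qed.
Let B0 : 0 <= B. Proof. exact: le_trans (hB 0). Qed.

Lemma L1_conv_integrand x : L1 (fun y => K (x - y) * h y).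
Proof. exact: (L1M_bounded (L1_reflect x K1) mh hB). Qed.

Lemma convolutionE x : convolution K h x = \int[mu]_z (K z * h (x - z)).
Proof.
rewrite /convolution -(Rintegral_reflect x (L1_conv_integrand x)).
by apply: eq_Rintegral => z _; rewrite opprB addrCA subrr addr0.
Qed.

Lemma L1_convolution : L1 (convolution K h).
Proof.
exact: (@L1_Fubini R (fun x y => K (x - y) * h y) (conv_L1 K1 h1) L1_conv_integrand).
Qed.

Lemma convolution_le x : `|convolution K h x| <= B * \int[mu]_z `|K z|.
Proof.
apply: normr_Rintegral_le; first exact: L1_conv_integrand.
rewrite -(Rintegral_reflect x (L1_norm K1)).
rewrite -(RintegralZl _ measurableT (L1_reflect x (L1_norm K1))).
apply: le_Rintegral => //.
- exact: (L1_norm (L1_conv_integrand x)).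
- exact: (L1Z B (L1_reflect x (L1_norm K1))).
- by move=> y _; rewrite normrM mulrC ler_wpM2r.
Qed.

(** Finitely many discontinuities of [h] become negligible after integration. *)
Lemma convolution_continuous (s : seq R) :
  (forall z, z \notin s -> {for z, continuous h}) -> continuous (convolution K h).
Proof.
move=> hs x; apply/(@cvg_nbhsP _ R^o) => w wx.
rewrite [X in _ --> X]convolutionE.
have e : convolution K h \o w = (fun n => \int[mu]_z (K z * h (w n - z))).
  by apply/funext => n; rewrite /= convolutionE.
rewrite -[X in X @ _]/(convolution K h \o w) e.
have mhx (y : R) : measurable_fun setT (fun z : R => h (y - z)).
  by apply: (measurableT_comp mh); exact: measurable_funB.
apply: (@Rdominated_cvg _ _ _ (fun z => B * `|K z|)).
- by move=> n; exact: measurable_funM.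
- exact: measurable_funM.
- exact/L1Z/L1_norm.
- exists [set z | x - z \in s]; split.
  + rewrite (_ : [set _ | _] = [set` [seq x - z | z <- s]]).
      apply: countable_measurable; last exact: finite_set_countable (finite_seq _).
      by move=> r; exact: measurable_set1.
    apply/seteqP; split => z /=.
      by move=> xz; apply/mapP; exists (x - z) => //; rewrite opprB addrCA subrr addr0.
    by move=> /mapP[y ys ->]; rewrite opprB addrCA subrr addr0.
  + apply: countable_lebesgue_measure0.
    rewrite (_ : [set _ | _] = [set` [seq x - z | z <- s]]).
      exact: finite_set_countable (finite_seq _).
    apply/seteqP; split => z /=.
      by move=> xz; apply/mapP; exists (x - z) => //; rewrite opprB addrCA subrr addr0.
    by move=> /mapP[y ys ->]; rewrite opprB addrCA subrr addr0.
  + move=> z /=; apply: contra_notP => /negP xzs.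
    apply: cvgM; first exact: cvg_cst.
    have c : (fun n => w n - z) @ \oo --> x - z by apply: cvgB => //; exact: cvg_cst.
    exact: (cvg_comp _ _ c (hs _ xzs)).
- by move=> n z; rewrite normrM mulrC ler_wpM2r.
Qed.

(** Both formulas below are this instance of Fubini's theorem with b a cosine or a sine. *)
Let conv_trig (b : R -> R) (c : R) : measurable_fun setT b -> (forall x, `|b x| <= 1) ->
  \int[mu]_x (convolution K h x * b x) =
  \int[mu]_y (h y * \int[mu]_x (K x * b (x + y))).
Proof.
move=> mb b1.
have mbz : measurable_fun setT (fun z : R * R => b z.1) by exact: (measurableT_comp mb).
have iF := prodM_integrable (conv_L1 K1 h1) mbz (fun z => b1 _).
have Lx x : L1 (fun y => K (x - y) * h y * b x).
  have := L1Z (b x) (L1_conv_integrand x).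
  by apply: (eq_integrable measurableT) => y _ /=; rewrite mulrC.
have Kb y : L1 (fun x => K (x - y) * b x) by exact: (L1M_bounded (L1_shift y K1) mb b1).
have Ly y : L1 (fun x => K (x - y) * h y * b x).
  have := L1Z (h y) (Kb y).
  by apply: (eq_integrable measurableT) => x _ /=; rewrite mulrCA mulrA.
have FF := RFubini iF Lx Ly.
transitivity (\int[mu]_x \int[mu]_y (K (x - y) * h y * b x)).
  apply: eq_Rintegral => x _.
  by rewrite -(RintegralZr _ measurableT (L1_conv_integrand x)).
rewrite FF; apply: eq_Rintegral => y _.
have Kb' : L1 (fun x => K x * b (x + y)).
  apply: (@L1M_bounded _ K (fun x => b (x + y)) 1) => //.
  by apply: (measurableT_comp mb); exact: measurable_funD.
rewrite -(Rintegral_shift y Kb') -(RintegralZl _ measurableT (L1_shift y Kb')).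
by apply: eq_Rintegral => x _; rewrite subrK; ring.
Qed.

Lemma fcos_convolution c : fcos (convolution K h) c =
  fcos K c * fcos h c - fsin K c * fsin h c.
Proof.
rewrite /fcos conv_trig//; [|exact: measurable_cosM|by move=> x; exact: cos_max].
rewrite -!(RintegralZl _ measurableT); [|exact: L1_sin|exact: L1_cos].
rewrite -RintegralB//; [|by apply: L1Z; exact: L1_cos|by apply: L1Z; exact: L1_sin].
apply: eq_Rintegral => y _.
have -> : \int[mu]_x (K x * cos (c * (x + y))) =
    cos (c * y) * fcos K c - sin (c * y) * fsin K c.
  rewrite -!(RintegralZl _ measurableT); [|exact: L1_sin|exact: L1_cos].
  rewrite -RintegralB//; [|by apply: L1Z; exact: L1_cos|by apply: L1Z; exact: L1_sin].
  by apply: eq_Rintegral => x _; rewrite mulrDr cosD; ring.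
by rewrite -/(fcos K c); ring.
Qed.

Lemma fsin_convolution c : fsin (convolution K h) c =
  fsin K c * fcos h c + fcos K c * fsin h c.
Proof.
rewrite /fsin conv_trig//; [|exact: measurable_sinM|by move=> x; exact: sin_max].
rewrite -!(RintegralZl _ measurableT); [|exact: L1_sin|exact: L1_cos].
rewrite -RintegralD//; [|by apply: L1Z; exact: L1_cos|by apply: L1Z; exact: L1_sin].
apply: eq_Rintegral => y _.
have -> : \int[mu]_x (K x * sin (c * (x + y))) =
    cos (c * y) * fsin K c + sin (c * y) * fcos K c.
  rewrite -!(RintegralZl _ measurableT); [|exact: L1_cos|exact: L1_sin].
  rewrite -RintegralD//; [|by apply: L1Z; exact: L1_sin|by apply: L1Z; exact: L1_cos].
  by apply: eq_Rintegral => x _; rewrite mulrDr sinD; ring.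
by rewrite -/(fsin K c); ring.
Qed.

(** The two addition formulas combine as the modulus of a product of complex numbers. *)
Lemma normc_fourier_convolution w : Normc.normc (fourier (convolution K h) w) ^+ 2 =
  Normc.normc (fourier K w) ^+ 2 * Normc.normc (fourier h w) ^+ 2.
Proof.
rewrite !normc_fourier_sqr fcos_convolution fsin_convolution; ring.
Qed.

Lemma convolution_L2_le (s : seq R) :
  (forall z, z \notin s -> {for z, continuous h}) ->
  (\int[mu]_x (convolution K h x ^+ 2)%:E <=
   \int[mu]_w (Normc.normc (fourier K w) ^+ 2 * Normc.normc (fourier h w) ^+ 2)%:E)%E.
Proof.
move=> hs; apply: (le_trans (plancherel_le L1_convolution convolution_le (convolution_continuous hs))).
rewrite le_eqVlt; apply/orP; left; apply/eqP; apply: eq_integral => w _.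
by rewrite normc_fourier_convolution.
Qed.

End convolutions.

(** * Energy of the drift *)

Lemma lebesgue_measure_itv_lty (R : realType) (b1 b2 : bool) (s t : R) :
  (@lebesgue_measure R [set` Interval (BSide b1 s) (BSide b2 t)] < +oo)%E.
Proof. by rewrite lebesgue_measure_itv /=; case: ifPn => // _; rewrite -EFinD ltry. Qed.

Section primitive.
Variable R : realType.
Notation mu := (@lebesgue_measure R).
Variables (g : R -> R) (B : R).
Hypotheses (mg : measurable_fun setT g) (gB : forall x, `|g x| <= B).

Lemma bounded_integrable_itv (b1 b2 : bool) (s t : R) :
  mu.-integrable [set` Interval (BSide b1 s) (BSide b2 t)] (EFin \o g).
Proof.
apply: measurable_bounded_integrable.
- exact: measurable_itv.
- exact: lebesgue_measure_itv_lty.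
- exact: measurable_funTS.
- exists B; split; first exact: num_real.
  by move=> M BM x _ /=; rewrite (le_trans (gB x))// ltW.
Qed.

Let ib := bounded_integrable_itv.

Lemma primitive0B s t : s <= t ->
  primitive0 g t - primitive0 g s = \int[mu]_(x in `]s, t]) g x.
Proof.
move=> st.
have oc a b : \int[mu]_(x in `]a, b]) g x = \int[mu]_(x in `[a, b]) g x.
  by rewrite Rintegral_itv_obnd_cbnd//; exact: ib.
have split3 a b c : a <= b -> b <= c ->
  \int[mu]_(x in `[a, c]) g x - \int[mu]_(x in `[a, b]) g x = \int[mu]_(x in `]b, c]) g x.
  by move=> ab bc; rewrite Rintegral_itvB//; exact: ib.
rewrite /primitive0; have [s0|s0] := leP 0 s.
  by rewrite (le_trans s0 st) split3.
have [t0|t0] := leP 0 t.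
  rewrite opprK -(oc 0 t) -(split3 s)//; last exact: ltW.
  by rewrite subrK oc.
rewrite opprK addrC -[X in _ - X]oc -(split3 s)//; last exact: ltW.
by rewrite opprB addrCA subrr addr0 oc.
Qed.

(** Cauchy-Schwarz, from the integral of the square of the deviation of [g] from its mean. *)
Lemma Rintegral_itv_sqr_le s t : s <= t ->
  (\int[mu]_(x in `]s, t]) g x) ^+ 2 <= (t - s) * \int[mu]_(x in `]s, t]) (g x ^+ 2).
Proof.
rewrite le_eqVlt => /orP[/eqP <-|st].
  by rewrite set_itv_ge ?bnd_simp ?ltxx// !Rintegral_set0 expr0n mulr0.
have mI : measurable (`]s, t]%classic : set (measurableTypeR R)) by exact: measurable_itv.
have i1 : mu.-integrable `]s, t] (EFin \o g) by exact: ib.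
have i2 : mu.-integrable `]s, t] (EFin \o (fun x => g x ^+ 2)).
  apply: measurable_bounded_integrable => //.
  - exact: lebesgue_measure_itv_lty.
  - by apply: measurable_funTS; exact: measurable_funX.
  - exists (B ^+ 2); split; first exact: num_real.
    move=> M BM x _ /=; rewrite normrX (le_trans _ (ltW BM))//.
    by rewrite ler_sqr ?nnegrE// (le_trans _ (gB x)).
set A := \int[mu]_(x in `]s, t]) g x; set Q := \int[mu]_(x in `]s, t]) (g x ^+ 2).
have ic (c : R) : mu.-integrable `]s, t] (EFin \o cst c).
  apply: measurable_bounded_integrable => //.
  - exact: lebesgue_measure_itv_lty.
  - exact: bounded_cst.
have ts0 : 0 < t - s by rewrite subr_gt0.
pose c := A / (t - s).
have iZ : mu.-integrable `]s, t] (EFin \o (fun x => (2 * c) * g x)).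
  have := integrableZl mI (2 * c) i1.
  by apply: (eq_integrable mI) => x _ /=; rewrite EFinM.
have iB : mu.-integrable `]s, t] (EFin \o (fun x => g x ^+ 2 - (2 * c) * g x)).
  have := integrableB mI i2 iZ.
  by apply: (eq_integrable mI) => x _ /=; rewrite EFinB.
have : 0 <= \int[mu]_(x in `]s, t]) (g x ^+ 2 - (2 * c) * g x + c ^+ 2).
  apply: Rintegral_ge0 => x _.
  by rewrite (_ : _ + _ = (g x - c) ^+ 2) ?sqr_ge0//; ring.
rewrite (RintegralD mI iB (ic (c ^+ 2))) (RintegralB mI i2 iZ) (RintegralZl _ mI i1).
have -> : \int[mu]_(x in `]s, t]) cst (c ^+ 2) x = c ^+ 2 * (t - s).
  rewrite Rintegral_cst//; congr (_ * _).
  have e : mu `]s, t] = (t - s)%:E by rewrite lebesgue_measure_itv /= lte_fin st.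
  exact: (congr1 fine e).
rewrite -/A -/Q.
have -> : Q - 2 * c * A + c ^+ 2 * (t - s) = Q - A ^+ 2 / (t - s).
  by rewrite /c; field; exact: lt0r_neq0.
by rewrite subr_ge0 ler_pdivrMr// mulrC.
Qed.

End primitive.

Lemma primitive0_sub (R : realType) (g1 g2 : R -> R) (B1 B2 s t : R) :
  measurable_fun setT g1 -> (forall x, `|g1 x| <= B1) ->
  measurable_fun setT g2 -> (forall x, `|g2 x| <= B2) -> s <= t ->
  primitive0 g1 t - primitive0 g2 t - (primitive0 g1 s - primitive0 g2 s) =
  primitive0 (g1 \- g2) t - primitive0 (g1 \- g2) s.
Proof.
move=> m1 b1 m2 b2 st.
have b12 x : `|(g1 \- g2) x| <= B1 + B2.
  by apply: le_trans (ler_normB _ _) _; exact: lerD.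
rewrite (primitive0B (measurable_funB m1 m2) b12 st).
have -> : forall A B C D : R, A - B - (C - D) = (A - C) - (B - D) by move=> *; ring.
rewrite (primitive0B m1 b1 st) (primitive0B m2 b2 st) -RintegralB.
- by [].
- exact: measurable_itv.
- exact: bounded_integrable_itv m1 b1 _ _ _ _.
- exact: bounded_integrable_itv m2 b2 _ _ _ _.
Qed.

(** Cauchy-Schwarz on each interval of the grid, after which the right-hand sides telescope. *)
Lemma increments_energy_le (R : realType) (u : R -> R) (B e : R) :
  L1 u -> (forall x, `|u x| <= B) ->
  (\int[@lebesgue_measure R]_x (u x ^+ 2)%:E <= e%:E)%E ->
  forall n (t : nat -> R), (forall i, (i < n)%N -> t i <= t i.+1) ->
  \sum_(i < n) (primitive0 u (t i.+1) - primitive0 u (t i)) ^+ 2 / (t i.+1 - t i) <= e.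
Proof.
move=> u1 uB ue n t tS; have mu_ := L1_measurable u1.
have B0 : 0 <= B by exact: le_trans (uB 0).
have u2 : L1 (fun x => u x ^+ 2) by exact: (@L1M_bounded _ u u B).
have u2B x : `|u x ^+ 2| <= B ^+ 2 by rewrite normrX ler_sqr ?nnegrE.
have t0n : t 0%N <= t n.
  elim: n tS => [//|n IH] tS; apply: le_trans (IH _) (tS n _) => //.
  by move=> i ni; apply: tS; exact: ltnW.
pose V := primitive0 (fun x => u x ^+ 2).
have le i : (i < n)%N ->
    (primitive0 u (t i.+1) - primitive0 u (t i)) ^+ 2 / (t i.+1 - t i) <=
    V (t i.+1) - V (t i).
  move=> ni; have ti := tS i ni.
  rewrite /V (primitive0B mu_ uB ti) (primitive0B (L1_measurable u2) u2B ti).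
  move: ti; rewrite le_eqVlt => /orP[/eqP <-|ti].
    by rewrite subrr invr0 mulr0; apply: Rintegral_ge0 => x _; exact: sqr_ge0.
  rewrite ler_pdivrMr ?subr_gt0// mulrC.
  exact: (Rintegral_itv_sqr_le mu_ uB (ltW ti)).
apply: (@le_trans _ _ (\sum_(i < n) (V (t i.+1) - V (t i)))).
  by apply: ler_sum => i _; exact: le.
rewrite -(big_mkord xpredT (fun i => V (t i.+1) - V (t i))).
rewrite (telescope_sumr (V \o t))//= /V (primitive0B (L1_measurable u2) u2B t0n).
rewrite -lee_fin; apply: le_trans ue.
have i2 := bounded_integrable_itv (L1_measurable u2) u2B false false (t 0%N) (t n).
rewrite /Rintegral fineK; last exact: integrable_fin_num i2.
apply: ge0_subset_integral => //.
- exact: measurable_int u2.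
- by move=> x _; rewrite lee_fin sqr_ge0.
Qed.

(** * Functions with a jump in the classes *)

Section Lfun2.
Variable R : realType.
Notation mu := (@lebesgue_measure R).

Lemma L1_bounded_Lfun2 (f : R -> R) (B : R) : L1 f -> (forall x, `|f x| <= B) ->
  f \in Lfun mu 2%:E.
Proof.
move=> f1 fB; have mf := L1_measurable f1.
rewrite inE; apply/andP; split; rewrite inE/=; first exact: mf.
have f2 : L1 (fun x => f x ^+ 2) by exact: (@L1M_bounded _ f f B).
rewrite /finite_norm unlock /Lnorm poweR_lty//.
rewrite (_ : \int[mu]_x _ = \int[mu]_x (f x ^+ 2)%:E)%E.
  exact: integrable_lty f2.
apply: eq_integral => x _ /=.
by rewrite powR_mulrn// real_normK ?num_real.
Qed.

End Lfun2.

(** [step_plus] is a step of height a at [th] plus the smooth function [Q]: its derivative extends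
  continuously by [q] across [th], which is the shape required of functions in the classes. *)
Section jump_class.
Variables (R : realType) (a th : R) (Q q : R -> R).
Hypotheses (a0 : 0 < a) (dQ : forall x : R, is_derive x 1 Q (q x)) (cq : continuous q).
Notation mu := (@lebesgue_measure R).

Definition step_plus (x : R) : R := (if th < x then a else 0) + Q x.

Let cQ x : {for x, continuous Q}. Proof. exact: is_derive_continuous (dQ x). Qed.

Lemma near_gt_step_plus x : th < x -> \near x, step_plus x = a + Q x.
Proof.
move=> tx; near=> y; rewrite /step_plus ifT//.
by near: y; exact: lt_nbhsr.
Unshelve. all: by end_near. Qed.

Lemma near_lt_step_plus x : x < th -> \near x, step_plus x = 0 + Q x.
Proof.
move=> tx; near=> y; rewrite /step_plus ifF//.
apply/negbTE; rewrite -leNgt ltW//.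
by near: y; exact: lt_nbhsl.
Unshelve. all: by end_near. Qed.

Lemma step_plus_derive x : x != th -> is_derive x 1 step_plus (q x).
Proof.
have d (b : R) : is_derive x 1 (fun y => b + Q y) (q x).
  have h := is_deriveD (is_derive_cst b x 1) (dQ x).
  by apply: (is_derive_eq h); rewrite add0r.
rewrite neq_lt => /orP[tx|tx].
  by apply: near_eq_is_derive (d 0); near do apply/esym; exact: near_lt_step_plus.
by apply: near_eq_is_derive (d a); near do apply/esym; exact: near_gt_step_plus.
Unshelve. all: by end_near. Qed.

Lemma step_plus_right : step_plus t @[t --> th^'+] --> a + Q th.
Proof.
have c : a + Q t @[t --> th^'+] --> a + Q th.
  by apply: cvgD; [exact: cvg_cst|apply: cvg_at_right_filter; exact: cQ].
apply: cvg_trans c; apply: near_eq_cvg; near=> t.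
rewrite /step_plus ifT//.
Unshelve. all: by end_near. Qed.

Lemma step_plus_left : step_plus t @[t --> th^'-] --> Q th.
Proof.
have c : Q t @[t --> th^'-] --> Q th by apply: cvg_at_left_filter; exact: cQ.
apply: cvg_trans c; apply: near_eq_cvg; near=> t.
rewrite /step_plus ifF ?add0r//; apply/negbTE; rewrite -leNgt ltW//.
Unshelve. all: by end_near. Qed.

Lemma jump_step_plus : jump step_plus th = a.
Proof.
rewrite /jump (cvg_lim (@Rhausdorff R) step_plus_right).
by rewrite (cvg_lim (@Rhausdorff R) step_plus_left) addrK.
Qed.

Lemma change_point_step_plus : change_point step_plus th.
Proof.
split; [by apply/cvg_ex; eexists; exact: step_plus_right|
        by apply/cvg_ex; eexists; exact: step_plus_left|].
by rewrite jump_step_plus gt_eqF.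
Qed.

Lemma single_change_point_step_plus : 0 <= th <= 1 -> single_change_point step_plus th.
Proof.
move=> th01; split => //; first exact: change_point_step_plus.
move=> th' [_ _]; have [->//|tt] := eqVneq th' th.
have c := is_derive_continuous (step_plus_derive tt).
rewrite /jump (cvg_lim (@Rhausdorff R) (cvg_at_right_filter c)).
by rewrite (cvg_lim (@Rhausdorff R) (cvg_at_left_filter c)) subrr eqxx.
Qed.

Lemma derive1_step_plus x : x != th -> derive1 step_plus x = q x.
Proof. by move=> xt; rewrite derive1E; have [_ <-] := step_plus_derive xt. Qed.

Lemma derive1_step_plus_right : derive1 step_plus t @[t --> th^'+] --> q th.
Proof.
have c : q t @[t --> th^'+] --> q th by apply: cvg_at_right_filter; exact: cq.
apply: cvg_trans c; apply: near_eq_cvg; near=> t.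
rewrite derive1_step_plus// gt_eqF//.
Unshelve. all: by end_near. Qed.

Lemma derive1_step_plus_left : derive1 step_plus t @[t --> th^'-] --> q th.
Proof.
have c : q t @[t --> th^'-] --> q th by apply: cvg_at_left_filter; exact: cq.
apply: cvg_trans c; apply: near_eq_cvg; near=> t.
rewrite derive1_step_plus// lt_eqF//.
Unshelve. all: by end_near. Qed.

Lemma deriv_ext_step_plus : deriv_ext step_plus th = q.
Proof.
apply/funext => x; rewrite /deriv_ext; case: eqVneq => [->|xt].
  exact: (cvg_lim (@Rhausdorff R) derive1_step_plus_right).
exact: derive1_step_plus.
Qed.

Lemma step_plus_lipschitz (L : R) : (forall x, `|q x| <= L) ->
  forall x x', x <= x' -> ~ (x <= th <= x') ->
  `|step_plus x - step_plus x'| <= L * `|x - x'|.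
Proof.
move=> qL x x' xx' nth.
have -> : step_plus x - step_plus x' = Q x - Q x'.
  rewrite /step_plus; have [tx|xt] := ltP th x.
    by rewrite (lt_le_trans tx xx'); ring.
  have [tx'|x't] := ltP th x'; last by ring.
  by exfalso; apply: nth; rewrite xt ltW.
have [c _ e] := @MVT_segment R Q q x x' xx' (fun y _ => dQ y)
  (continuous_subspaceT cQ).
by rewrite distrC e normrM distrC ler_wpM2r.
Qed.

Lemma class_F_step_plus (m L B : R) : 1 <= m -> 0 <= th <= 1 ->
  L1 step_plus -> (forall x, `|step_plus x| <= B) ->
  L1 q -> (forall x, `|q x| <= B) ->
  (m = 1 -> forall x, `|q x| <= L) ->
  (\int[mu]_w (Normc.normc (fourier q w) * `|w| `^ (m - 1))%:E <= L%:E)%E ->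
  class_F m a L step_plus.
Proof.
move=> m1 th01 f1 fB q1 qB qL hL; rewrite /class_F.
have f2 := L1_bounded_Lfun2 f1 fB.
case: eqVneq => [me1|mn1].
  split => //; exists th; split.
  - exact: single_change_point_step_plus.
  - by rewrite jump_step_plus ler_norm.
  - exact: step_plus_lipschitz (qL me1).
have q2 := L1_bounded_Lfun2 q1 qB.
split => //; exists th; split.
- exact: single_change_point_step_plus.
- by rewrite jump_step_plus ler_norm.
- split.
  + by move=> x xt; case: (step_plus_derive xt).
  + by apply/cvg_ex; eexists; exact: derive1_step_plus_right.
  + by apply/cvg_ex; eexists; exact: derive1_step_plus_left.
  + rewrite /jump (cvg_lim (@Rhausdorff R) derive1_step_plus_right).
    by rewrite (cvg_lim (@Rhausdorff R) derive1_step_plus_left) subrr.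
  + by rewrite deriv_ext_step_plus.
- rewrite deriv_ext_step_plus; split => //; exists (fourier q) => //; split.
  + exact: measurable_fcos.
  + exact: measurable_fsin.
  + exists (fun=> q); split.
    * by move=> _; split => //; apply/Lfun1_integrable.
    * rewrite (_ : (\int[mu]_x _)%E = 0%E); first exact: cvg_cst.
      by rewrite -[RHS](integral0 mu setT); apply: eq_integral => x _; rewrite subrr expr0n.
    * rewrite (_ : (\int[mu]_w _)%E = 0%E); first exact: cvg_cst.
      rewrite -[RHS](integral0 mu setT); apply: eq_integral => w _.
      by rewrite subrr Normc.normc0 expr0n.
Qed.

End jump_class.

(** * The Gaussian distribution function *)

Section gauss_cdf.
Variables (R : realType).
Notation mu := (@lebesgue_measure R).
Notation p s := (normal_pdf 0 s).

Definition gauss_cdf (s x : R) := \int[mu]_(y in `]-oo, x]) p s y.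

Section one.
Variable s : R.
Hypothesis s0 : 0 < s.
Let sn0 : s != 0. Proof. exact: lt0r_neq0. Qed.

Let iS (A : set R) : measurable A -> mu.-integrable A (EFin \o p s).
Proof.
by move=> mA; apply: (@integrableS _ _ _ _ setT) => //; exact: integrable_normal_pdf.
Qed.

Lemma is_derive_gauss_cdf (x : R) : is_derive x 1 (gauss_cdf s) (p s x).
Proof.
have xx : x < x + 1 by rewrite ltrDl.
have [//||d e] := @continuous_FTC1 R (p s) -oo%O x (x + 1) xx (iS (measurable_itv _)).
- by rewrite /= ltNyr.
- exact: (@continuous_normal_pdf _ 0 s sn0 x).
by split; [exact: d|rewrite -derive1E; exact: e].
Qed.

Lemma gauss_cdf_ge0 x : 0 <= gauss_cdf s x.
Proof. by apply: Rintegral_ge0 => y _; exact: normal_pdf_ge0. Qed.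

Lemma gauss_cdf_tail x : 1 - gauss_cdf s x = \int[mu]_(y in `]x, +oo[) p s y.
Proof.
have -> : 1 = \int[mu]_y p s y by rewrite /Rintegral integral_normal_pdf.
rewrite -set_itvNyy Rintegral_itvB//.
by rewrite set_itvNyy; exact: integrable_normal_pdf.
Qed.

Lemma gauss_cdf_le1 x : gauss_cdf s x <= 1.
Proof.
rewrite -subr_ge0 gauss_cdf_tail; apply: Rintegral_ge0 => y _; exact: normal_pdf_ge0.
Qed.

Lemma gauss_cdfN x : gauss_cdf s (- x) = 1 - gauss_cdf s x.
Proof.
rewrite gauss_cdf_tail Rintegral_itv_obnd_cbnd; last exact: iS.
rewrite /gauss_cdf Rintegral_mkcond Rintegral_opp; last first.
  rewrite -restrict_EFin; apply/integrable_restrict => //=.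
  by rewrite setTI; exact: iS.
rewrite [RHS]Rintegral_mkcond; apply: eq_Rintegral => y _.
rewrite !patchE normal_pdf_even//.
by congr (if _ then _ else _); apply/idP/idP; rewrite !inE /= !in_itv /= andbT lerN2.
Qed.

Lemma normal_pdf_cvgy : p s x @[x --> +oo] --> 0.
Proof.
have [C C0 hC] := abs_normal_pdf_le s0.
have s20 : 2 * s != 0 by rewrite mulf_neq0.
apply: (@squeeze_cvgr _ _ _ _ (cst 0) (fun x => C * normal_peak (2 * s) * x^-1)).
- near=> x; rewrite normal_pdf_ge0/=.
  have x0 : 0 < x by near: x; exact: nbhs_pinfty_gt.
  rewrite ler_pdivlMr// mulrC.
  have := hC x; rewrite gtr0_norm// => /le_trans; apply.
  by rewrite ler_wpM2l// normal_pdf_ub.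
- exact: cvg_cst.
rewrite -[X in _ --> X](mulr0 (C * normal_peak (2 * s))).
apply: cvgM; first exact: cvg_cst.
apply/gtr0_cvgV0; first by near=> y; near: y; exact: nbhs_pinfty_gt.
exact: cvg_id.
Unshelve. all: by end_near. Qed.

(** For x >= 1 the tail is at most the integral of y p(y), which is explicit. *)
Lemma gauss_cdf_tail_le x : 1 <= x -> 1 - gauss_cdf s x <= s ^+ 2 * p s x.
Proof.
move=> x1; rewrite gauss_cdf_tail Rintegral_itv_obnd_cbnd; last exact: iS.
have e : \int[mu]_(y in `[x, +oo[) (y * p s y) = s ^+ 2 * p s x.
  rewrite (@Rintegral_ge0_continuous_FTC2y R _ (fun y => - s ^+ 2 * p s y) x 0).
  - by rewrite sub0r mulNr opprK.
  - move=> y xy; rewrite mulr_ge0 ?normal_pdf_ge0//; lra.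
  - apply: continuous_subspaceT => y; apply: cvgM; first exact: cvg_id.
    exact: continuous_normal_pdf.
  - rewrite -[X in _ --> X](mulr0 (- s ^+ 2)).
    by apply: cvgM; [exact: cvg_cst|exact: normal_pdf_cvgy].
  - by move=> y _; have h := is_deriveZ (- s ^+ 2) (is_derive_normal_pdf s0 y); case: h.
  - apply: cvg_at_right_filter; apply: cvgM; first exact: cvg_cst.
    exact: continuous_normal_pdf.
  - move=> y _; have h := is_deriveZ (- s ^+ 2) (is_derive_normal_pdf s0 y).
    rewrite derive1E (@derive_val _ _ _ _ _ _ _ h) /GRing.scale /=; field.
    exact: sn0.
rewrite -e; apply: le_Rintegral => //; first exact: iS.
  apply: (@integrableS _ _ _ _ setT) => //.
  apply: L1_le (L1_abs_normal_pdf s0) _.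
    by apply: measurable_funM => //; exact: measurable_normal_pdf.
  by move=> y; rewrite normrM (ger0_norm (normal_pdf_ge0 _ _ _)).
move=> y /=; rewrite in_itv /= andbT => xy.
rewrite ler_peMl ?normal_pdf_ge0//; exact: le_trans xy.
Qed.

Lemma gauss_cdf_continuous : continuous (gauss_cdf s).
Proof. by move=> x; exact: is_derive_continuous (is_derive_gauss_cdf x). Qed.

(** Subtracting the smooth step makes the jump at 0 integrable. *)
Definition heaviside_diff x := (if 0 < x then 1 else 0) - gauss_cdf s x.

Lemma heaviside_diff_le1 x : `|heaviside_diff x| <= 1.
Proof.
have := gauss_cdf_ge0 x; have := gauss_cdf_le1 x.
rewrite /heaviside_diff ler_norml; case: ifP => _; lra.
Qed.

Lemma L1_heaviside_diff : L1 heaviside_diff.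
Proof.
apply: (@L1_le _ _ (fun x => \1_`[-1, 1] x + s ^+ 2 * p s x)).
- apply: measurable_funB.
    apply: measurable_fun_ifT => //; exact: measurable_fun_ltr.
  by apply: continuous_measurable_fun; exact: gauss_cdf_continuous.
- apply: L1D; first exact: integrable_indic_itv.
  by apply: L1Z; exact: integrable_normal_pdf.
move=> x; rewrite indicE.
have p0 : 0 <= s ^+ 2 * p s x by rewrite mulr_ge0 ?sqr_ge0 ?normal_pdf_ge0.
have [xI|xI] := boolP (x \in `[-1, 1]%classic).
  by rewrite (le_trans (heaviside_diff_le1 x))// lerDl.
rewrite add0r /heaviside_diff; case: ltP => x0.
  have x1 : 1 <= x.
    rewrite leNgt; apply: contra xI => x1; rewrite inE /= in_itv /=; lra.
  by rewrite ger0_norm ?subr_ge0 ?gauss_cdf_le1// gauss_cdf_tail_le.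
have x1 : 1 <= - x.
  rewrite leNgt; apply: contra xI => x1; rewrite inE /= in_itv /=; lra.
rewrite sub0r normrN (ger0_norm (gauss_cdf_ge0 x)).
have := gauss_cdf_tail_le x1.
by rewrite normal_pdf_even// -gauss_cdfN opprK.
Qed.

Variable d : R.
Hypothesis d0 : 0 <= d.

(** The interval is open at 0 and closed at d so that box is exactly the difference between the
  indicators of x > 0 and of x > d. *)
Definition box (x : R) : R := \1_`]0, d] x.

Lemma box_convolution x : convolution (p s) box x = gauss_cdf s x - gauss_cdf s (x - d).
Proof.
have b1 y : `|box y| <= 1 by rewrite /box indicE; case: (_ \in _); rewrite ?normr1 ?normr0.
have L : L1 box by exact: integrable_indic_itv.
rewrite (convolutionE (integrable_normal_pdf 0 s) L b1).
rewrite (_ : gauss_cdf s x - _ = \int[mu]_(y in `]x - d, x]) p s y); last first.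
  rewrite /gauss_cdf Rintegral_itvB//; first exact: iS.
  by rewrite bnd_simp gerBl.
rewrite Rintegral_itv_obnd_cbnd; last exact: iS.
rewrite -Rintegral_itv_bndo_bndc; last exact: iS.
rewrite [RHS]Rintegral_mkcond; apply: eq_Rintegral => z _.
rewrite /box indicE patchE.
have -> : (x - z \in `]0, d]%classic) = (z \in `[x - d, x[%classic).
  apply/idP/idP; rewrite !inE /= !in_itv /= => /andP[h1 h2]; apply/andP; split; lra.
by case: ifP => _; rewrite ?mulr1 ?mulr0.
Qed.
End one.
End gauss_cdf.

(** * Transforms of Gaussian densities, their translates, and boxes *)

Section trig.
Variable R : realType.
Implicit Types x y : R.

Lemma cos_lipschitz x y : `|cos x - cos y| <= `|x - y|.
Proof.
wlog xy : x y / x <= y.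
  by move=> h; have [/h//|/ltW/h] := leP x y; rewrite distrC (distrC y).
have [c _ e] := @MVT_segment R cos (fun z => - sin z) x y xy
  (fun z _ => is_derive_cos z) (continuous_subspaceT (@continuous_cos R)).
by rewrite distrC e normrM normrN distrC ler_piMl// sin_max.
Qed.

Lemma sin_lipschitz x y : `|sin x - sin y| <= `|x - y|.
Proof.
wlog xy : x y / x <= y.
  by move=> h; have [/h//|/ltW/h] := leP x y; rewrite distrC (distrC y).
have [c _ e] := @MVT_segment R sin cos x y xy
  (fun z _ => is_derive_sin z) (continuous_subspaceT (@continuous_sin R)).
by rewrite distrC e normrM distrC ler_piMl// cos_max.
Qed.

(** The squared chord between two points of the unit circle at angle x. *)
Lemma chord_le x : 2 - 2 * cos x <= x ^+ 2.
Proof.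
have -> : 2 - 2 * cos x = 4 * sin (x / 2) ^+ 2.
  have -> : cos x = cos ((x / 2) *+ 2) by congr cos; rewrite mulr2n; field.
  by rewrite cos_mulr2n sin2cos2 !mulr2n; ring.
have := sin_lipschitz (x / 2) 0; rewrite sin0 !subr0 => h.
have h2 : `|sin (x / 2)| ^+ 2 <= `|x / 2| ^+ 2 by rewrite lerXn2r ?nnegrE.
move: h2; rewrite !real_normK ?num_real// exprMn => h2.
have -> : x ^+ 2 = 4 * (x ^+ 2 * 2^-1 ^+ 2) by field.
by rewrite ler_wpM2l.
Qed.

End trig.

Section fourier_linear.
Variable R : realType.
Notation mu := (@lebesgue_measure R).
Implicit Types (f g : R -> R) (b c w : R).

Lemma fcosD f g c : L1 f -> L1 g -> fcos (fun x => f x + g x) c = fcos f c + fcos g c.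
Proof.
move=> f1 g1; rewrite /fcos -(RintegralD measurableT (L1_cos c f1) (L1_cos c g1)).
by apply: eq_Rintegral => x _; rewrite mulrDl.
Qed.

Lemma fsinD f g c : L1 f -> L1 g -> fsin (fun x => f x + g x) c = fsin f c + fsin g c.
Proof.
move=> f1 g1; rewrite /fsin -(RintegralD measurableT (L1_sin c f1) (L1_sin c g1)).
by apply: eq_Rintegral => x _; rewrite mulrDl.
Qed.

Lemma fcosZ b f c : L1 f -> fcos (fun x => b * f x) c = b * fcos f c.
Proof.
move=> f1; rewrite /fcos -(RintegralZl _ measurableT (L1_cos c f1)).
by apply: eq_Rintegral => x _; rewrite mulrA.
Qed.

Lemma fsinZ b f c : L1 f -> fsin (fun x => b * f x) c = b * fsin f c.
Proof.
move=> f1; rewrite /fsin -(RintegralZl _ measurableT (L1_sin c f1)).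
by apply: eq_Rintegral => x _; rewrite mulrA.
Qed.

Lemma fcos_sum n (f : nat -> R -> R) c : (forall j, L1 (f j)) ->
  fcos (fun x => \sum_(j < n) f j x) c = \sum_(j < n) fcos (f j) c.
Proof.
move=> f1; rewrite /fcos -(Rintegral_sum _ (fun j : 'I_n => L1_cos c (f1 j))).
by apply: eq_Rintegral => x _; rewrite mulr_suml.
Qed.

Lemma fsin_sum n (f : nat -> R -> R) c : (forall j, L1 (f j)) ->
  fsin (fun x => \sum_(j < n) f j x) c = \sum_(j < n) fsin (f j) c.
Proof.
move=> f1; rewrite /fsin -(Rintegral_sum _ (fun j : 'I_n => L1_sin c (f1 j))).
by apply: eq_Rintegral => x _; rewrite mulr_suml.
Qed.

Lemma normc_fourier_ge0 f w : 0 <= Normc.normc (fourier f w).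
Proof. exact: sqrtr_ge0. Qed.

Lemma normc_fourierD f g w : L1 f -> L1 g ->
  Normc.normc (fourier (fun x => f x + g x) w) <=
  Normc.normc (fourier f w) + Normc.normc (fourier g w).
Proof.
move=> f1 g1.
have -> : fourier (fun x => f x + g x) w = fourier f w + fourier g w.
  rewrite /fourier -!/(fcos _ _) -!/(fsin _ _) fcosD// fsinD//.
exact: le_normcD.
Qed.

Lemma normc_fourierZ b f w : L1 f ->
  Normc.normc (fourier (fun x => b * f x) w) = `|b| * Normc.normc (fourier f w).
Proof.
move=> f1; apply/eqP; rewrite -(eqrXn2 (n := 2))//; last 2 first.
- exact: normc_fourier_ge0.
- by rewrite mulr_ge0// normc_fourier_ge0.
rewrite exprMn !normc_fourier_sqr fcosZ// fsinZ// real_normK ?num_real//.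
by apply/eqP; ring.
Qed.

Lemma normc_fourier_sum n (f : nat -> R -> R) w : (forall j, L1 (f j)) ->
  Normc.normc (fourier (fun x => \sum_(j < n) f j x) w) <=
  \sum_(j < n) Normc.normc (fourier (f j) w).
Proof.
move=> f1; elim: n => [|n IH].
  rewrite big_ord0; rewrite (_ : fourier _ _ = 0) ?Normc.normc0//.
  have z (b : R -> R) : \int[mu]_x ((\sum_(j < 0) f j x) * b x) = 0.
    rewrite /Rintegral (_ : integral _ _ _ = 0%E)//.
    by apply: integral0_eq => x _ /=; rewrite big_ord0 mul0r.
  by rewrite /fourier !z.
rewrite big_ord_recr.
rewrite (_ : (fun x => \sum_(j < n.+1) f j x) = (fun x => \sum_(j < n) f j x + f n x)); last first.
  by apply/funext => x; rewrite big_ord_recr.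
apply: le_trans (normc_fourierD _ _ (f1 n)) _; first exact: L1_sum.
by rewrite lerD2r.
Qed.

End fourier_linear.

Section transforms.
Variable R : realType.
Notation mu := (@lebesgue_measure R).
Notation p s := (normal_pdf 0 s).
Implicit Types (s d w : R).

Section gaussian.
Variable s : R.
Hypothesis s0 : 0 < s.

Lemma fcos_normal_pdf w : fcos (p s) (2 * pi * w) = gauss_weight s w.
Proof.
rewrite /fcos normal_pdf_cos// gauss_weightE//; congr expR.
by move: (@pi R) => q; field.
Qed.

Lemma fsin_normal_pdf w : fsin (p s) w = 0.
Proof. exact: normal_pdf_sin. Qed.

Lemma normc_fourier_normal_pdf w : Normc.normc (fourier (p s) w) = gauss_weight s w.
Proof.
apply/eqP; rewrite -(eqrXn2 (n := 2))//; last 2 first.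
- exact: normc_fourier_ge0.
- exact: gauss_weight_ge0.
by rewrite normc_fourier_sqr fcos_normal_pdf fsin_normal_pdf expr0n addr0.
Qed.

(** The derivative of the convolution of [p s] with [box d]. *)
Definition pdf_diff d x := p s x - p s (x - d).

Lemma L1_pdf_diff d : L1 (pdf_diff d).
Proof. by apply: L1B; [exact: L1_normal_pdf|apply: L1_shift; exact: L1_normal_pdf]. Qed.

End gaussian.

Section shift.
Variables (g : R -> R) (d c : R).
Hypothesis g1 : L1 g.

Let Lc : L1 (fun x => cos (c * d) * (g x * cos (c * x))).
Proof. by apply: L1Z; exact: L1_cos. Qed.
Let Ls : L1 (fun x => sin (c * d) * (g x * sin (c * x))).
Proof. by apply: L1Z; exact: L1_sin. Qed.
Let Lcs : L1 (fun x => cos (c * d) * (g x * sin (c * x))).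
Proof. by apply: L1Z; exact: L1_sin. Qed.
Let Lsc : L1 (fun x => sin (c * d) * (g x * cos (c * x))).
Proof. by apply: L1Z; exact: L1_cos. Qed.

Lemma fcos_shift : fcos (fun x => g (x - d)) c = cos (c * d) * fcos g c - sin (c * d) * fsin g c.
Proof.
rewrite /fcos /fsin -(RintegralZl _ measurableT (L1_cos c g1)).
rewrite -(RintegralZl _ measurableT (L1_sin c g1)) -(RintegralB measurableT Lc Ls).
rewrite -[RHS](Rintegral_shift d (L1B Lc Ls)); apply: eq_Rintegral => x _.
have -> : c * x = c * (x - d) + c * d by ring.
rewrite cosD; ring.
Qed.

Lemma fsin_shift : fsin (fun x => g (x - d)) c = cos (c * d) * fsin g c + sin (c * d) * fcos g c.
Proof.
rewrite /fcos /fsin -(RintegralZl _ measurableT (L1_cos c g1)).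
rewrite -(RintegralZl _ measurableT (L1_sin c g1)) -(RintegralD measurableT Lcs Lsc).
rewrite -[RHS](Rintegral_shift d (L1D Lcs Lsc)); apply: eq_Rintegral => x _.
have -> : c * x = c * (x - d) + c * d by ring.
rewrite sinD; ring.
Qed.

End shift.

Lemma normc_fourier_pdf_diff s d w : 0 < s -> 0 <= d ->
  Normc.normc (fourier (pdf_diff s d) w) <= d * (2 * pi) * (`|w| * gauss_weight s w).
Proof.
move=> s0 d0; have pL := L1_normal_pdf s; have pS := L1_shift d pL.
have g0 := gauss_weight_ge0 s w; have pi0 := @pi_ge0 R.
rewrite -ler_sqr ?nnegrE ?normc_fourier_ge0//; last first.
  by rewrite mulr_ge0// mulr_ge0// mulr_ge0.
have -> : pdf_diff s d = fun x => p s x + (-1) * p s (x - d).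
  by apply/funext => x; rewrite mulN1r.
rewrite normc_fourier_sqr fcosD//; last exact: L1Z.
rewrite fsinD//; last exact: L1Z.
rewrite fcosZ// fsinZ// (fcos_shift _ _ pL) (fsin_shift _ _ pL).
rewrite fcos_normal_pdf// fsin_normal_pdf//.
set t := 2 * pi * w * d; set g := gauss_weight s w.
have -> : (g + -1 * (cos t * g - sin t * 0)) ^+ 2 + (0 + -1 * (cos t * 0 + sin t * g)) ^+ 2 =
    g ^+ 2 * (2 - 2 * cos t).
  have := cos2Dsin2 t; move: (cos t) (sin t) => c1 s1 e.
  have -> : 2 - 2 * c1 = (c1 ^+ 2 + s1 ^+ 2) + 1 - 2 * c1 by rewrite e; ring.
  by ring.
have -> : (d * (2 * pi) * (`|w| * g)) ^+ 2 = g ^+ 2 * t ^+ 2.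
  have -> : (d * (2 * pi) * (`|w| * g)) ^+ 2 = (d * (2 * pi) * g) ^+ 2 * `|w| ^+ 2 by ring.
  by rewrite real_normK ?num_real// /t; ring.
by rewrite ler_wpM2l ?sqr_ge0// chord_le.
Qed.

Section box.
Variable d : R.
Hypothesis d0 : 0 <= d.

Lemma L1_box : L1 (box d).
Proof. exact: integrable_indic_itv. Qed.

Lemma box_le1 x : `|box d x| <= 1.
Proof. by rewrite /box indicE; case: (_ \in _); rewrite ?normr1 ?normr0. Qed.

Let box_integral (F f : R -> R) : (forall x : R, is_derive x 1 F (f x)) -> continuous f ->
  \int[mu]_x (box d x * f x) = F d - F 0.
Proof.
move=> dF cf; rewrite (_ : \int[mu]_x _ = \int[mu]_(x in `]0, d]) f x); last first.
  rewrite [RHS]Rintegral_mkcond; apply: eq_Rintegral => x _.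
  by rewrite /box indicE patchE; case: (_ \in _); rewrite ?mul1r ?mul0r.
have := d0; rewrite le_eqVlt => /orP[/eqP <-|dp].
  by rewrite set_itv_ge ?bnd_simp ?ltxx// Rintegral_set0 subrr.
have ci : mu.-integrable `[0, d] (EFin \o f).
  apply: continuous_compact_integrable; first exact: segment_compact.
  exact: continuous_subspaceT.
have cF x : {for x, continuous F} by exact: is_derive_continuous (dF x).
rewrite Rintegral_itv_obnd_cbnd; last first.
  by apply: integrableS ci => //; exact: subset_itv_oc_cc.
rewrite /Rintegral (@continuous_FTC2 _ f F 0 d dp)//.
- exact: continuous_subspaceT.
- split.
  + by move=> x _; case: (dF x).
  + by apply: cvg_at_right_filter; exact: cF.
  + by apply: cvg_at_left_filter; exact: cF.
- by move=> x _; rewrite derive1E; case: (dF x).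
Qed.

(** The squared chord of angle 2 pi w d, divided by (2 pi w)^2. *)
Lemma normc_fourier_box w : w != 0 ->
  Normc.normc (fourier (box d) w) ^+ 2 = (2 - 2 * cos (2 * pi * w * d)) / (2 * pi * w) ^+ 2.
Proof.
move=> w0; set c := 2 * pi * w.
have c0 : c != 0 by rewrite !mulf_neq0// gt_eqF// pi_gt0.
rewrite normc_fourier_sqr -/c.
have -> : fcos (box d) c = sin (c * d) / c.
  have dF (x : R) : is_derive x 1 (fun x => c^-1 * sin (c * x)) (cos (c * x)).
    have h := is_deriveZ c^-1 (is_derive_sinM c x).
    by apply: (is_derive_eq h); rewrite /GRing.scale /= mulrA mulVf// mul1r.
  by rewrite /fcos (box_integral dF (@continuous_cosM R c)) mulr0 sin0; ring.
have -> : fsin (box d) c = (1 - cos (c * d)) / c.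
  have dF (x : R) : is_derive x 1 (fun x => - c^-1 * cos (c * x)) (sin (c * x)).
    have h := is_deriveZ (- c^-1) (is_derive_cosM c x).
    by apply: (is_derive_eq h); rewrite /GRing.scale /= mulrA mulrNN mulVf// mul1r.
  by rewrite /fsin (box_integral dF (@continuous_sinM R c)) mulr0 cos0; ring.
have := cos2Dsin2 (c * d); move: (cos _) (sin _) => c1 s1 e.
have -> : 2 - 2 * c1 = (c1 ^+ 2 + s1 ^+ 2) + 1 - 2 * c1 by rewrite e; ring.
by clearbody c; field.
Qed.

Lemma normc_fourier_box_le w : Normc.normc (fourier (box d) w) ^+ 2 <= d ^+ 2.
Proof.
have [->|w0] := eqVneq w 0.
  rewrite normc_fourier_sqr mulr0.
  have -> : fcos (box d) 0 = d.
    have dF (x : R) : is_derive x 1 id (cos (0 * x)) by rewrite mul0r cos0; exact: is_derive_id.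
    by rewrite /fcos (box_integral dF (@continuous_cosM R 0)) subr0.
  have -> : fsin (box d) 0 = 0.
    have dF (x : R) : is_derive x 1 (cst 0) (sin (0 * x)).
      by rewrite mul0r sin0; exact: is_derive_cst.
    by rewrite /fsin (box_integral dF (@continuous_sinM R 0)) subrr.
  by rewrite expr0n addr0.
have pn0 : pi != 0 :> R by rewrite gt_eqF// pi_gt0.
rewrite normc_fourier_box// ler_pdivrMr; last by rewrite exprn_even_gt0//= !mulf_neq0.
by apply: le_trans (chord_le _) _; rewrite exprMn mulrC.
Qed.

Lemma normc_fourier_box_tail w : w != 0 ->
  Normc.normc (fourier (box d) w) ^+ 2 <= w ^- 2.
Proof.
move=> w0; rewrite normc_fourier_box//.
have pn0 : pi != 0 :> R by rewrite gt_eqF// pi_gt0.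
rewrite ler_pdivrMr; last by rewrite exprn_even_gt0//= !mulf_neq0.
have -> : w ^- 2 * (2 * pi * w) ^+ 2 = 4 * pi ^+ 2 :> R by field.
have h1 := cos_geN1 (2 * pi * w * d); have h2 := @pi_ge2 R.
by nra.
Qed.

End box.
End transforms.

(** * Moments of Gaussian weights *)

Section moments.
Variable R : realType.
Notation mu := (@lebesgue_measure R).
Implicit Types (r s w u v : R).

(** Here v stands for half of a Gaussian exponent in u. *)
Lemma powR_le_expR r : 0 <= r -> exists2 A : R, 0 < A &
  forall u v, 0 <= u -> u ^+ 2 <= v -> u `^ r <= A * expR v.
Proof.
move=> r0.
have [n nr] : exists n : nat, r <= n.+1%:R.
  by exists (Num.truncn r); exact/ltW/truncnS_gt.
exists (n.+1)`!%:R => [|u v u0 uv]; first by rewrite ltr0n fact_gt0.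
have v0 : 0 <= v by rewrite (le_trans _ uv)// sqr_ge0.
have e1 : 1 <= expR v by rewrite -[leLHS]expR0 ler_expR.
have f1 : (1 : R) <= (n.+1)`!%:R by rewrite ler1n fact_gt0.
have [u1|u1] := leP u 1.
  apply: (@le_trans _ _ 1); last by rewrite -[leLHS]mul1r ler_pM.
  by have := @ge0_ler_powR _ _ r0 u 1; rewrite powR1; apply; rewrite ?nnegrE.
apply: (@le_trans _ _ (u ^+ 2 ^+ n.+1)).
  rewrite -exprM -powR_mulrn// ler_powR ?(ltW u1)//.
  by rewrite (le_trans nr)// ler_nat leq_pmull.
apply: (@le_trans _ _ (v ^+ n.+1)); first by rewrite lerXn2r ?nnegrE ?sqr_ge0.
have f0 : 0 < (n.+1)`!%:R :> R by rewrite ltr0n fact_gt0.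
have := expR_ge1Dxn n v0; rewrite -ler_pdivrMl// mulrC.
by apply: le_trans; rewrite lerDr.
Qed.

(** The mass is the value at 0 of the inverse transform, a Gaussian density. *)
Lemma gauss_weight_mass s : 0 < s -> \int[mu]_w gauss_weight s w <= s^-1.
Proof.
move=> s0; have := gauss_weight_cos s0 0.
rewrite (_ : \int[mu]_w _ = \int[mu]_w gauss_weight s w); last first.
  by apply: eq_Rintegral => w _; rewrite mulr0 cos0 mulr1.
move=> ->; rewrite normal_pdf0E// expr0n mulr0 expR0 mulr1 /normal_peak.
have p2 := @pi_ge2 R; have s20 := sqr_ge0 s.
rewrite lef_pV2 ?posrE//; last by rewrite sqrtr_gt0; nra.
by rewrite -[leLHS]ger0_norm ?(ltW s0)// -sqrtr_sqr ler_sqrt; nra.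
Qed.

(** Half of the exponent absorbs the power; the other half is again a Gaussian weight. *)
Lemma gauss_moment r : 0 <= r -> exists2 C : R, 0 < C & forall s, 0 < s ->
  L1 (fun w => gauss_weight s w * `|w| `^ r) /\
  \int[mu]_w (gauss_weight s w * `|w| `^ r) <= C * s `^ (- (r + 1)).
Proof.
move=> r0; have [A A0 hA] := powR_le_expR r0.
have q0 : 0 < Num.sqrt (2 : R) by rewrite sqrtr_gt0.
exists (A * Num.sqrt 2) => [|s s0]; first by rewrite mulr_gt0.
pose t := s / Num.sqrt 2.
have t0 : 0 < t by rewrite divr_gt0.
have t2 : t ^+ 2 = s ^+ 2 / 2 by rewrite exprMn exprVn sqr_sqrtr.
have key w : gauss_weight s w * `|w| `^ r <= A * s `^ (- r) * gauss_weight t w.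
  have sp0 : 0 < s `^ r by rewrite powR_gt0.
  have -> : `|w| `^ r = s `^ (- r) * (s * `|w|) `^ r.
    by rewrite powRM ?(ltW s0)// powRN mulKf ?gt_eqF.
  have -> : A * s `^ (- r) * gauss_weight t w = s `^ (- r) * (A * gauss_weight t w) by ring.
  rewrite mulrCA ler_wpM2l ?powR_ge0//.
  rewrite !gauss_weightE// t2.
  have -> : - (2 * pi ^+ 2 * (s ^+ 2 / 2)) * w ^+ 2 = - (pi ^+ 2 * s ^+ 2 * w ^+ 2) by field.
  have -> : - (2 * pi ^+ 2 * s ^+ 2) * w ^+ 2 =
      - (pi ^+ 2 * s ^+ 2 * w ^+ 2) - (pi ^+ 2 * s ^+ 2 * w ^+ 2) by ring.
  set v := pi ^+ 2 * s ^+ 2 * w ^+ 2.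
  rewrite expRD -mulrA [A * _]mulrC ler_wpM2l ?expR_ge0//.
  rewrite expRN ler_pdivrMl ?expR_gt0// [expR v * A]mulrC.
  apply: hA; first by rewrite mulr_ge0// ltW.
  rewrite exprMn real_normK ?num_real// /v ler_wpM2r ?sqr_ge0//.
  by rewrite ler_peMl ?sqr_ge0// exprn_ege1//; have := @pi_ge2 R; lra.
have Lt : L1 (fun w => A * s `^ (- r) * gauss_weight t w).
  by apply: L1Z; exact: L1_gauss_weight.
have Ls : L1 (fun w => gauss_weight s w * `|w| `^ r).
  apply: L1_le Lt _ => [|w].
    apply: measurable_funM; first exact: L1_measurable (L1_gauss_weight s).
    by apply: (@measurableT_comp _ _ _ _ _ _ (@powR R ^~ r)) => //; exact: measurable_powR.
  by rewrite ger0_norm ?key// mulr_ge0 ?gauss_weight_ge0 ?powR_ge0.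
split => //; apply: (@le_trans _ _ (\int[mu]_w (A * s `^ (- r) * gauss_weight t w))).
  by apply: le_Rintegral => //.
rewrite (RintegralZl _ measurableT (L1_gauss_weight t)).
have -> : A * Num.sqrt 2 * s `^ (- (r + 1)) = A * s `^ (- r) * t^-1.
  rewrite opprD powRD; last by rewrite (gt_eqF s0) implybT.
  rewrite (powR_inv1 (ltW s0)) /t invf_div; ring.
by rewrite ler_wpM2l ?gauss_weight_mass// mulr_ge0 ?powR_ge0// ltW.
Qed.

End moments.

(** * The two hypotheses *)

Section mixture.
Variables (R : realType) (a s : R) (n : nat) (c sig : nat -> R).
Hypotheses (a0 : 0 < a) (s0 : 0 < s) (sig0 : forall j, 0 < sig j).
Notation mu := (@lebesgue_measure R).
Notation p s := (normal_pdf 0 s).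
Implicit Types (d x w : R).

(** [smooth_part] is [Q] and [smooth_deriv] is [q] for the function with change-point [d]; the
  coefficients [c] and scales [sig] are those of the mixture G. *)
Definition smooth_part d x :=
  a * (\sum_(j < n) c j * (gauss_cdf (sig j) x - gauss_cdf (sig j) (x - d)) - gauss_cdf s x).

Definition smooth_deriv d x := a * (\sum_(j < n) c j * pdf_diff (sig j) d x - p s x).

(** G * box - box, the difference between the two hypotheses divided by a. *)
Definition mixture_error d x :=
  \sum_(j < n) c j * convolution (p (sig j)) (box d) x - box d x.

Definition mixture_hat w := \sum_(j < n) c j * gauss_weight (sig j) w.

Definition hypothesis_fun d x := a * (heaviside_diff s x + mixture_error d x).

Lemma is_derive_smooth_part d (x : R) : is_derive x 1 (smooth_part d) (smooth_deriv d x).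
Proof.
have dsh t (t0 : 0 < t) : is_derive x 1 (fun x => gauss_cdf t (x - d)) (p t (x - d)).
  have h1 : is_derive x 1 (fun x : R => x - d) 1.
    have h := is_deriveB (is_derive_id x (1 : R)) (is_derive_cst d x (1 : R)).
    by apply: (is_derive_eq h); rewrite subr0.
  have h2 : is_derive x 1 (gauss_cdf t \o (fun x => x - d)) (p t (x - d) * 1).
    by apply: is_derive1_comp; exact: is_derive_gauss_cdf.
  by apply: (is_derive_eq h2); rewrite mulr1.
have h (j : 'I_n) : is_derive x 1
    (fun x => c j * (gauss_cdf (sig j) x - gauss_cdf (sig j) (x - d))) (c j * pdf_diff (sig j) d x).
  exact: (is_deriveZ (c j) (is_deriveB (is_derive_gauss_cdf (sig0 j) x) (dsh _ (sig0 j)))).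
have hs := is_deriveZ a (is_deriveB (is_derive_sum h) (is_derive_gauss_cdf s0 x)).
rewrite (_ : smooth_part d = a \*: (\sum_(j < n)
  (fun x => c j * (gauss_cdf (sig j) x - gauss_cdf (sig j) (x - d))) - gauss_cdf s))//.
by apply/funext => y; rewrite /smooth_part /= !fctE fct_sumE.
Qed.

Lemma continuous_smooth_deriv d : continuous (smooth_deriv d).
Proof.
move=> x; apply: cvgM; first exact: cvg_cst.
apply: cvgB; last by apply: continuous_normal_pdf; rewrite gt_eqF.
apply: cvg_big => [|j _]; first exact: add_continuous.
  apply: cvgM; first exact: cvg_cst.
have sn : sig j != 0 by rewrite gt_eqF.
apply: cvgB; first exact: continuous_normal_pdf.
apply: (@continuous_comp _ _ _ (fun x => x - d) (p (sig j))); last exact: continuous_normal_pdf.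
by apply: cvgB; [exact: cvg_id|exact: cvg_cst].
Qed.

Lemma L1_smooth_deriv d : L1 (smooth_deriv d).
Proof.
apply: L1Z; apply: L1B; last exact: L1_normal_pdf.
apply: L1_sum => j; apply: L1Z; exact: L1_pdf_diff.
Qed.

Let conv_box_le1 d j x : `|convolution (p (sig j)) (box d) x| <= 1.
Proof.
have h := convolution_le (L1_normal_pdf (sig j)) (L1_box d) (@box_le1 _ d) x.
apply: le_trans h _; rewrite mul1r (_ : \int[mu]_z _ = \int[mu]_z p (sig j) z).
  by rewrite /Rintegral integral_normal_pdf.
by apply: eq_Rintegral => z _; rewrite ger0_norm// normal_pdf_ge0.
Qed.

Let L1_conv_box d j : L1 (convolution (p (sig j)) (box d)).
Proof. exact: L1_convolution (L1_normal_pdf (sig j)) (L1_box d) (@box_le1 _ d). Qed.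

Lemma L1_mixture_error d : L1 (mixture_error d).
Proof. by apply: L1B (L1_box d); apply: L1_sum => j; exact: L1Z. Qed.

Lemma mixture_error_le d x : `|mixture_error d x| <= \sum_(j < n) `|c j| + 1.
Proof.
apply: le_trans (ler_normB _ _) _; apply: lerD (box_le1 d x).
apply: le_trans (ler_norm_sum _ _ _) _; apply: ler_sum => j _.
by rewrite normrM ler_piMr.
Qed.

Lemma mixture_error0 x : mixture_error 0 x = 0.
Proof.
rewrite /mixture_error {2}/box set_itv_ge ?bnd_simp ?ltxx// indic0 subr0 big1// => j _.
by rewrite box_convolution// subr0 subrr mulr0.
Qed.

(** The compensation is smooth and the box jumps at its two ends. *)
Lemma mixture_error_continuous d x : 0 <= d -> x \notin [:: 0; d] ->
  {for x, continuous (mixture_error d)}.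
Proof.
move=> d0; rewrite !inE negb_or => /andP[x0 xd].
apply: cvgB.
  apply: cvg_big => [|j _]; first exact: add_continuous.
  apply: cvgM; first exact: cvg_cst.
  rewrite (_ : convolution _ _ = fun x => gauss_cdf (sig j) x - gauss_cdf (sig j) (x - d)).
    apply: cvgB; first exact: gauss_cdf_continuous.
    apply: (@continuous_comp _ _ _ (fun x => x - d) (gauss_cdf (sig j))).
      by apply: cvgB; [exact: cvg_id|exact: cvg_cst].
    exact: gauss_cdf_continuous.
  by apply/funext => y; exact: box_convolution.
have locally_cst (b : R) : (\near x, box d x = b) -> box d y @[y --> x] --> box d x.
  move=> nb; have -> : box d x = b by exact: nbhs_singleton nb.
  have cb : b @[y --> x] --> b by exact: cvg_cst.
  apply: cvg_trans cb; apply: near_eq_cvg; move: nb; apply: filterS => y; exact: esym.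
have [xn|xp] := ltP x 0.
  apply: (locally_cst 0); near=> y; rewrite /box indicE memNset//= in_itv/=.
  apply/negP; rewrite negb_and -leNgt; apply/orP; left; apply/ltW.
  by near: y; exact: lt_nbhsl.
have {}xp : 0 < x by rewrite lt_neqAle eq_sym x0.
have [dx|xd'] := ltP d x.
  apply: (locally_cst 0); near=> y; rewrite /box indicE memNset//= in_itv/=.
  apply/negP; rewrite negb_and -ltNge; apply/orP; right.
  by near: y; exact: lt_nbhsr.
have {}xd' : x < d by rewrite lt_neqAle xd.
apply: (locally_cst 1); near=> y; rewrite /box indicE mem_set//= in_itv/=.
apply/andP; split; first by near: y; exact: lt_nbhsr.
by apply/ltW; near: y; exact: lt_nbhsl.
Unshelve. all: by end_near. Qed.

Lemma normc_fourier_mixture_error d w : 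
  Normc.normc (fourier (mixture_error d) w) ^+ 2 =
  (1 - mixture_hat w) ^+ 2 * Normc.normc (fourier (box d) w) ^+ 2.
Proof.
have Lb := L1_box d.
have Lm : L1 (fun x => \sum_(j < n) c j * convolution (p (sig j)) (box d) x).
  by apply: L1_sum => j; exact: L1Z.
have Lz j : L1 (fun x => c j * convolution (p (sig j)) (box d) x) by exact: L1Z.
have e : mixture_error d = fun x => \sum_(j < n) c j * convolution (p (sig j)) (box d) x +
    (-1) * box d x.
  by apply/funext => x; rewrite mulN1r.
have ec : fcos (mixture_error d) (2 * pi * w) =
    (mixture_hat w - 1) * fcos (box d) (2 * pi * w).
  rewrite e fcosD//; last exact: L1Z.
  rewrite fcosZ// (fcos_sum n _ Lz) mulrBl mul1r mulN1r mulr_suml; congr (_ - _).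
  apply: eq_bigr => j _; rewrite fcosZ//.
  rewrite (fcos_convolution (L1_normal_pdf (sig j)) Lb (@box_le1 _ d)).
  by rewrite fcos_normal_pdf// fsin_normal_pdf// mul0r subr0 mulrA.
have es : fsin (mixture_error d) (2 * pi * w) =
    (mixture_hat w - 1) * fsin (box d) (2 * pi * w).
  rewrite e fsinD//; last exact: L1Z.
  rewrite fsinZ// (fsin_sum n _ Lz) mulrBl mul1r mulN1r mulr_suml; congr (_ - _).
  apply: eq_bigr => j _; rewrite fsinZ//.
  rewrite (fsin_convolution (L1_normal_pdf (sig j)) Lb (@box_le1 _ d)).
  by rewrite fcos_normal_pdf// fsin_normal_pdf// mul0r add0r mulrA.
rewrite !normc_fourier_sqr ec es; ring.
Qed.

(** The first expression shows that the function is integrable and how it depends on [d]; the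
  second one shows its regularity. *)
Lemma hypothesis_funE d : 0 <= d -> hypothesis_fun d = step_plus a d (smooth_part d).
Proof.
move=> d0; apply/funext => x; rewrite /hypothesis_fun /mixture_error /step_plus /smooth_part.
rewrite /heaviside_diff (eq_bigr (fun j : 'I_n =>
  c j * (gauss_cdf (sig j) x - gauss_cdf (sig j) (x - d)))); last first.
  by move=> j _; rewrite box_convolution.
move: (\sum_(j < n) _) => S.
have -> : box d x = (if 0 < x then 1 else 0) - (if d < x then 1 else 0).
  rewrite /box indicE; have [xI|xI] := boolP (x \in `]0, d]%classic).
    move: xI; rewrite inE /= in_itv /= => /andP[-> xd].
    by rewrite ltNge xd subr0.
  move: xI; rewrite notin_setE /= in_itv /= => /negP; rewrite negb_and -ltNge.
  have [dx _|xd] := ltP d x; first by rewrite (le_lt_trans d0 dx) subrr.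
  by rewrite orbF => /negbTE ->; rewrite subrr.
by case: (0 < x); case: (d < x); ring.
Qed.

Lemma L1_hypothesis_fun d : L1 (hypothesis_fun d).
Proof. by apply: L1Z; apply: L1D; [exact: L1_heaviside_diff|exact: L1_mixture_error]. Qed.

Lemma hypothesis_fun_le d x : `|hypothesis_fun d x| <= a * (1 + (\sum_(j < n) `|c j| + 1)).
Proof.
rewrite normrM gtr0_norm// ler_wpM2l ?(ltW a0)//.
apply: le_trans (ler_normD _ _) _; apply: lerD; first exact: heaviside_diff_le1.
exact: mixture_error_le.
Qed.

Lemma convolution_hypothesis_fun (K : R -> R) d x : L1 K ->
  convolution K (hypothesis_fun d) x - convolution K (hypothesis_fun 0) x =
  convolution K (fun x => a * mixture_error d x) x.
Proof.
move=> K1; rewrite /convolution.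
have Lh d' := L1_conv_integrand K1 (L1_hypothesis_fun d') (hypothesis_fun_le d') x.
rewrite -(RintegralB measurableT (Lh d) (Lh 0)); apply: eq_Rintegral => y _.
rewrite /hypothesis_fun mixture_error0; ring.
Qed.

End mixture.

Section reduction.
Variables (R : realType) (a s : R) (n : nat) (c sig : nat -> R) (m L : R).
Hypotheses (a0 : 0 < a) (s0 : 0 < s) (sig0 : forall j, 0 < sig j) (m1 : 1 <= m).
Notation mu := (@lebesgue_measure R).
Notation p s := (normal_pdf 0 s).
Implicit Types (d x w : R).
Notation moment t r := (\int[mu]_w (gauss_weight t w * `|w| `^ r)).

(** The amount of smoothness spent: an upper bound for the weighted integral of the transform of
  the derivative, and for m = 1 also for the Lipschitz constant. *)
Definition class_budget d :=
  a * (\sum_(j < n) `|c j| * (d * (2 * pi) * moment (sig j) m) + moment s (m - 1)).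

Let L1_moment t r : 0 < t -> 0 <= r -> L1 (fun w => gauss_weight t w * `|w| `^ r).
Proof. by move=> t0 r0; have [C _ /(_ _ t0)[]] := @gauss_moment R r r0. Qed.

Let m0 : 0 <= m - 1. Proof. by rewrite subr_ge0. Qed.
Let m0' : 0 <= m. Proof. exact: le_trans m1. Qed.

Lemma mul_norm_powR w : `|w| * `|w| `^ (m - 1) = `|w| `^ m.
Proof. by rewrite mulr_powRB1// (lt_le_trans _ m1). Qed.

(** Fourier inversion, since the cosine is 1-Lipschitz. *)
Lemma pdf_diff_le t d x : 0 < t -> 0 <= d ->
  `|pdf_diff t d x| <= d * (2 * pi) * moment t 1.
Proof.
move=> t0 d0; have pi0 := @pi_ge0 R.
have Lc z : L1 (fun w => gauss_weight t w * cos (2 * pi * w * z)).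
  rewrite (_ : (fun w => _) = fun w => gauss_weight t w * cos ((2 * pi * z) * w)).
    exact: L1_cos (L1_gauss_weight t).
  by apply/funext => w; rewrite -mulrA [w * z]mulrC mulrA.
rewrite /pdf_diff -!gauss_weight_cos// -(RintegralB measurableT (Lc x) (Lc (x - d))).
have L1m := L1_moment t0 ler01.
rewrite -(RintegralZl _ measurableT L1m).
apply: normr_Rintegral_le; first exact: L1B (Lc x) (Lc (x - d)).
apply: le_Rintegral => //.
- exact: L1_norm (L1B (Lc x) (Lc (x - d))).
- exact: L1Z.
move=> w _; rewrite -mulrBr normrM ger0_norm ?gauss_weight_ge0//.
rewrite powRr1// mulrCA ler_wpM2l ?gauss_weight_ge0//.
apply: le_trans (cos_lipschitz _ _) _.
rewrite -mulrBr opprB addrCA subrr addr0 !normrM (ger0_norm d0) (ger0_norm pi0) ger0_norm//.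
by rewrite le_eqVlt; apply/orP; left; apply/eqP; ring.
Qed.

Lemma smooth_deriv_le d x : 0 <= d ->
  `|smooth_deriv a s n c sig d x| <=
  a * (\sum_(j < n) `|c j| * (d * (2 * pi) * moment (sig j) 1) + moment s 0).
Proof.
move=> d0; rewrite normrM gtr0_norm// ler_wpM2l ?(ltW a0)//.
apply: le_trans (ler_normB _ _) _; apply: lerD.
  apply: le_trans (ler_norm_sum _ _ _) _; apply: ler_sum => j _.
  by rewrite normrM ler_wpM2l// pdf_diff_le.
rewrite ger0_norm ?normal_pdf_ge0// -gauss_weight_cos//.
apply: le_Rintegral => //.
- rewrite (_ : EFin \o _ = EFin \o (fun w => gauss_weight s w * cos ((2 * pi * x) * w))).
    exact: L1_cos (L1_gauss_weight s).
  by apply/funext => w /=; rewrite -mulrA [w * x]mulrC mulrA.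
- exact: L1_moment.
move=> w _; rewrite powRr0 ler_wpM2l ?gauss_weight_ge0// cos_le1.
Qed.

Lemma fourier_smooth_deriv_le d : 0 <= d ->
  (\int[mu]_w (Normc.normc (fourier (smooth_deriv a s n c sig d) w) * `|w| `^ (m - 1))%:E
     <= (class_budget d)%:E)%E.
Proof.
move=> d0; have pi0 := @pi_ge0 R.
pose N w := a * (\sum_(j < n) `|c j| * (d * (2 * pi) * (gauss_weight (sig j) w * `|w| `^ m)) +
  gauss_weight s w * `|w| `^ (m - 1)).
have LNj (j : 'I_n) : L1 (fun w => `|c j| * (d * (2 * pi) * (gauss_weight (sig j) w * `|w| `^ m))).
  by apply: L1Z; apply: L1Z; exact: L1_moment.
have LNs : L1 (fun w => \sum_(j < n)
    `|c j| * (d * (2 * pi) * (gauss_weight (sig j) w * `|w| `^ m))).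
  exact: L1_sum.
have Lms := L1_moment s0 m0.
have LN : L1 N by apply: L1Z; exact: L1D LNs Lms.
have -> : class_budget d = \int[mu]_w N w.
  rewrite /N (RintegralZl _ measurableT (L1D LNs Lms)) (RintegralD measurableT LNs Lms).
  rewrite (Rintegral_sum _ LNj); congr (_ * (_ + _)); apply: eq_bigr => j _.
  rewrite (RintegralZl _ measurableT (L1Z _ (L1_moment (sig0 j) m0'))).
  by rewrite (RintegralZl _ measurableT (L1_moment (sig0 j) m0')).
rewrite -(eRintegral LN); apply: ge0_le_integral => //.
- by move=> w _; rewrite lee_fin mulr_ge0 ?normc_fourier_ge0 ?powR_ge0.
- apply/measurable_EFinP; apply: measurable_funM; last first.
    by apply: (@measurableT_comp _ _ _ _ _ _ (@powR R ^~ (m - 1))) => //; exact: measurable_powR.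
  have Lq := L1_smooth_deriv a s n c sig d.
  rewrite (_ : (fun w => _) = fun w => Num.sqrt (fcos (smooth_deriv a s n c sig d) (2 * pi * w) ^+ 2
    + fsin (smooth_deriv a s n c sig d) (2 * pi * w) ^+ 2))//.
  apply: (@measurableT_comp _ _ _ _ _ _ (@Num.sqrt R)).
    by apply: continuous_measurable_fun; exact: sqrt_continuous.
  by apply: measurable_funD; apply: measurable_funX; [exact: measurable_fcos|exact: measurable_fsin].
- exact: measurable_int LN.
move=> w _; rewrite lee_fin.
have LS : L1 (fun x => \sum_(j < n) c j * pdf_diff (sig j) d x).
  by apply: L1_sum => j; apply: L1Z; exact: L1_pdf_diff.
rewrite normc_fourierZ; last exact: L1B LS (L1_normal_pdf s).
rewrite gtr0_norm// /N -mulrA ler_wpM2l ?(ltW a0)//.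
have -> : (\sum_(j < n) `|c j| * (d * (2 * pi) * (gauss_weight (sig j) w * `|w| `^ m)) +
  gauss_weight s w * `|w| `^ (m - 1)) =
  (\sum_(j < n) `|c j| * (d * (2 * pi) * (`|w| * gauss_weight (sig j) w)) + gauss_weight s w) *
  `|w| `^ (m - 1).
  rewrite [RHS]mulrDl mulr_suml; congr (_ + _); apply: eq_bigr => j _.
  rewrite -mul_norm_powR; ring.
apply: ler_wpM2r; first exact: powR_ge0.
have -> : (fun x => \sum_(j < n) c j * pdf_diff (sig j) d x - p s x) =
    fun x => \sum_(j < n) c j * pdf_diff (sig j) d x + (-1) * p s x.
  by apply/funext => x; rewrite mulN1r.
apply: le_trans (normc_fourierD _ LS (L1Z _ (L1_normal_pdf s))) _; apply: lerD.
  have Lj j : L1 (fun x => c j * pdf_diff (sig j) d x) by apply: L1Z; exact: L1_pdf_diff.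
  apply: le_trans (normc_fourier_sum n w Lj) _.
  apply: ler_sum => j _; rewrite normc_fourierZ; last exact: L1_pdf_diff.
  by rewrite ler_wpM2l// normc_fourier_pdf_diff.
rewrite normc_fourierZ; last exact: L1_normal_pdf.
by rewrite normrN normr1 mul1r normc_fourier_normal_pdf.
Qed.

Lemma class_F_hypothesis_fun d : 0 <= d <= 1 -> class_budget d <= L ->
  class_F m a L (hypothesis_fun a s n c sig d).
Proof.
move=> /andP[d0 d1] bL; rewrite hypothesis_funE//.
set B := Num.max (a * (1 + (\sum_(j < n) `|c j| + 1)))
  (a * (\sum_(j < n) `|c j| * (d * (2 * pi) * moment (sig j) 1) + moment s 0)).
apply: (@class_F_step_plus R a d _ (smooth_deriv a s n c sig d)) (B) _ _ _ _ _ _ _ _ => //.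
- by move=> x; exact: is_derive_smooth_part.
- exact: continuous_smooth_deriv.
- by rewrite d0.
- by rewrite -(@hypothesis_funE _ a s n c sig)//; exact: L1_hypothesis_fun.
- move=> x; rewrite -(@hypothesis_funE _ a s n c sig)// le_max.
  by rewrite hypothesis_fun_le.
- exact: L1_smooth_deriv.
- by move=> x; rewrite le_max smooth_deriv_le// orbT.
- move=> me x; apply: le_trans (smooth_deriv_le x d0) _.
  by move: bL; rewrite /class_budget me subrr.
- by apply: le_trans (fourier_smooth_deriv_le d0) _; rewrite lee_fin.
Qed.

Lemma class_budget0 d : 0 <= d -> class_budget 0 <= class_budget d.
Proof.
move=> d0; rewrite /class_budget ler_wpM2l ?(ltW a0)// lerD2r.
apply: ler_sum => j _; rewrite !mul0r mulr0.
have M0 : 0 <= moment (sig j) m.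
  by apply: Rintegral_ge0 => w _; rewrite mulr_ge0 ?gauss_weight_ge0 ?powR_ge0.
by rewrite mulr_ge0// mulr_ge0// mulr_ge0// mulr_ge0// pi_ge0.
Qed.

Lemma two_hypotheses_minimax (K : R -> R) (eps d : R) : L1 K -> 0 < eps -> 0 <= d <= 1 ->
  class_budget d <= L ->
  (\int[mu]_w (Normc.normc (fourier K w) ^+ 2 * (a ^+ 2 * (1 - mixture_hat n c sig w) ^+ 2 *
     Normc.normc (fourier (box d) w) ^+ 2))%:E <= (eps ^+ 2)%:E)%E ->
  minimax_risk_ge K eps (class_F m a L) (d / 8).
Proof.
move=> K1 e0 /andP[d0 d1] bL he.
pose f t := hypothesis_fun a s n c sig t.
have L1f t : L1 (f t) by exact: L1_hypothesis_fun.
have fB t x : `|f t x| <= a * (1 + (\sum_(j < n) `|c j| + 1)) by exact: hypothesis_fun_le.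
have cp t : 0 <= t -> change_point (f t) t.
  move=> t0; rewrite /f hypothesis_funE//.
  apply: change_point_step_plus => // x.
  exact: is_derive_smooth_part.
pose h x := a * mixture_error n c sig d x.
have h1 : L1 h by apply: L1Z; exact: L1_mixture_error.
have hB x : `|h x| <= a * (\sum_(j < n) `|c j| + 1).
  by rewrite normrM gtr0_norm// ler_wpM2l ?(ltW a0)// mixture_error_le.
have u1 := L1_convolution K1 h1 hB.
have uB := convolution_le K1 h1 hB.
have key : (\int[mu]_x (convolution K h x ^+ 2)%:E <= (eps ^+ 2)%:E)%E.
  apply: le_trans (convolution_L2_le K1 h1 hB (s := [:: 0; d]) _) _.
    move=> z zs; apply: cvgM; first exact: cvg_cst.
    exact: mixture_error_continuous.
  apply: le_trans he; rewrite le_eqVlt; apply/orP; left; apply/eqP.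
  apply: eq_integral => w _; congr ((_ * _)%:E).
  rewrite normc_fourierZ; last exact: L1_mixture_error.
  by rewrite exprMn real_normK ?num_real// normc_fourier_mixture_error// mulrA.
have mc t := L1_measurable (L1_convolution K1 (L1f t) (fB t)).
have cB t := convolution_le K1 (L1f t) (fB t).
have hE : convolution K (f d) \- convolution K (f 0) = convolution K h.
  by apply/funext => x; exact: convolution_hypothesis_fun.
have -> : d / 8 = (d - 0) / 8 by rewrite subr0.
apply: (@two_point_minimax_risk R K eps _ (f 0) (f d) 0 d) => //.
- apply: class_F_hypothesis_fun; first by rewrite lexx ler01.
  exact: le_trans (class_budget0 d0) bL.
- by apply: class_F_hypothesis_fun => //; rewrite d0.
- exact: cp.
- exact: cp.
move=> H k t tS.
apply: le_trans (increments_energy_le u1 uB key tS).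
apply: ler_sum => i _; rewrite le_eqVlt; apply/orP; left; apply/eqP; congr (_ ^+ 2 / _).
by rewrite -hE -(primitive0_sub (mc d) (cB d) (mc 0) (cB 0) (tS i (ltn_ord i))).
Qed.

End reduction.

(** * Power integrals *)

Section power_integrals.
Variable R : realType.
Notation mu := (@lebesgue_measure R).
Implicit Types (r b x w : R).

Lemma is_derive_shift_powR r (x : R) : -1 < x ->
  is_derive x 1 (fun y => (1 + y) `^ r) (r * (1 + x) `^ (r - 1)).
Proof.
move=> x1.
have h1 : is_derive x 1 (fun y : R => 1 + y) 1.
  have h := is_deriveD (is_derive_cst (1 : R) x (1 : R)) (is_derive_id x (1 : R)).
  by apply: (is_derive_eq h); rewrite add0r.
have p : 0 < 1 + x by lra.
have h2 : is_derive x 1 ((@powR R ^~ r) \o (fun y => 1 + y)) (r * (1 + x) `^ (r - 1) * 1).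
  by apply: is_derive1_comp; exact: is_derive1_powR.
by apply: (is_derive_eq h2); rewrite mulr1.
Qed.

Lemma powRN_cvg0 r : 0 < r -> (fun w : R => w `^ (- r)) @ +oo --> (0 : R).
Proof.
move=> r0; rewrite (_ : (fun w : R => w `^ (- r)) = (fun w => (w `^ r)^-1)); last first.
  by apply/funext => w; rewrite powRN.
apply/(gtr0_cvgV0 (f := fun w : R => w `^ r)).
  by near=> w; apply: powR_gt0; near: w; exact: nbhs_pinfty_gt.
apply/cvgryPge => A; near=> w.
have A1 : 0 <= `|A| + 1 by rewrite addr_ge0.
have Aw : (`|A| + 1) `^ r^-1 <= w by near: w; exact: nbhs_pinfty_ge.
have w0 : 0 <= w by rewrite (le_trans (powR_ge0 _ _) Aw).
apply: (@le_trans _ _ (`|A| + 1)); first by rewrite (le_trans (ler_norm A))// lerDl.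
rewrite -[leLHS]powRr1// -(@mulVf _ r) ?gt_eqF// powRrM.
by rewrite ge0_ler_powR ?nnegrE ?powR_ge0// ltW.
Unshelve. all: by end_near. Qed.

Lemma powR_tail_integral r b : 0 < b -> 1 < r ->
  (\int[mu]_(w in `[b, +oo[) (w `^ (- r))%:E = (b `^ (1 - r) / (r - 1))%:E)%E.
Proof.
move=> b0 r1; have r10 : 1 - r != 0 by rewrite lt_eqF// subr_lt0.
have dF (w : R) : 0 < w ->
    is_derive w 1 (fun w => (1 - r)^-1 * w `^ (1 - r)) (w `^ (- r)).
  move=> w0; have h := is_deriveZ (1 - r)^-1 (is_derive1_powR (1 - r) w0).
  apply: (is_derive_eq h); rewrite /GRing.scale /= mulrA mulVf// mul1r.
  by congr (_ `^ _); ring.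
have cw (w : R) : 0 < w -> {for w, continuous (fun w => w `^ (- r))}.
  by move=> w0; apply: is_derive_continuous; exact: is_derive1_powR.
rewrite (@ge0_continuous_FTC2y R _ (fun w => (1 - r)^-1 * w `^ (1 - r)) b 0).
- rewrite -EFinB sub0r; congr (_%:E); rewrite -mulNr -invrN opprB mulrC //.
- by move=> x _; exact: powR_ge0.
- apply: continuous_in_subspaceT => x; rewrite inE /= in_itv /= andbT => bx.
  by apply: cw; exact: lt_le_trans bx.
- rewrite -[X in _ --> X](mulr0 (1 - r)^-1); apply: cvgM; first exact: cvg_cst.
  by rewrite -opprB; apply: powRN_cvg0; rewrite subr_gt0.
- by move=> x bx; case: (dF x (lt_trans b0 bx)).
- by apply: cvg_at_right_filter; exact: is_derive_continuous (dF b b0).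
- move=> x; rewrite in_itv /= andbT => bx.
  by rewrite derive1E; case: (dF x (lt_trans b0 bx)).
Qed.

Let shift_integral (F f : R -> R) b : 0 < b ->
  (forall x : R, -1 < x -> is_derive x 1 F (f x)) ->
  (forall x : R, -1 < x -> {for x, continuous f}) ->
  (\int[mu]_(w in `[0%R, b]) (f w)%:E = (F b - F 0)%:E)%E.
Proof.
move=> b0 dF cf; have n1 (x : R) : 0 <= x -> -1 < x by lra.
have cF x (x0 : 0 <= x) := is_derive_continuous (dF x (n1 x x0)).
rewrite (@continuous_FTC2 R f F 0 b b0) ?EFinB//.
- apply: continuous_in_subspaceT => x; rewrite inE /= in_itv /= => /andP[x0 _].
  by apply: cf; exact: n1.
- split.
  + by move=> x; rewrite in_itv /= => /andP[x0 _]; case: (dF x (n1 x (ltW x0))).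
  + by apply: cvg_at_right_filter; exact: cF.
  + by apply: cvg_at_left_filter; apply: cF; exact: ltW.
- by move=> x; rewrite in_itv /= => /andP[x0 _]; rewrite derive1E; case: (dF x (n1 x (ltW x0))).
Qed.

Lemma powR_shift_integral r b : 0 < b -> r < 1 ->
  (\int[mu]_(w in `[0%R, b]) ((1 + w) `^ (- r))%:E = (((1 + b) `^ (1 - r) - 1) / (1 - r))%:E)%E.
Proof.
move=> b0 r1; have r10 : 1 - r != 0 by rewrite gt_eqF// subr_gt0.
have dF (w : R) : -1 < w ->
    is_derive w 1 (fun w => (1 - r)^-1 * (1 + w) `^ (1 - r)) ((1 + w) `^ (- r)).
  move=> w1; have h := is_deriveZ (1 - r)^-1 (is_derive_shift_powR (1 - r) w1).
  apply: (is_derive_eq h); rewrite /GRing.scale /= mulrA mulVf// mul1r.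
  by congr (_ `^ _); ring.
have cf (w : R) : -1 < w -> {for w, continuous (fun w => (1 + w) `^ (- r))}.
  by move=> w1; apply: is_derive_continuous; exact: is_derive_shift_powR.
by rewrite (shift_integral b0 dF cf) addr0 powR1 -mulrBr mulrC.
Qed.

Lemma inv_shift_integral b : 0 < b ->
  (\int[mu]_(w in `[0%R, b]) ((1 + w) `^ (- 1))%:E = (ln (1 + b))%:E)%E.
Proof.
move=> b0; have dF (w : R) : -1 < w -> is_derive w 1 (fun w => ln (1 + w)) ((1 + w) `^ (- 1)).
  move=> w1; have w0 : 0 < 1 + w by lra.
  have h1 : is_derive w 1 (fun y : R => 1 + y) 1.
    have h := is_deriveD (is_derive_cst (1 : R) w (1 : R)) (is_derive_id w (1 : R)).
    by apply: (is_derive_eq h); rewrite add0r.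
  have h2 : is_derive w 1 (@ln R \o (fun y => 1 + y)) ((1 + w)^-1 * 1).
    by apply: is_derive1_comp; exact: is_derive1_ln.
  by apply: (is_derive_eq h2); rewrite mulr1 powR_inv1// ltW.
have cf (w : R) : -1 < w -> {for w, continuous (fun w => (1 + w) `^ (- 1))}.
  by move=> w1; apply: is_derive_continuous; exact: is_derive_shift_powR.
by rewrite (shift_integral b0 dF cf) addr0 ln1 subr0.
Qed.

(** The two bounding functions, cut off at b, are summed with their reflections. *)
Lemma integral_abs_split_le (E phi1 phi2 : R -> R) b (B1 B2 : R) : 0 <= b ->
  measurable_fun setT E -> (forall w, 0 <= E w) ->
  measurable_fun setT phi1 -> measurable_fun setT phi2 ->
  (forall w, 0 <= phi1 w) -> (forall w, 0 <= phi2 w) ->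
  (forall w, `|w| <= b -> E w <= phi1 `|w|) -> (forall w, b < `|w| -> E w <= phi2 `|w|) ->
  (\int[mu]_(w in `[0%R, b]) (phi1 w)%:E <= B1%:E)%E ->
  (\int[mu]_(w in `[b, +oo[) (phi2 w)%:E <= B2%:E)%E ->
  (\int[mu]_w (E w)%:E <= (2 * (B1 + B2))%:E)%E.
Proof.
move=> b0 mE E0 m1 m2 p1 p2 h1 h2 i1 i2.
pose A := phi1 \_ `[0%R, b]; pose B := phi2 \_ `[b, +oo[; pose G w := A w + B w.
have A0 w : 0 <= A w by rewrite /A patchE; case: ifP.
have B0 w : 0 <= B w by rewrite /B patchE; case: ifP.
have G0 w : 0 <= G w by rewrite addr_ge0.
have mA : measurable_fun setT A.
  by apply/(measurable_restrictT _ _).1 => //; exact: measurable_funTS.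
have mB : measurable_fun setT B.
  by apply/(measurable_restrictT _ _).1 => //; exact: measurable_funTS.
have mG : measurable_fun setT G by exact: measurable_funD.
have mG' : measurable_fun setT (fun w : R => G (- w)).
  by apply: (@measurableT_comp _ _ _ _ _ _ G) => //; exact: oppr_measurable.
have GG w : E w <= G w + G (- w).
  wlog w0 : w E mE E0 h1 h2 / 0 <= w.
    move=> H; have [|/ltW w0] := leP 0 w; first exact: (H w E).
    have := H (- w) (fun w => E (- w)); rewrite !opprK [G (- w) + _]addrC; apply => //.
    - by apply: (@measurableT_comp _ _ _ _ _ _ E) => //; exact: oppr_measurable.
    - by move=> v; rewrite -normrN; exact: h1.
    - by move=> v; rewrite -normrN; exact: h2.
    - by rewrite oppr_ge0.
  apply: (@le_trans _ _ (G w)); last by rewrite lerDl.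
  have aw : `|w| = w by rewrite ger0_norm.
  have [wb|bw] := leP w b.
    have := h1 w; rewrite aw => /(_ wb) /le_trans; apply.
    rewrite /G {1}/A patchE mem_set; last by rewrite /= in_itv /= w0.
    by rewrite lerDl.
  have := h2 w; rewrite aw => /(_ bw) /le_trans; apply.
  rewrite /G /B patchE mem_set; last by rewrite /= in_itv /= ltW.
  by rewrite lerDr.
apply: (@le_trans _ _ (\int[mu]_w ((G w)%:E + (G (- w))%:E))%E).
  apply: ge0_le_integral => //.
  - by move=> w _; rewrite lee_fin.
  - exact/measurable_EFinP.
  - by apply: emeasurable_funD; exact/measurable_EFinP.
  by move=> w _; rewrite -EFinD lee_fin.
rewrite ge0_integralD//; last 4 first.
- by move=> w _; rewrite lee_fin.
- exact/measurable_EFinP.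
- by move=> w _; rewrite lee_fin.
- exact/measurable_EFinP.
rewrite -(@ge0_integral_opp _ (fun w => (G w)%:E)); last 2 first.
- exact/measurable_EFinP.
- by move=> w; rewrite lee_fin.
have -> : (\int[mu]_w (G w)%:E = \int[mu]_(w in `[0%R, b]) (phi1 w)%:E +
    \int[mu]_(w in `[b, +oo[) (phi2 w)%:E)%E.
  rewrite [X in (_ = X + _)%E]integral_mkcond [X in (_ = _ + X)%E]integral_mkcond -ge0_integralD//.
  - apply: eq_integral => w _; rewrite /G EFinD /A /B !patchE.
    by case: ifP; case: ifP.
  - by move=> w _; rewrite patchE; case: ifP => // _; rewrite lee_fin.
  - by apply/(measurable_restrictT _ _).1 => //; apply/measurable_EFinP; exact: measurable_funTS.
  - by move=> w _; rewrite patchE; case: ifP => // _; rewrite lee_fin.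
  - by apply/(measurable_restrictT _ _).1 => //; apply/measurable_EFinP; exact: measurable_funTS.
rewrite (_ : 2 * (B1 + B2) = (B1 + B2) + (B1 + B2)); last by ring.
by rewrite EFinD; apply: leeD; rewrite EFinD; apply: leeD.
Qed.

End power_integrals.

(** * Energy between the hypotheses *)

Section energy.
Variables (R : realType) (K : R -> R) (beta kappa a : R).
Hypotheses (K1 : L1 K) (beta0 : 0 < beta).
Hypothesis K_decay : forall w : R,
  Normc.normc (fourier K w) <= kappa * (1 + `|w| ^+ 2) `^ (- (beta / 2)).
Notation mu := (@lebesgue_measure R).
Implicit Types (d w x y r : R).

Lemma powR_gt0D x r1 r2 : 0 < x -> x `^ (r1 + r2) = x `^ r1 * x `^ r2.
Proof. by move=> x0; rewrite powRD// (gt_eqF x0) implybT. Qed.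

Lemma powRN_anti x y r : 0 < x -> x <= y -> 0 <= r -> y `^ (- r) <= x `^ (- r).
Proof.
move=> x0 xy r0; have y0 := lt_le_trans x0 xy.
by rewrite !powRN lef_pV2 ?posrE ?powR_gt0// ge0_ler_powR ?nnegrE// ltW.
Qed.

Lemma powR_sqr x r : 0 <= x -> (x `^ r) ^+ 2 = x `^ (2 * r).
Proof. by move=> x0; rewrite -powR_mulrn ?powR_ge0// -powRrM mulrC. Qed.

Lemma powR_sqrl x r : 0 <= x -> (x ^+ 2) `^ r = x `^ (2 * r).
Proof. by move=> x0; rewrite -powR_mulrn// -powRrM. Qed.

Lemma measurable_normc_fourier_sqr (f : R -> R) : L1 f ->
  measurable_fun setT (fun w => Normc.normc (fourier f w) ^+ 2).
Proof.
move=> f1; rewrite (_ : (fun w => _) = fun w => fcos f (2 * pi * w) ^+ 2 + fsin f (2 * pi * w) ^+ 2).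
  by apply: measurable_funD; apply: measurable_funX; [exact: measurable_fcos|exact: measurable_fsin].
by apply/funext => w; rewrite normc_fourier_sqr.
Qed.

Let fourier_sqr_le w :
  Normc.normc (fourier K w) ^+ 2 <= kappa ^+ 2 * (1 + `|w| ^+ 2) `^ (- beta).
Proof.
have p0 : 0 <= 1 + `|w| ^+ 2 by rewrite addr_ge0 ?sqr_ge0.
have -> : - beta = 2 * - (beta / 2) by field.
rewrite -powR_sqr// -exprMn lerXn2r// nnegrE; first exact: normc_fourier_ge0.
exact: le_trans (normc_fourier_ge0 K w) (K_decay w).
Qed.

Lemma fourier_sqr_tail w : w != 0 ->
  Normc.normc (fourier K w) ^+ 2 <= kappa ^+ 2 * `|w| `^ (- (2 * beta)).
Proof.
move=> w0; apply: le_trans (fourier_sqr_le w) _; rewrite ler_wpM2l ?sqr_ge0//.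
have -> : - (2 * beta) = 2 * - beta by ring.
rewrite -powR_sqrl//; apply: powRN_anti; last exact: ltW.
  by rewrite exprn_gt0// normr_gt0.
by rewrite lerDr.
Qed.

(** From (1 + |w|)^2 <= 2 (1 + w^2); the powers of 1 + |w| have explicit primitives. *)
Lemma fourier_sqr_core w :
  Normc.normc (fourier K w) ^+ 2 <= kappa ^+ 2 * 2 `^ beta * (1 + `|w|) `^ (- (2 * beta)).
Proof.
apply: le_trans (fourier_sqr_le w) _; rewrite -mulrA ler_wpM2l ?sqr_ge0//.
have u0 : 0 <= 1 + `|w| by rewrite addr_ge0.
have -> : - (2 * beta) = 2 * - beta by ring.
have -> : 2 `^ beta = 2^-1 `^ (- beta) :> R.
  by rewrite -(@powR_inv1 _ 2)// -powRrM mulrNN mul1r.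
rewrite -powR_sqrl// -powRM ?invr_ge0 ?sqr_ge0//; apply: powRN_anti; last exact: ltW.
  by rewrite mulr_gt0 ?invr_gt0// exprn_gt0// ltr_pwDl.
have := normr_ge0 w; move: `|w| => v v0; have := sqr_ge0 (1 - v); nra.
Qed.

Section integrand.
Variables (n : nat) (c sig : nat -> R) (d : R).

Let E w := Normc.normc (fourier K w) ^+ 2 *
  (a ^+ 2 * (1 - mixture_hat n c sig w) ^+ 2 * Normc.normc (fourier (box d) w) ^+ 2).

Lemma measurable_energy : measurable_fun setT E.
Proof.
apply: measurable_funM; first exact: measurable_normc_fourier_sqr.
apply: measurable_funM; last exact: measurable_normc_fourier_sqr (L1_box d).
apply: measurable_funM => //; apply: measurable_funX; apply: measurable_funB => //.
apply: measurable_sum => j; apply: measurable_funM => //.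
exact: L1_measurable (L1_gauss_weight (sig j)).
Qed.

Lemma energy_ge0 w : 0 <= E w.
Proof. by rewrite mulr_ge0 ?sqr_ge0// mulr_ge0 ?sqr_ge0// mulr_ge0 ?sqr_ge0. Qed.

End integrand.

(** With the bounds d and 1 / |w| for the transform of the box, below and above 1 / d. The
  integral over the low frequencies is left as [I], since its size depends on the position of
  beta with respect to 1/2. *)
Lemma singular_energy_le d I : 0 < d ->
  (\int[mu]_(w in `[0%R, (d^-1)%R]) ((1 + w) `^ (- (2 * beta)))%:E <= I%:E)%E ->
  (\int[mu]_w (Normc.normc (fourier K w) ^+ 2 * (a ^+ 2 *
     (1 - mixture_hat 0 (fun=> 0) (fun=> 1) w) ^+ 2 *
     Normc.normc (fourier (box d) w) ^+ 2))%:E <=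
   (2 * kappa ^+ 2 * a ^+ 2 * (2 `^ beta * d ^+ 2 * I + d `^ (2 * beta + 1) / (2 * beta + 1)))%:E)%E.
Proof.
move=> d0 hI; have b0 : 0 < d^-1 by rewrite invr_gt0.
pose C := kappa ^+ 2 * a ^+ 2.
have C0 : 0 <= C by rewrite mulr_ge0 ?sqr_ge0.
have p1 w : 0 <= C * (2 `^ beta * d ^+ 2 * (1 + w) `^ (- (2 * beta))).
  by rewrite mulr_ge0// mulr_ge0 ?powR_ge0// mulr_ge0 ?sqr_ge0 ?powR_ge0.
have p2 w : 0 <= C * w `^ (- (2 * beta + 2)) by rewrite mulr_ge0// powR_ge0.
have m1 (r : R) : measurable_fun setT (fun w : R => (1 + w) `^ r).
  apply: (@measurableT_comp _ _ _ _ _ _ (@powR R ^~ r)); first exact: measurable_powR.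
  exact: measurable_funD.
have -> : 2 * kappa ^+ 2 * a ^+ 2 * (2 `^ beta * d ^+ 2 * I + d `^ (2 * beta + 1) / (2 * beta + 1))
  = 2 * (C * (2 `^ beta * d ^+ 2 * I) + C * (d `^ (2 * beta + 1) / (2 * beta + 1))).
  by rewrite /C; ring.
have hat0 w : mixture_hat 0 (fun=> 0) (fun=> 1) w = 0 :> R by rewrite /mixture_hat big_ord0.
apply: (integral_abs_split_le (ltW b0) (measurable_energy 0 (fun=> 0) (fun=> 1) d)
  (energy_ge0 0 (fun=> 0) (fun=> 1) d)
  (phi1 := fun w => C * (2 `^ beta * d ^+ 2 * (1 + w) `^ (- (2 * beta))))
  (phi2 := fun w => C * w `^ (- (2 * beta + 2)))) => //.
- by apply: measurable_funM => //; apply: measurable_funM.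
- by apply: measurable_funM => //; exact: measurable_powR.
- move=> w wb; rewrite hat0 subr0 expr1n mulr1.
  have := fourier_sqr_core w; have := normc_fourier_box_le (ltW d0) w.
  have := sqr_ge0 (Normc.normc (fourier K w)); move: (Normc.normc (fourier K w) ^+ 2) => X.
  have := sqr_ge0 (Normc.normc (fourier (box d) w)).
  move: (Normc.normc (fourier (box d) w) ^+ 2) => Y Y0 X0 Yd XK.
  have -> : C * (2 `^ beta * d ^+ 2 * (1 + `|w|) `^ (- (2 * beta))) =
      (kappa ^+ 2 * 2 `^ beta * (1 + `|w|) `^ (- (2 * beta))) * (a ^+ 2 * d ^+ 2).
    by rewrite /C; ring.
  by apply: ler_pM => //; [rewrite mulr_ge0 ?sqr_ge0|rewrite ler_wpM2l ?sqr_ge0].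
- move=> w wb; rewrite hat0 subr0 expr1n mulr1.
  have w0 : w != 0 by rewrite -normr_gt0 (lt_trans b0).
  have wp : 0 < `|w| by rewrite normr_gt0.
  have := fourier_sqr_tail w0; have := normc_fourier_box_tail (ltW d0) w0.
  have := sqr_ge0 (Normc.normc (fourier K w)); move: (Normc.normc (fourier K w) ^+ 2) => X.
  have := sqr_ge0 (Normc.normc (fourier (box d) w)).
  move: (Normc.normc (fourier (box d) w) ^+ 2) => Y Y0 X0 Yd XK.
  have -> : C * `|w| `^ (- (2 * beta + 2)) =
      (kappa ^+ 2 * `|w| `^ (- (2 * beta))) * (a ^+ 2 * w ^- 2).
    rewrite opprD powR_gt0D// [`|w| `^ (- 2)]powRN powR_mulrn// real_normK ?num_real// /C.
    by ring.
  by apply: ler_pM => //; [rewrite mulr_ge0 ?sqr_ge0|rewrite ler_wpM2l ?sqr_ge0].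
- rewrite (_ : (\int[mu]_(w in _) _)%E = (\int[mu]_(w in `[0%R, (d^-1)%R])
      ((C * (2 `^ beta * d ^+ 2))%:E * ((1 + w) `^ (- (2 * beta)))%:E))%E); last first.
    by apply: eq_integral => w _; rewrite -EFinM mulrA.
  have Cd : 0 <= C * (2 `^ beta * d ^+ 2) by rewrite mulr_ge0// mulr_ge0 ?powR_ge0 ?sqr_ge0.
  rewrite ge0_integralZl//.
  + have -> : C * (2 `^ beta * d ^+ 2 * I) = C * (2 `^ beta * d ^+ 2) * I by ring.
    by rewrite [leRHS]EFinM lee_wpmul2l// lee_fin.
  + by apply/measurable_EFinP; apply: measurable_funTS; exact: m1.
  + by move=> w _; rewrite lee_fin powR_ge0.
- rewrite (_ : (\int[mu]_(w in _) _)%E = (\int[mu]_(w in `[(d^-1)%R, +oo[)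
      (C%:E * (w `^ (- (2 * beta + 2)))%:E))%E); last first.
    by apply: eq_integral => w _; rewrite -EFinM.
  rewrite ge0_integralZl//.
  + rewrite powR_tail_integral//; last by rewrite ltr_wpDl ?mulr_ge0 ?(ltW beta0)// ltr1n.
    rewrite -EFinM lee_fin ler_wpM2l// le_eqVlt; apply/orP; left; apply/eqP.
    congr (_ / _); last by ring.
    rewrite -(@powR_inv1 _ d) ?(ltW d0)// -powRrM; congr (_ `^ _); ring.
  + by apply/measurable_EFinP; apply: measurable_funTS; exact: measurable_powR.
  + by move=> w _; rewrite lee_fin powR_ge0.
Qed.

(** The square of 1 - Ghat is at most 1 and at most a constant times (t w)^(2 beta), because
  2k >= beta; the second bound cancels the decay of the transform of K below 1 / t. *)
Lemma regular_energy_le n (c sig : nat -> R) d t k : 0 < d -> 0 < t -> 1 < 2 * beta ->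
  beta <= (2 * k)%:R ->
  (forall w, 1 - mixture_hat n c sig w = (1 - expR (- (2 * pi ^+ 2 * t ^+ 2) * w ^+ 2)) ^+ k) ->
  (\int[mu]_w (Normc.normc (fourier K w) ^+ 2 * (a ^+ 2 *
     (1 - mixture_hat n c sig w) ^+ 2 * Normc.normc (fourier (box d) w) ^+ 2))%:E <=
   (2 * kappa ^+ 2 * ((2 * pi ^+ 2) `^ beta + (2 * beta - 1)^-1) * (a * d) ^+ 2 *
      t `^ (2 * beta - 1))%:E)%E.
Proof.
move=> d0 t0 b1 bk hatE; have b0 : 0 < t^-1 by rewrite invr_gt0.
pose C := kappa ^+ 2 * (a * d) ^+ 2; pose P := (2 * pi ^+ 2) `^ beta : R.
have C0 : 0 <= C by rewrite mulr_ge0 ?sqr_ge0.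
have P0 : 0 <= P by exact: powR_ge0.
have pp : 0 <= 2 * pi ^+ 2 :> R by rewrite mulr_ge0 ?sqr_ge0.
have -> : 2 * kappa ^+ 2 * (P + (2 * beta - 1)^-1) * (a * d) ^+ 2 * t `^ (2 * beta - 1) =
  2 * (C * (P * t `^ (2 * beta - 1)) + C * (t `^ (2 * beta - 1) / (2 * beta - 1))).
  by rewrite /C; ring.
have D01 w : 0 <= 1 - expR (- (2 * pi ^+ 2 * t ^+ 2) * w ^+ 2) <= 1.
  have := expR_gt0 (- (2 * pi ^+ 2 * t ^+ 2) * w ^+ 2).
  have : expR (- (2 * pi ^+ 2 * t ^+ 2) * w ^+ 2) <= 1.
    rewrite -[leRHS]expR0 ler_expR mulNr oppr_le0.
    by rewrite mulr_ge0 ?sqr_ge0// mulr_ge0 ?sqr_ge0.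
  by move: (expR _) => x x1 x0; apply/andP; split; lra.
have box_le w := normc_fourier_box_le (ltW d0) w.
have aD0 w : 0 <= a ^+ 2 * (1 - mixture_hat n c sig w) ^+ 2.
  by apply: mulr_ge0; exact: sqr_ge0.
have D1 w : (1 - mixture_hat n c sig w) ^+ 2 <= 1.
  have /andP[D0 D1] := D01 w.
  by rewrite hatE -exprM exprn_ile1.
have D2 w : (1 - mixture_hat n c sig w) ^+ 2 <= P * (t * `|w|) `^ (2 * beta).
  rewrite hatE -exprM mulnC; have /andP[D0 D1'] := D01 w.
  apply: (@le_trans _ _ ((1 - expR (- (2 * pi ^+ 2 * t ^+ 2) * w ^+ 2)) `^ beta)).
    move: (1 - _) D0 D1' => x x0 x1; rewrite -powR_mulrn//.
    move: x0; rewrite le_eqVlt => /orP[/eqP <-|x0].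
      by rewrite powR0 ?powR_ge0// gt_eqF// (lt_le_trans beta0).
    have -> : (2 * k)%:R = beta + ((2 * k)%:R - beta) by ring.
    rewrite powR_gt0D// ler_piMr ?powR_ge0//.
    have := @ge0_ler_powR _ ((2 * k)%:R - beta) _ x 1; rewrite powR1.
    by apply; rewrite ?nnegrE ?subr_ge0 ?(ltW x0).
  have -> : P * (t * `|w|) `^ (2 * beta) = (2 * pi ^+ 2 * (t * `|w|) ^+ 2) `^ beta.
    by rewrite [RHS]powRM ?sqr_ge0// powR_sqrl// mulr_ge0// ltW.
  apply: ge0_ler_powR; rewrite ?nnegrE ?(ltW beta0)//; first by rewrite mulr_ge0 ?sqr_ge0.
  rewrite exprMn real_normK ?num_real//.
  have := expR_ge1Dx (- (2 * pi ^+ 2 * t ^+ 2) * w ^+ 2); move: (expR _) => x.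
  by move=> h; rewrite lerBlDr; lra.
apply: (integral_abs_split_le (ltW b0) (measurable_energy n c sig d) (energy_ge0 n c sig d)
  (phi1 := fun w => C * (P * t `^ (2 * beta)))
  (phi2 := fun w => C * w `^ (- (2 * beta)))) => //.
- by apply: measurable_funM => //; exact: measurable_powR.
- by move=> w; rewrite mulr_ge0// mulr_ge0 ?powR_ge0.
- by move=> w; rewrite mulr_ge0 ?powR_ge0.
- move=> w wb; have [->|w0] := eqVneq w 0.
    rewrite hatE expr0n mulr0 expR0 subrr -exprM expr0n.
    have -> : ((k * 2)%N == 0) = false.
      apply/negbTE; rewrite -lt0n muln_gt0 andbT lt0n; apply: contraTneq bk => ->.
      by rewrite -ltNge.
    by rewrite mulr0 mul0r mulr0 mulr_ge0// mulr_ge0 ?powR_ge0.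
  have wp : 0 < `|w| by rewrite normr_gt0.
  have -> : C * (P * t `^ (2 * beta)) = (kappa ^+ 2 * `|w| `^ (- (2 * beta))) *
      (a ^+ 2 * (P * (t * `|w|) `^ (2 * beta)) * d ^+ 2).
    rewrite powRM ?(ltW t0)// powRN /C.
    have : `|w| `^ (2 * beta) != 0 by rewrite gt_eqF ?powR_gt0.
    by move: (`|w| `^ (2 * beta)) => z z0; field.
  apply: ler_pM (fourier_sqr_tail w0) _; rewrite ?sqr_ge0//.
    by rewrite mulr_ge0 ?sqr_ge0// mulr_ge0 ?sqr_ge0.
  apply: ler_pM (box_le w); [exact: aD0|exact: sqr_ge0|].
  by apply: ler_wpM2l; rewrite ?sqr_ge0.
- move=> w wb; have w0 : w != 0 by rewrite -normr_gt0 (lt_trans b0).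
  have -> : C * `|w| `^ (- (2 * beta)) = (kappa ^+ 2 * `|w| `^ (- (2 * beta))) *
      (a ^+ 2 * 1 * d ^+ 2) by rewrite /C; ring.
  apply: ler_pM (fourier_sqr_tail w0) _; rewrite ?sqr_ge0//.
    by rewrite mulr_ge0 ?sqr_ge0// mulr_ge0 ?sqr_ge0.
  apply: ler_pM (box_le w); [exact: aD0|exact: sqr_ge0|].
  by apply: ler_wpM2l; rewrite ?sqr_ge0.
- rewrite integral_cst//= lebesgue_measure_itv /= lte_fin b0 oppr0 adde0 -EFinM lee_fin.
  rewrite -mulrA ler_wpM2l// -mulrA ler_wpM2l// le_eqVlt; apply/orP; left; apply/eqP.
  by rewrite powR_gt0D// powR_inv1// ltW.
- rewrite (_ : (\int[mu]_(w in _) _)%E = (\int[mu]_(w in `[(t^-1)%R, +oo[)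
      (C%:E * (w `^ (- (2 * beta)))%:E))%E); last first.
    by apply: eq_integral => w _; rewrite -EFinM.
  rewrite ge0_integralZl//.
  + rewrite powR_tail_integral// -EFinM lee_fin ler_wpM2l// le_eqVlt; apply/orP; left; apply/eqP.
    congr (_ / _); rewrite -(@powR_inv1 _ t) ?(ltW t0)// -powRrM; congr (_ `^ _); ring.
  + by apply/measurable_EFinP; apply: measurable_funTS; exact: measurable_powR.
  + by move=> w _; rewrite lee_fin powR_ge0.
Qed.

End energy.

(** The coefficients of 1 - (1 - y)^k on powers of y: if y is the transform of the Gaussian density
  of scale t, then y^(j+1) is that of the density whose variance is j+1 times larger. *)
Section binomial_mixture.
Variables (R : realType) (k : nat) (t : R).
Hypothesis t0 : 0 < t.

Definition binomial_coef (j : nat) : R := (-1) ^+ j * 'C(k, j.+1)%:R.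
Definition binomial_scale (j : nat) : R := t * Num.sqrt j.+1%:R.

Lemma binomial_scale_ge j : t <= binomial_scale j.
Proof. by rewrite ler_peMr ?(ltW t0)// -[leLHS]sqrtr1 ler_sqrt// ler1n. Qed.

Lemma binomial_scale_gt0 j : 0 < binomial_scale j.
Proof. exact: lt_le_trans (binomial_scale_ge j). Qed.

Lemma binomial_mixture_hat w : 1 - mixture_hat k binomial_coef binomial_scale w =
  (1 - expR (- (2 * pi ^+ 2 * t ^+ 2) * w ^+ 2)) ^+ k.
Proof.
set y := expR _.
have gw (j : 'I_k) : gauss_weight (binomial_scale j) w = y ^+ j.+1.
  rewrite gauss_weightE ?binomial_scale_gt0// -expRM_natl; congr expR.
  rewrite /binomial_scale exprMn sqr_sqrtr ?ler0n//.
  by move: (j.+1%:R : R) => z; ring.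
rewrite exprBn big_ord_recl /= expr1n mulr1 expr0 bin0 mulr1n mul1r; congr (_ + _).
rewrite /mixture_hat -sumrN; apply: eq_bigr => j _.
rewrite gw /binomial_coef /bump /= add1n expr1n mulr1 -mulr_natr ![_ ^+ j.+1]exprS; ring.
Qed.

End binomial_mixture.

(** * Rates *)

Section rates.
Variable R : realType.
Implicit Types (a L m beta kappa eps d p C : R).
Notation mu := (@lebesgue_measure R).

Lemma near0_powR_le1 C p : 0 < C -> 0 < p -> \forall eps \near (0 : R)^'+, C * eps `^ p <= 1.
Proof.
move=> C0 p0; near=> eps.
have e0 : 0 < eps by [].
have eC : eps <= C^-1 `^ p^-1.
  by near: eps; apply: nbhs_right_le; rewrite powR_gt0// invr_gt0.
rewrite -ler_pdivlMl// mulr1; apply: (@le_trans _ _ ((C^-1 `^ p^-1) `^ p)).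
  by apply: ge0_ler_powR; rewrite ?nnegrE ?powR_ge0// ltW.
by rewrite -powRrM mulVf ?gt_eqF// powRr1// invr_ge0 ltW.
Unshelve. all: by end_near. Qed.

(** A smooth step of large width s costs as little smoothness as desired. *)
Lemma smooth_scale a L m : 0 < a -> 0 < L -> 1 <= m -> exists2 s, 0 < s &
  a * \int[mu]_w (gauss_weight s w * `|w| `^ (m - 1)) <= L.
Proof.
move=> a0 L0 m1; have m0 : 0 < m by exact: lt_le_trans m1.
have [C C0 hC] := @gauss_moment R (m - 1) ltac:(by rewrite subr_ge0).
pose s := (a * C / L) `^ m^-1.
have b0 : 0 < a * C / L by rewrite divr_gt0 ?mulr_gt0.
have s0 : 0 < s by rewrite powR_gt0.
exists s => //; have [_ h] := hC s s0.
apply: (@le_trans _ _ (a * (C * s `^ (- (m - 1 + 1))))); first by rewrite ler_wpM2l ?(ltW a0).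
rewrite subrK powRN -powRrM mulVf ?gt_eqF// powRr1 ?(ltW b0)//.
rewrite le_eqVlt; apply/orP; left; apply/eqP.
by field; rewrite !gt_eqF.
Qed.

Section kernel.
Variables (K : R -> R) (beta kappa m : R).
Hypotheses (K1 : L1 K) (beta0 : 0 < beta) (kappa0 : 0 < kappa) (m1 : 1 <= m).
Hypothesis K_decay : forall w : R,
  Normc.normc (fourier K w) <= kappa * (1 + `|w| ^+ 2) `^ (- (beta / 2)).

Lemma singular_minimax a L eps d I : 0 < a -> 0 < L -> 0 < eps -> 0 < d <= 1 ->
  (\int[mu]_(w in `[0%R, (d^-1)%R]) ((1 + w) `^ (- (2 * beta)))%:E <= I%:E)%E ->
  2 * kappa ^+ 2 * a ^+ 2 * (2 `^ beta * d ^+ 2 * I + d `^ (2 * beta + 1) / (2 * beta + 1))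
    <= eps ^+ 2 ->
  minimax_risk_ge K eps (class_F m a L) (d / 8).
Proof.
move=> a0 L0 e0 /andP[d0 d1] hI hE.
have [s s0 hs] := smooth_scale a0 L0 m1.
apply: (@two_hypotheses_minimax R a s 0 (fun=> 0) (fun=> 1) m L a0 s0) => //.
- by rewrite ltW.
- by rewrite /class_budget big_ord0 add0r.
apply: le_trans (singular_energy_le a K1 beta0 K_decay d0 hI) _.
by rewrite lee_fin.
Qed.

Lemma singular_rate a L : beta < 1 / 2 -> 0 < a -> 0 < L ->
  exists2 c3 : R, 0 < c3 & \forall eps \near (0 : R)^'+,
    minimax_risk_ge K eps (class_F m a L) (c3 * eps `^ (2 / (2 * beta + 1))).
Proof.
move=> b12 a0 L0; have r0 : 0 < 1 - 2 * beta by lra.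
have r1 : 0 < 2 * beta + 1 by rewrite addr_gt0 ?mulr_gt0.
(* The energy is at most A d^(2 beta + 1). *)
pose A := 2 * kappa ^+ 2 * a ^+ 2 *
  (2 `^ beta * (2 `^ (1 - 2 * beta) / (1 - 2 * beta)) + (2 * beta + 1)^-1).
have A0 : 0 < A.
  rewrite mulr_gt0 ?mulr_gt0 ?exprn_gt0// addr_gt0 ?invr_gt0//.
  by rewrite mulr_gt0 ?powR_gt0// divr_gt0 ?powR_gt0.
pose c := A^-1 `^ (2 * beta + 1)^-1.
have c0 : 0 < c by rewrite powR_gt0 ?invr_gt0.
exists (c / 8); first by rewrite divr_gt0.
have p0 : 0 < 2 / (2 * beta + 1) by rewrite divr_gt0.
near=> eps; have e0 : 0 < eps by [].
pose d := c * eps `^ (2 / (2 * beta + 1)).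
have d0 : 0 < d by apply: mulr_gt0 => //; exact: powR_gt0.
have d1 : d <= 1 by rewrite /d; near: eps; exact: near0_powR_le1.
rewrite [c / 8 * _](_ : _ = d / 8); last by rewrite /d; ring.
pose I := (2 / d) `^ (1 - 2 * beta) / (1 - 2 * beta).
apply: (@singular_minimax a L eps d I) => //; first by rewrite d0.
  rewrite powR_shift_integral ?invr_gt0//; last by lra.
  rewrite lee_fin ler_wpM2r ?invr_ge0 ?(ltW r0)//.
  apply: (@le_trans _ _ ((1 + d^-1) `^ (1 - 2 * beta))); first by rewrite gerBl.
  have i1 : 1 <= d^-1 by rewrite invf_ge1.
  apply: ge0_ler_powR; rewrite ?nnegrE ?(ltW r0)//; first by lra.
    by rewrite divr_ge0// ltW.
  by lra.
have dI : d ^+ 2 * I = 2 `^ (1 - 2 * beta) / (1 - 2 * beta) * d `^ (2 * beta + 1).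
  rewrite /I powRM ?invr_ge0 ?(ltW d0)// -(@powR_inv1 _ d) ?(ltW d0)// -powRrM.
  rewrite -(@powR_mulrn _ d) ?(ltW d0)//.
  have -> : d `^ (2 * beta + 1) = d `^ 2%:R * d `^ (-1 * (1 - 2 * beta)).
    by rewrite -powR_gt0D//; congr (_ `^ _); ring.
  by ring.
rewrite -[2 `^ beta * _ * I]mulrA dI.
have dE : d `^ (2 * beta + 1) = A^-1 * eps ^+ 2.
  rewrite powRM ?(ltW c0) ?powR_ge0// -!powRrM mulVf ?gt_eqF//.
  rewrite powRr1 ?invr_ge0 ?(ltW A0)//; congr (_ * _).
  by rewrite -(@powR_mulrn _ eps) ?(ltW e0)//; congr (_ `^ _); field; rewrite gt_eqF.
rewrite (_ : 2 * kappa ^+ 2 * a ^+ 2 * _ = A * d `^ (2 * beta + 1)); last by rewrite /A; ring.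
by rewrite dE mulVKf ?gt_eqF.
Unshelve. all: by end_near. Qed.

(** The logarithm comes from ln(1 + 1/d), where 1/d is at most a fixed power of 1/eps. *)
Lemma critical_rate a L : beta = 1 / 2 -> 0 < a -> 0 < L ->
  exists2 c2 : R, 0 < c2 & \forall eps \near (0 : R)^'+,
    minimax_risk_ge K eps (class_F m a L) (c2 * eps * ln (1 / eps) `^ (- (1 / 2))).
Proof.
move=> b12 a0 L0.
have ka0 : 0 < kappa * a by rewrite mulr_gt0.
pose c := Num.min 1 (4 * (kappa * a))^-1.
have c0 : 0 < c by rewrite lt_min ltr01 invr_gt0 mulr_gt0.
have c1 : c <= 1 by rewrite ge_min lexx.
have ck : 16 * (kappa * a * c) ^+ 2 <= 1.
  have : kappa * a * c <= 4^-1.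
    have : c <= (4 * (kappa * a))^-1 by rewrite ge_min lexx orbT.
    move=> /(ler_wpM2l (ltW ka0)) /le_trans; apply.
    by rewrite invfM mulrCA mulfV ?gt_eqF// mulr1.
  have : 0 <= kappa * a * c by rewrite mulr_ge0 ?ltW.
  by move: (kappa * a * c) => x; nra.
exists (c / 8); first by rewrite divr_gt0.
near=> eps; have e0 : 0 < eps by [].
have e1 : eps <= expR (-1) by near: eps; apply: nbhs_right_le; exact: expR_gt0.
have ec : eps <= c / 2 by near: eps; apply: nbhs_right_le; rewrite divr_gt0.
pose l := ln (1 / eps); have ei0 : 0 < 1 / eps by rewrite divr_gt0.
have l1 : 1 <= l.
  rewrite -(expRK 1) ler_ln ?posrE ?expR_gt0// div1r -[expR 1]invrK -expRN.
  by rewrite lef_pV2 ?posrE ?expR_gt0.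
have l0 : 0 < l by exact: lt_le_trans l1.
have le : l <= eps^-1.
  have := @le_ln1Dx R (1 / eps - 1); rewrite [1 + _]addrC subrK -/l => h.
  have : l <= 1 / eps - 1 by apply: h; lra.
  by rewrite div1r; lra.
(* d is proportional to eps l^(-1/2) and d^2 l to eps^2. *)
pose r := l `^ (- (1 / 2)); pose d := c * eps * r.
have r0 : 0 < r by rewrite powR_gt0.
have r2 : r ^+ 2 * l = 1.
  rewrite powR_sqr ?(ltW l0)// (_ : 2 * - (1 / 2) = -1); last by field.
  by rewrite powR_inv1 ?(ltW l0)// mulVf ?gt_eqF.
have d0 : 0 < d by rewrite !mulr_gt0.
have r1 : r <= 1 by nra.
have eps1 : eps <= 1 by lra.
have d1 : d <= 1.
  rewrite /d; have ce : c * eps <= 1 by nra.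
  have ce0 : 0 < c * eps by rewrite mulr_gt0.
  by nra.
rewrite [c / 8 * _ * _](_ : _ = d / 8); last by rewrite /d /r /l; ring.
(* 1/d <= eps^-2 / c, and eps <= c / 2 absorbs the constant into a third power. *)
have hI : 1 + d^-1 <= (1 / eps) ^+ 3.
  have dV : d^-1 = c^-1 * eps^-1 * r^-1 by rewrite /d !invfM.
  have rV : r^-1 <= eps^-1.
    apply: le_trans le; rewrite -[leRHS](mulr1 l) -ler_pdivrMl// -invfM.
    rewrite invf_le1; first by nra.
    by rewrite mulr_gt0.
  rewrite div1r dV; have c1' : 1 <= c^-1 by rewrite invf_ge1.
  have ec' : 2 * c^-1 <= eps^-1.
    rewrite -(invrK 2) -invfM lef_pV2 ?posrE ?mulr_gt0 ?invr_gt0//; lra.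
  have x0 : 0 < eps^-1 by rewrite invr_gt0.
  have rv0 : 0 < r^-1 by rewrite invr_gt0.
  move: (eps^-1) (c^-1) (r^-1) rV c1' ec' x0 rv0 => x y z zx y1 yx x0 z0.
  have h1 : y * x * z <= y * x * x by rewrite ler_wpM2l// mulr_ge0; lra.
  have h2 : 2 * y * x ^+ 2 <= x * x ^+ 2 by rewrite ler_wpM2r// sqr_ge0.
  have h3 : 1 <= y * x ^+ 2 by rewrite mulr_ege1// exprn_ege1//; lra.
  have -> : x ^+ 3 = x * x ^+ 2 by ring.
  have : y * x * x = y * x ^+ 2 by ring.
  by lra.
apply: (@singular_minimax a L eps d (3 * l)) => //; first by rewrite d0.
  rewrite b12 (_ : 2 * (1 / 2) = 1); last by field.
  rewrite inv_shift_integral ?invr_gt0// lee_fin.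
  have -> : 3 * l = ln ((1 / eps) ^+ 3) by rewrite lnXn// mulr_natl.
  by rewrite ler_ln ?posrE ?exprn_gt0// addr_gt0 ?invr_gt0.
have -> : 2 * beta + 1 = 2%:R by rewrite b12; field.
rewrite powR_mulrn ?(ltW d0)//.
have b2 : 2 `^ beta <= 2 :> R.
  rewrite -[leRHS]powRr1// ler_powR ?ler1n//; lra.
have -> : d ^+ 2 = c ^+ 2 * eps ^+ 2 * r ^+ 2 by rewrite /d; ring.
have b2' : 0 <= 2 `^ beta :> R by exact: powR_ge0.
have k0 : 0 <= (kappa * a * c) ^+ 2 by exact: sqr_ge0.
have e2 : 0 <= eps ^+ 2 by exact: sqr_ge0.
have r20 : 0 <= r ^+ 2 by exact: sqr_ge0.
have r21 : r ^+ 2 <= 1 by nra.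
rewrite (_ : _ * _ = (kappa * a * c) ^+ 2 * eps ^+ 2 * (6 * 2 `^ beta * (r ^+ 2 * l) + r ^+ 2)).
  rewrite r2; set X := 6 * _ * _ + _.
  have X13 : X <= 16 by rewrite /X; lra.
  rewrite mulrAC ler_piMl//; apply: le_trans ck; rewrite mulrC.
  by rewrite ler_wpM2r.
by field.
Unshelve. all: by end_near. Qed.

Lemma regular_rate : 1 / 2 < beta ->
  exists2 c1 : R, 0 < c1 & forall a L, 0 < a -> 0 < L -> \forall eps \near (0 : R)^'+,
    minimax_risk_ge K eps (class_F m a L)
      (c1 * a^-1 * L `^ ((2 * beta - 1) / (2 * beta + 2 * m + 1))
        * eps `^ ((2 * m + 2) / (2 * m + 2 * beta + 1))).
Proof.
move=> b12; have b1 : 1 < 2 * beta by lra.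
have m0 : 0 < m by exact: lt_le_trans m1.
have [k bk] : exists k : nat, beta <= (2 * k)%:R.
  exists (Num.truncn beta).+1; rewrite mul2n -addnn natrD.
  by apply: (le_trans (ltW (truncnS_gt beta))); rewrite lerDl.
have [C C0 hC] := @gauss_moment R m (ltW m0).
(* V and S C bound the energy and the budget; c is small in terms of both, not of a and L. *)
pose S : R := \sum_(j < k) `|binomial_coef R k j|.
have S0 : 0 <= S by exact: sumr_ge0.
have pi0 := @pi_gt0 R.
pose V := 2 * kappa ^+ 2 * ((2 * pi ^+ 2) `^ beta + (2 * beta - 1)^-1).
have V0 : 0 <= V.
  apply: mulr_ge0; first by apply: mulr_ge0 => //; exact: sqr_ge0.
  by apply: addr_ge0; [exact: powR_ge0|rewrite invr_ge0; lra].
have W0 : 0 <= 4 * pi * S * C by rewrite !mulr_ge0// ltW.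
pose c := (V + 1 + 4 * pi * S * C)^-1.
have D0 : 0 < V + 1 + 4 * pi * S * C by lra.
have c0 : 0 < c by rewrite invr_gt0.
have cD : c * (V + 1 + 4 * pi * S * C) = 1 by rewrite /c mulVf// gt_eqF.
have cV : 0 <= c * V by rewrite mulr_ge0// ltW.
have cW : 0 <= c * (4 * pi * S * C) by rewrite mulr_ge0// ltW.
have {}cD : c * V + c + c * (4 * pi * S * C) = 1 by rewrite -[RHS]cD; ring.
have Vc : V * c ^+ 2 <= 1.
  have -> : V * c ^+ 2 = c * V * c by ring.
  by move: (c * V) (c * _) cV cW cD => x y x0 y0 e; nra.
have Wc : S * (c * (2 * pi)) * C <= 1 / 2.
  have -> : S * (c * (2 * pi)) * C = c * (4 * pi * S * C) / 2 by field.
  by move: (c * V) (c * _) cV cW cD => x y x0 y0 e; lra.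
exists (c / 8); first by rewrite divr_gt0.
move=> a L a0 L0; have L2 : 0 < L / 2 by rewrite divr_gt0.
have [s s0 hs] := smooth_scale a0 L2 m1.
pose q := 2 * beta + 2 * m + 1; have q0 : 0 < q.
  by rewrite addr_gt0// addr_gt0 ?mulr_gt0.
have qn : q != 0 by rewrite gt_eqF.
rewrite (_ : 2 * m + 2 * beta + 1 = q); last by rewrite /q; ring.
pose u := (2 * beta - 1) / q; pose v := (2 * m + 2) / q; rewrite -/q -/u -/v.
have uv : u + v = 1.
  by rewrite /u /v -mulrDl (_ : 2 * beta - 1 + (2 * m + 2) = q) ?mulfV// /q; ring.
have v0 : 0 < v by rewrite divr_gt0// addr_gt0 ?mulr_gt0.
pose A := c * a^-1 * L `^ u.
have A0 : 0 < A by apply: mulr_gt0; [rewrite divr_gt0|exact: powR_gt0].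
near=> eps; have e0 : 0 < eps by [].
(* a d t^-(m+1) = c L and (a d)^2 t^(2 beta - 1) = c^2 eps^2. *)
pose t := (eps / L) `^ (2 / q); pose d := A * eps `^ v.
have eL0 : 0 < eps / L by rewrite divr_gt0.
have t0 : 0 < t by exact: powR_gt0.
have d0 : 0 < d by apply: mulr_gt0 => //; exact: powR_gt0.
have d1 : d <= 1 by rewrite /d; near: eps; exact: near0_powR_le1.
have ad : a * d = c * (L `^ u * eps `^ v) by rewrite /d /A; field; rewrite gt_eqF.
have tv : t `^ (- (m + 1)) = L `^ v * eps `^ (- v).
  rewrite -powRrM (_ : 2 / q * - (m + 1) = - v); last by rewrite /v; field.
  rewrite powRM ?invr_ge0 ?(ltW e0) ?(ltW L0)// mulrC; congr (_ * _).
  by rewrite -(@powR_inv1 _ L) ?(ltW L0)// -powRrM mulrNN mul1r.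
have adt : a * d * t `^ (- (m + 1)) = c * L.
  rewrite ad tv powRN; have := powR_gt0 v e0; move: (eps `^ v) => x x0.
  have Luv : L `^ u * L `^ v = L by rewrite -powR_gt0D// uv powRr1// ltW.
  by rewrite -[X in _ = c * X]Luv; field; rewrite gt_eqF.
have adt2 : (a * d) ^+ 2 * t `^ (2 * beta - 1) = c ^+ 2 * eps ^+ 2.
  have -> : t `^ (2 * beta - 1) = (eps `^ u / L `^ u) ^+ 2.
    rewrite -powRrM (_ : 2 / q * (2 * beta - 1) = 2 * u); last by rewrite /u; field.
    rewrite -powR_sqr ?(ltW eL0)// powRM ?invr_ge0 ?(ltW e0) ?(ltW L0)//.
    by rewrite -(@powR_inv1 _ L) ?(ltW L0)// -powRrM mulN1r powRN.
  rewrite ad -exprMn; have := powR_gt0 u L0; move: (L `^ u) => x x0.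
  have euv : eps `^ u * eps `^ v = eps by rewrite -powR_gt0D// uv powRr1// ltW.
  by rewrite -[X in _ = _ * X ^+ 2]euv; field; rewrite gt_eqF.
rewrite (_ : c / 8 * a^-1 * L `^ u * eps `^ v = d / 8); last by rewrite /d /A; ring.
apply: (@two_hypotheses_minimax R a s k (binomial_coef R k) (binomial_scale t) m L a0 s0) => //.
- exact: binomial_scale_gt0.
- by rewrite ltW.
- have -> : L = S * (c * (2 * pi)) * C * L + (1 - S * (c * (2 * pi)) * C) * L by ring.
  rewrite /class_budget mulrDr; apply: lerD; last first.
    by apply: le_trans hs _; rewrite mulrC ler_wpM2r ?(ltW L0)//; lra.
  have -> : S * (c * (2 * pi)) * C * L = a * (S * (d * (2 * pi) * (C * t `^ (- (m + 1))))).
    have -> : S * (c * (2 * pi)) * C * L = S * (2 * pi) * C * (c * L) by ring.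
    by rewrite -adt; ring.
  rewrite ler_wpM2l ?(ltW a0)// /S mulr_suml; apply: ler_sum => j _.
  have d2 : 0 <= d * (2 * pi) by apply: mulr_ge0 (ltW d0) _; exact: mulr_ge0 (ltW pi0).
  rewrite ler_wpM2l// ler_wpM2l//.
  have [_ h] := hC _ (binomial_scale_gt0 t0 j).
  apply: le_trans h _; rewrite ler_wpM2l ?(ltW C0)//.
  by apply: powRN_anti; rewrite ?binomial_scale_ge// ltW// addr_gt0.
apply: le_trans (regular_energy_le a K1 beta0 K_decay d0 t0 b1 bk (binomial_mixture_hat k t0)) _.
by rewrite lee_fin -/V -mulrA adt2 mulrA ler_piMl ?sqr_ge0.
Unshelve. all: by end_near. Qed.

End kernel.
End rates.

Theorem theorem2 (R : realType) (K : R -> R) (beta kappa m : R)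
    (K_L1 : K \in Lfun (@lebesgue_measure R) 1%E)
    (beta_gt0 : 0 < beta) (kappa_gt0 : 0 < kappa)
    (K_decay : forall omega : R,
       Normc.normc (fourier K omega) <= kappa * (1 + `|omega| ^+ 2) `^ (- (beta / 2)))
    (K_neq0 : forall omega : R, Normc.normc (fourier K omega) != 0)
    (m_ge1 : 1 <= m) :
  [/\ 1 / 2 < beta ->
        exists2 c1 : R, 0 < c1 &
        forall a L : R, 0 < a -> 0 < L ->
        \forall eps \near (0 : R)^'+,
          minimax_risk_ge K eps (class_F m a L)
            (c1 * a^-1 * L `^ ((2 * beta - 1) / (2 * beta + 2 * m + 1))
              * eps `^ ((2 * m + 2) / (2 * m + 2 * beta + 1))),
      beta = 1 / 2 ->
        forall a L : R, 0 < a -> 0 < L ->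
        exists2 c2 : R, 0 < c2 &
        \forall eps \near (0 : R)^'+,
          minimax_risk_ge K eps (class_F m a L)
            (c2 * eps * ln (1 / eps) `^ (- (1 / 2))) &
      beta < 1 / 2 ->
        forall a L : R, 0 < a -> 0 < L ->
        exists2 c3 : R, 0 < c3 &
        \forall eps \near (0 : R)^'+,
          minimax_risk_ge K eps (class_F m a L)
            (c3 * eps `^ (2 / (2 * beta + 1)))].
Proof.
have K1 : L1 K by apply/Lfun1_integrable.
split.
- exact: (regular_rate K1 beta_gt0 m_ge1 K_decay).
- by move=> b a L; exact: (critical_rate K1 beta_gt0 kappa_gt0 m_ge1 K_decay b).
- by move=> b a L; exact: (singular_rate K1 beta_gt0 kappa_gt0 m_ge1 K_decay b).
Qed.
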